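(* Assume the $k$-Cycle Hypothesis. Then there is no constant $\varepsilon>0$ such that partially dynamic $s$-$t$ Shortest Path in undirected graphs can be solved with $O(m^{2-\varepsilon})$ preprocessing time and $O(m^{1-\varepsilon})$ (amortized) update and query time, for all graph sparsities $m$.
   Context: $k$-Cycle Hypothesis: in the word-RAM model with $O(\log m)$-bit words, for every constant $\varepsilon>0$ there exists a constant integer $k$ such that there is no $O(m^{2-\varepsilon})$ time algorithm that detects whether an $m$-edge graph contains a cycle on $k$ vertices. In the partially dynamic $s$-$t$ Shortest Path problem, a graph undergoes either only edge insertions (incremental) or only edge deletions (decremental), two fixed vertices $s,t$ are given, and queries ask for the current shortest-path distance from $s$ to $t$; $m$ is the maximum number of edges of the graph. *)

(* Defs.v *)
From Stdlib Require Import Reals List Arith.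
Import ListNotations.

(** * Word RAM *)

Inductive binop : Set :=
  Add | Sub | Mul | Div | Mod | And | Or | Xor | Shl | Shr.

Inductive instr : Set :=
| Const (r v : nat)            (* R[r] := v *)
| Op (o : binop) (r a b : nat) (* R[r] := R[a] o R[b] *)
| Read (r a : nat)             (* R[r] := M[R[a]] *)
| Write (a b : nat)            (* M[R[a]] := R[b] *)
| Jump (l : nat)
| JumpLt (a b l : nat)         (* if R[a] < R[b] then goto l *)
| Halt.

Definition program : Set := list instr.

Record state : Set := State { pc : nat; reg : nat -> nat; mem : nat -> nat }.

Definition trunc (w x : nat) : nat := x mod 2 ^ w.

Definition eval_op (w : nat) (o : binop) (x y : nat) : nat :=
  trunc w
    match o with
    | Add => x + y
    | Sub => x + (2 ^ w - y)
    | Mul => x * y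
    | Div => x / y
    | Mod => x mod y
    | And => Nat.land x y
    | Or => Nat.lor x y
    | Xor => Nat.lxor x y
    | Shl => Nat.shiftl x y
    | Shr => Nat.shiftr x y
    end.

Definition upd (f : nat -> nat) (a v : nat) : nat -> nat :=
  fun b => if b =? a then v else f b.

(** One unit-cost step with [w]-bit words; [None] when the machine has halted,
    by [Halt] or by leaving the program text.  Registers only ever hold numbers
    below [2 ^ w], so only the addresses below [2 ^ w] are reachable. *)
Definition step (w : nat) (P : program) (x : state) : option state :=
  let R := reg x in
  let next := S (pc x) in
  match nth_error P (pc x) with
  | Some (Const r v) => Some (State next (upd R r (trunc w v)) (mem x))
  | Some (Op o r a b) =>
      Some (State next (upd R r (eval_op w o (R a) (R b))) (mem x))
  | Some (Read r a) => Some (State next (upd R r (mem x (R a))) (mem x))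
  | Some (Write a b) => Some (State next R (upd (mem x) (R a) (R b)))
  | Some (Jump l) => Some (State l R (mem x))
  | Some (JumpLt a b l) =>
      Some (State (if R a <? R b then l else next) R (mem x))
  | Some Halt | None => None
  end.

(** [exec w P x T y]: started in [x], [P] halts in [y] after exactly [T] steps. *)
Inductive exec (w : nat) (P : program) : state -> nat -> state -> Prop :=
| exec_halt x : step w P x = None -> exec w P x 0 x
| exec_step x y z T :
    step w P x = Some y -> exec w P y T z -> exec w P x (S T) z.

(** The words of a list laid out from index 0 and followed by zeros; entries
    that do not fit in a word are truncated. *)
Definition words (w : nat) (l : list nat) : nat -> nat :=
  fun a => trunc w (nth a l 0).

Definition start (w : nat) (args : list nat) (M : nat -> nat) : state :=
  State 0 (words w args) M.

(** Words of [O(log m)] bits: the constant [c] is chosen by the algorithm. *)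
Definition word_size (c m : nat) : nat := c * (Nat.log2 m + 1).

(** * Graphs, as lists of edges on the vertex set [{0, ..., n - 1}] *)

Inductive orientation : Set := Directed | Undirected.

Definition edge (o : orientation) (E : list (nat * nat)) (u v : nat) : Prop :=
  In (u, v) E \/ (o = Undirected /\ In (v, u) E).

Definition simple_graph (o : orientation) (n : nat) (E : list (nat * nat))
    : Prop :=
  NoDup E /\
  (forall u v, In (u, v) E -> u < n /\ v < n /\ u <> v) /\
  (o = Undirected -> forall u v, In (u, v) E -> ~ In (v, u) E).

Definition has_cycle (o : orientation) (k : nat) (E : list (nat * nat))
    : Prop :=
  exists p : list nat,
    length p = k /\ NoDup p /\
    forall i, i < k -> edge o E (nth i p 0) (nth ((i + 1) mod k) p 0).

(** * The k-Cycle Hypothesis *)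

Definition edge_words (E : list (nat * nat)) : list nat :=
  flat_map (fun '(u, v) => [u; v]) E.

(** Words of [O(log m)] bits can only name vertices of graphs in which [n] is
    bounded in terms of [m]; [n <= 2 * m] holds once isolated vertices are
    dropped.  [n] and [m] are passed in registers 0 and 1, the edge list in
    memory, and the answer (nonzero for "yes") is returned in register 0. *)
Definition cycle_detection_in_time
    (o : orientation) (k : nat) (bound : nat -> R) : Prop :=
  exists (P : program) (c : nat) (K : R),
  forall (n : nat) (E : list (nat * nat)),
    let m := length E in
    let w := word_size c m in
    simple_graph o n E -> 1 <= m -> n <= 2 * m ->
    exists (T : nat) (x : state),
      exec w P (start w [n; m] (words w (edge_words E))) T x /\
      (reg x 0 <> 0 <-> has_cycle o k E) /\
      (INR T <= K * bound m)%R.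

Definition k_cycle_hypothesis (o : orientation) : Prop :=
  forall eps : R, (0 < eps)%R ->
  exists k : nat, 3 <= k /\
    ~ cycle_detection_in_time o k (fun m => Rpower (INR m) (2 - eps)).

(** * Partially dynamic s-t Shortest Path *)

(** [((u, v), x)]: an undirected edge between [u] and [v] of length [x]. *)
Definition wedge : Set := ((nat * nat) * nat)%type.

Definition wedge_words (E : list wedge) : list nat :=
  flat_map (fun '((u, v), x) => [u; v; x]) E.

Inductive walk (E : list wedge) : nat -> nat -> nat -> Prop :=
| walk_nil u : walk E u u 0
| walk_cons u v t x d :
    In ((u, v), x) E \/ In ((v, u), x) E ->
    walk E v t d -> walk E u t (x + d).

Definition is_distance (E : list wedge) (s t d : nat) : Prop :=
  walk E s t d /\ forall d', walk E s t d' -> d <= d'.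

(** A finite distance [d] is reported as [S d], an infinite one as [0]. *)
Definition is_answer (E : list wedge) (s t a : nat) : Prop :=
  match a with
  | 0 => forall d, ~ walk E s t d
  | S d => is_distance E s t d
  end.

Inductive operation : Set :=
| Insert (u v x : nat)
| Delete (u v : nat)
| Query.

Definition joins (u v : nat) (e : wedge) : bool :=
  let '((a, b), _) := e in
  ((a =? u) && (b =? v)) || ((a =? v) && (b =? u)).

Definition apply_op (q : operation) (E : list wedge) : list wedge :=
  match q with
  | Insert u v x => ((u, v), x) :: E
  | Delete u v => filter (fun e => negb (joins u v e)) E
  | Query => E
  end.

Fixpoint max_edges (E : list wedge) (ops : list operation) : nat :=
  match ops with
  | [] => length E
  | q :: ops' => Nat.max (length E) (max_edges (apply_op q E) ops')
  end.

Inductive mode : Set := Incremental | Decremental.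

Definition weighted_graph (n W : nat) (E : list wedge) : Prop :=
  simple_graph Undirected n (map fst E) /\
  forall e, In e E -> 1 <= snd e <= W.

Definition allowed (md : mode) (E : list wedge) (q : operation) : Prop :=
  match q with
  | Insert _ _ _ => md = Incremental
  | Delete u v => md = Decremental /\ exists e, In e E /\ joins u v e = true
  | Query => True
  end.

(** The graph is simple with lengths in [1..W] initially and after each
    operation; in particular an inserted edge is not already present. *)
Fixpoint valid_ops (md : mode) (n W : nat) (E : list wedge)
    (ops : list operation) : Prop :=
  weighted_graph n W E /\
  match ops with
  | [] => True
  | q :: ops' => allowed md E q /\ valid_ops md n W (apply_op q E) ops'
  end.

Record dynamic_algorithm : Set := DynamicAlgorithm {
  preprocess : program;
  insert_code : program;
  delete_code : program;
  query_code : program }.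

(** [serves w D s t E M ops T]: with current graph [E] and current memory [M],
    [D] processes [ops] one at a time in [T] steps altogether, answering every
    query correctly in register 0.  The arguments of an operation are passed in
    registers and the memory is kept from one operation to the next. *)
Inductive serves (w : nat) (D : dynamic_algorithm) (s t : nat) :
    list wedge -> (nat -> nat) -> list operation -> nat -> Prop :=
| serves_nil E M : serves w D s t E M [] 0
| serves_insert E M u v x ops T1 T2 y :
    exec w (insert_code D) (start w [u; v; x] M) T1 y ->
    serves w D s t (apply_op (Insert u v x) E) (mem y) ops T2 ->
    serves w D s t E M (Insert u v x :: ops) (T1 + T2)
| serves_delete E M u v ops T1 T2 y :
    exec w (delete_code D) (start w [u; v] M) T1 y ->
    serves w D s t (apply_op (Delete u v) E) (mem y) ops T2 ->
    serves w D s t E M (Delete u v :: ops) (T1 + T2)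
| serves_query E M ops T1 T2 y :
    exec w (query_code D) (start w [] M) T1 y ->
    is_answer E s t (reg y 0) ->
    serves w D s t E (mem y) ops T2 ->
    serves w D s t E M (Query :: ops) (T1 + T2).

(** Preprocessing in [O(pre_bound m)] time and amortized [O(op_bound m)] time
    per update and query, [m] being the maximum number of edges over time.
    Edge lengths are integers in [1 .. m ^ d]: [d = 0] is the unweighted
    problem, larger [d] allows polynomially bounded lengths. *)
Definition dynamic_st_shortest_path_in_time
    (md : mode) (d : nat) (pre_bound op_bound : nat -> R) : Prop :=
  exists (D : dynamic_algorithm) (c : nat) (K : R),
  forall (n s t : nat) (E : list wedge) (ops : list operation),
    let m := max_edges E ops in
    let w := word_size c m in
    valid_ops md n (m ^ d) E ops ->
    s < n -> t < n -> 1 <= m -> n <= 2 * m ->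
    exists (Tpre Tops : nat) (x : state),
      exec w (preprocess D)
        (start w [n; m; s; t; length E] (words w (wedge_words E))) Tpre x /\
      (INR Tpre <= K * pre_bound m)%R /\
      serves w D s t E (mem x) ops Tops /\
      (INR Tops <= K * (INR (length ops) * op_bound m))%R.

(* Main.v *)
From Stdlib Require Import Reals ZArith List Arith Lia Lra FunctionalExtensionality.
Require Import Defs.
Import ListNotations.

(** Colour the vertices with [0, ..., k - 1] and keep only the arcs from a colour
    to its cyclic successor; a [k]-cycle through a vertex [v] of colour [0] that
    meets every colour is a path with [k] arcs from a copy of [v] in a first layer
    to a copy of [v] in a last layer.  Hang the first layer on a path starting at
    [s], the last layer on a path ending at [t], the copies of vertex [i] being
    attached at distance [i] from the ends.  When only the attachments with index
    at least [i] are present, every [s]-[t] walk has length at least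
    [2 i + k + 2], with equality exactly when vertex [i] lies on such a cycle.  So
    linearly many deletions (or, in reverse, insertions) and queries on a graph
    with [10 m] edges decide whether a coloured cycle exists.

    Colour coding is derandomised by decision lists of [k] steps, each of which
    recolours the vertices of one colour having one prescribed bit: polylogarithmically
    many lists suffice, which costs less than a factor [m ^ (eps / 2)].  For each of
    them the dynamic algorithm is simulated, with its own word size, in a fresh
    region of memory. *)

(** * A structured language compiled to the word RAM *)

(** The word size of the dynamic algorithm depends on the exact maximum number of edges. The
    reduction needs longer words than the algorithm that it runs, so foreign code cannot be inlined
    unchanged. The difference also helps: a simulated machine can only address its own short range,
    so it never leaves its region, while the longer words suffice to address all regions. Fresh
    regions are used because preprocessing expects zeros after its input, and nothing has to be
    erased this way. Vertices of colour zero are split into a source and a sink, so that a closed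
    walk becomes a path climbing through the layers. All edges have length 1, which is why the
    result covers the unweighted problem and every polynomial range of lengths alike. *)

Inductive var : Set :=
| vFound | vm | vN | vM | vW | vS | vL | vD | vZ | vBase | vz | vPtr | vI
| vU | vV | vX | vY | vQ | vT | vCu | vCv | vR.

Scheme Equality for var.

(** The calling convention fixes two places: [m] arrives in register 1, and the answer is read from
    register 0. *)
Definition idx (x : var) : nat :=
  match x with
  | vFound => 0 | vm => 1 | vN => 2 | vM => 3 | vW => 4 | vS => 5 | vL => 6
  | vD => 7 | vZ => 8 | vBase => 9 | vz => 10 | vPtr => 11 | vI => 12
  | vU => 13 | vV => 14 | vX => 15 | vY => 16 | vQ => 17 | vT => 18
  | vCu => 19 | vCv => 20 | vR => 21
  end.

(** Variables live below [scratch]; [scratch] holds the addresses formed during simulation; from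
    [tmp] on come the expression stack and, during a call, the registers of the simulated
    machine. *)
Definition scratch := 31.
Definition tmp := 32.

Lemma idx_lt x : idx x < scratch.
Proof. destruct x; unfold scratch; simpl; lia. Qed.

Lemma idx_inj x y : idx x = idx y -> x = y.
Proof. destruct x, y; simpl; intros H; try reflexivity; discriminate H. Qed.

Definition env := var -> nat.

Definition set (s : env) (x : var) (v : nat) : env :=
  fun y => if var_beq y x then v else s y.

Inductive expr : Set :=
| V (x : var)
| C (v : nat)
| B (o : binop) (e1 e2 : expr).

Definition ideal_op (o : binop) (x y : nat) : nat :=
  match o with
  | Add => x + y
  | Sub => x - y
  | Mul => x * y
  | Div => x / y
  | Mod => x mod y
  | And => Nat.land x y
  | Or => Nat.lor x y
  | Xor => Nat.lxor x y
  | Shl => Nat.shiftl x y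
  | Shr => Nat.shiftr x y
  end.

Fixpoint ev (s : env) (e : expr) : nat :=
  match e with
  | V x => s x
  | C v => v
  | B o e1 e2 => ideal_op o (ev s e1) (ev s e2)
  end.

(** Under this condition no intermediate value overflows and no subtraction goes below zero, so
    machine arithmetic coincides with [ev]. *)
Fixpoint safe (w : nat) (s : env) (e : expr) : Prop :=
  match e with
  | V x => s x < 2 ^ w
  | C v => v < 2 ^ w
  | B o e1 e2 =>
      safe w s e1 /\ safe w s e2 /\
      ideal_op o (ev s e1) (ev s e2) < 2 ^ w /\
      match o with Sub => ev s e2 <= ev s e1 | _ => True end
  end.

(** [While e1 e2 c] repeats [c] as long as [e1] is less than [e2]; [Call] runs a foreign program by
    simulation and stores its register 0 in [x]. *)
Inductive cmd : Set :=
| Skip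
| Asg (x : var) (e : expr)
| Fetch (x : var) (e : expr)
| Store (e1 e2 : expr)
| Seq (c1 c2 : cmd)
| IfEq (e1 e2 : expr) (c1 c2 : cmd)
| While (e1 e2 : expr) (c : cmd)
| Call (Q : program) (args : list expr) (x : var).

(** Registers from [t] upwards serve as a stack. The machine has no move instruction; [Or] of a
    register with itself copies it. *)
Fixpoint comp_expr (e : expr) (t : nat) : program :=
  match e with
  | V x => [Op Or t (idx x) (idx x)]
  | C v => [Const t v]
  | B o e1 e2 => comp_expr e1 t ++ comp_expr e2 (S t) ++ [Op o t t (S t)]
  end.

Fixpoint esize (e : expr) : nat :=
  match e with
  | V _ | C _ => 1
  | B _ e1 e2 => esize e1 + (esize e2 + 1)
  end.

Definition instr_regs (i : instr) : nat :=
  match i with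
  | Const r _ => S r
  | Op _ r a b => S (Nat.max r (Nat.max a b))
  | Read r a => S (Nat.max r a)
  | Write a b => S (Nat.max a b)
  | Jump _ => 0
  | JumpLt a b _ => S (Nat.max a b)
  | Halt => 0
  end.

(** The outer [S] makes register 0 count even if [Q] never mentions it, since the result is read
    there. *)
Definition prog_regs (Q : program) : nat :=
  S (fold_right (fun i n => Nat.max (instr_regs i) n) 0 Q).

(** Every simulated instruction occupies two cells; the address of the
    simulated cell [a] is [a] plus the current base, and every computed value is
    reduced modulo the simulated word range held in [vW]. *)
Definition sim_instr (b n : nat) (i : instr) : program :=
  let target l := b + 2 * Nat.min l n in
  match i with
  | Const r v => [Const (tmp + r) v; Op Mod (tmp + r) (tmp + r) (idx vW)]
  | Op o r a c =>
      [Op o (tmp + r) (tmp + a) (tmp + c);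
       Op Mod (tmp + r) (tmp + r) (idx vW)]
  | Read r a => [Op Add scratch (idx vBase) (tmp + a); Read (tmp + r) scratch]
  | Write a c => [Op Add scratch (idx vBase) (tmp + a); Write scratch (tmp + c)]
  | Jump l => [Jump (target l); Const scratch 0]
  | JumpLt a c l => [JumpLt (tmp + a) (tmp + c) (target l); Const scratch 0]
  | Halt => [Jump (b + 2 * n); Const scratch 0]
  end.

Definition sim (Q : program) (b : nat) : program :=
  flat_map (sim_instr b (length Q)) Q.

Fixpoint comp_args (args : list expr) (t : nat) : program :=
  match args with
  | [] => []
  | e :: args' => comp_expr e t ++ [Op Mod t t (idx vW)] ++ comp_args args' (S t)
  end.

Definition zero_regs (t n : nat) : program :=
  map (fun j => Const j 0) (seq t n).

(** [start] truncates the arguments and puts zeros in all other registers, so whatever earlier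
    computations left in the registers of [Q] has to be erased. *)
Definition call_setup (Q : program) (args : list expr) : program :=
  comp_args args tmp ++ zero_regs (tmp + length args) (prog_regs Q).

Fixpoint csize (c : cmd) : nat :=
  match c with
  | Skip => 0
  | Asg _ e => esize e + 1
  | Fetch _ e => esize e + 1
  | Store e1 e2 => esize e1 + esize e2 + 1
  | Seq c1 c2 => csize c1 + csize c2
  | IfEq e1 e2 c1 c2 => esize e1 + esize e2 + (2 + (csize c1 + (1 + csize c2)))
  | While e1 e2 c => esize e1 + esize e2 + (2 + (csize c + 1))
  | Call Q args _ => length (call_setup Q args) + (2 * length Q + 1)
  end.

(** Jumps are absolute, hence the load address [b]. The only comparison is [JumpLt], so equality is
    tested by two opposite jumps to the else branch. *)
Fixpoint comp (c : cmd) (b : nat) : program :=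
  match c with
  | Skip => []
  | Asg x e => comp_expr e tmp ++ [Op Or (idx x) tmp tmp]
  | Fetch x e => comp_expr e tmp ++ [Read (idx x) tmp]
  | Store e1 e2 =>
      (comp_expr e1 tmp ++ comp_expr e2 (S tmp)) ++ [Write tmp (S tmp)]
  | Seq c1 c2 => comp c1 b ++ comp c2 (b + csize c1)
  | IfEq e1 e2 c1 c2 =>
      let b1 := b + (esize e1 + esize e2) + 2 in
      let b2 := b1 + csize c1 + 1 in
      (comp_expr e1 tmp ++ comp_expr e2 (S tmp)) ++
      [JumpLt tmp (S tmp) b2; JumpLt (S tmp) tmp b2] ++
      comp c1 b1 ++ [Jump (b2 + csize c2)] ++ comp c2 b2
  | While e1 e2 c1 =>
      let b1 := b + (esize e1 + esize e2) + 2 in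
      (comp_expr e1 tmp ++ comp_expr e2 (S tmp)) ++
      [JumpLt tmp (S tmp) b1; Jump (b1 + csize c1 + 1)] ++
      comp c1 b1 ++ [Jump b]
  | Call Q args x =>
      call_setup Q args ++ sim Q (b + length (call_setup Q args)) ++
      [Op Or (idx x) tmp tmp]
  end.

(** * Code sizes, code placement and compiled expressions *)

Lemma comp_expr_length e t : length (comp_expr e t) = esize e.
Proof.
  revert t; induction e as [x|v|o e1 IH1 e2 IH2]; intros t; simpl; auto.
  rewrite !length_app, IH1, IH2; reflexivity.
Qed.

Lemma sim_length Q b : length (sim Q b) = 2 * length Q.
Proof.
  unfold sim. generalize (length Q) at 1; intros n.
  induction Q as [|i Q IH]; [reflexivity|].
  change (length (sim_instr b n i ++ flat_map (sim_instr b n) Q) = 2 * S (length Q)).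
  rewrite length_app, IH. destruct i; simpl; lia.
Qed.

Lemma comp_length c b : length (comp c b) = csize c.
Proof.
  revert b; induction c; intros b; simpl;
    rewrite ?length_app; simpl; rewrite ?length_app, ?comp_expr_length; simpl;
    rewrite ?IHc, ?IHc1, ?IHc2, ?sim_length; simpl; try lia.
Qed.

(** Unlike [exec], this does not ask the last state to be halted, so runs of code fragments can be
    composed. *)
Fixpoint steps (w : nat) (P : program) (n : nat) (x y : state) : Prop :=
  match n with
  | 0 => x = y
  | S n' => exists z, step w P x = Some z /\ steps w P n' z y
  end.

Lemma steps_trans w P n1 n2 x y z :
  steps w P n1 x y -> steps w P n2 y z -> steps w P (n1 + n2) x z.
Proof.
  revert x; induction n1 as [|n1 IH]; intros x; simpl.
  - intros ->; auto.
  - intros (x' & Hx & Hs) H2; exists x'; split; auto.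
Qed.

Lemma steps_exec w P n x y :
  steps w P n x y -> step w P y = None -> exec w P x n y.
Proof.
  revert x; induction n as [|n IH]; intros x; simpl.
  - intros -> H; constructor; auto.
  - intros (x' & Hx & Hs) H; econstructor; eauto.
Qed.

Definition placed (P : program) (b : nat) (c : program) : Prop :=
  forall i a, nth_error c i = Some a -> nth_error P (b + i) = Some a.

Lemma placed_app P b c1 c2 :
  placed P b (c1 ++ c2) -> placed P b c1 /\ placed P (b + length c1) c2.
Proof.
  intros H; split; intros i a Hi.
  - apply H. rewrite nth_error_app1; auto.
    apply nth_error_Some; congruence.
  - rewrite <- Nat.add_assoc. apply H.
    rewrite nth_error_app2 by lia.
    replace (length c1 + i - length c1) with i by lia; auto.
Qed.

Lemma placed_cons P b i c :
  placed P b (i :: c) -> nth_error P b = Some i /\ placed P (S b) c.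
Proof.
  intros H; split.
  - rewrite <- (Nat.add_0_r b). apply H. reflexivity.
  - intros j a Hj. replace (S b + j) with (b + S j) by lia. apply H; auto.
Qed.

Definition agree (s : env) (x : state) : Prop := forall v, reg x (idx v) = s v.

Lemma upd_same f a v : upd f a v a = v.
Proof. unfold upd; rewrite Nat.eqb_refl; auto. Qed.

Lemma upd_other f a v b : b <> a -> upd f a v b = f b.
Proof. intros H; unfold upd; destruct (Nat.eqb_spec b a); congruence. Qed.

Lemma trunc_small w x : x < 2 ^ w -> trunc w x = x.
Proof. apply Nat.mod_small. Qed.

Lemma trunc_lt w x : trunc w x < 2 ^ w.
Proof. apply Nat.mod_upper_bound. apply Nat.pow_nonzero; lia. Qed.

Lemma eval_op_ideal w o x y :
  ideal_op o x y < 2 ^ w -> (match o with Sub => y <= x | _ => True end) ->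
  x < 2 ^ w ->
  eval_op w o x y = ideal_op o x y.
Proof.
  intros H1 H2 H3. unfold eval_op.
  destruct o; simpl in *; try (apply trunc_small; assumption).
  unfold trunc.
  replace (x + (2 ^ w - y)) with ((x - y) + 1 * 2 ^ w) by lia.
  rewrite Nat.Div0.mod_add. apply Nat.mod_small; auto.
Qed.

Lemma ev_lt w s e : safe w s e -> ev s e < 2 ^ w.
Proof. destruct e; simpl; tauto. Qed.

Lemma eval_Or_self w x : x < 2 ^ w -> eval_op w Or x x = x.
Proof.
  intros H. unfold eval_op. rewrite Nat.lor_diag. apply trunc_small; auto.
Qed.

Lemma agree_upd s x t v M' pc' :
  scratch <= t -> agree s x -> agree s (State pc' (upd (reg x) t v) M').
Proof.
  intros Ht H y; simpl. rewrite upd_other; auto.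
  pose proof (idx_lt y); lia.
Qed.

Lemma agree_set s x r v M' pc' :
  agree s x -> agree (set s r v) (State pc' (upd (reg x) (idx r) v) M').
Proof.
  intros H y; simpl. unfold set.
  destruct (var_beq y r) eqn:E.
  - apply internal_var_dec_bl in E; subst. apply upd_same.
  - rewrite upd_other; auto. intros Hi. apply idx_inj in Hi; subst.
    rewrite internal_var_dec_lb in E; auto; discriminate.
Qed.

(** The last clause, that registers below [t] survive, is what keeps the left operand intact while
    the right one is evaluated. *)
Lemma comp_expr_steps w P s e t b x :
  scratch <= t -> safe w s e -> placed P b (comp_expr e t) -> pc x = b -> agree s x ->
  exists y, steps w P (esize e) x y /\ pc y = b + esize e /\ agree s y /\
    mem y = mem x /\ reg y t = ev s e /\ forall r, r < t -> reg y r = reg x r.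
Proof.
  revert t b x; induction e as [v|v|o e1 IH1 e2 IH2]; intros t b x Ht Hs HP Hpc Ha.
  - simpl in *. apply placed_cons in HP as [HP _].
    eexists; split; [exists (State (S b) (upd (reg x) t (s v)) (mem x)); split; [|reflexivity]|].
    + unfold step. rewrite Hpc, HP, Ha, eval_Or_self; auto.
    + simpl; repeat split; try lia.
      * apply agree_upd; auto.
      * apply upd_same.
      * intros; apply upd_other; lia.
  - simpl in *. apply placed_cons in HP as [HP _].
    eexists; split; [exists (State (S b) (upd (reg x) t v) (mem x)); split; [|reflexivity]|].
    + unfold step. rewrite Hpc, HP, trunc_small; auto.
    + simpl; repeat split; try lia.
      * apply agree_upd; auto.
      * apply upd_same.
      * intros; apply upd_other; lia.
  - simpl in Hs, HP. destruct Hs as (H1 & H2 & H3 & H4).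
    apply placed_app in HP as [HP1 HP]. apply placed_app in HP as [HP2 HP].
    rewrite !comp_expr_length in *. apply placed_cons in HP as [HP _].
    destruct (IH1 t b x) as (y1 & S1 & P1 & A1 & M1 & R1 & F1); auto.
    destruct (IH2 (S t) (b + esize e1) y1) as (y2 & S2 & P2 & A2 & M2 & R2 & F2); auto; try lia.
    set (v := ideal_op o (ev s e1) (ev s e2)) in *.
    exists (State (S (pc y2)) (upd (reg y2) t v) (mem y2)).
    split; [|simpl; repeat split].
    + simpl. eapply steps_trans; eauto. eapply steps_trans; eauto.
      eexists; split; [|reflexivity].
      unfold step. rewrite P2, HP. rewrite R2, (F2 t), R1 by lia.
      rewrite eval_op_ideal; auto. apply ev_lt; auto.
    + lia.
    + apply agree_upd; auto.
    + congruence.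
    + apply upd_same.
    + intros r Hr. rewrite upd_other, F2, F1; auto; lia.
Qed.

(** * A program logic with step budgets *)

(** Total correctness within [T] steps. Quantifying over every surrounding program, load address and
    content of the temporary registers makes the notion compositional. *)
Definition wp (w : nat) (c : cmd) (T : nat) (Q : env -> (nat -> nat) -> Prop)
    (s : env) (M : nat -> nat) : Prop :=
  forall P b x, placed P b (comp c b) -> pc x = b -> agree s x -> mem x = M ->
  exists n y s', n <= T /\ steps w P n x y /\ pc y = b + csize c /\
    agree s' y /\ Q s' (mem y).

Lemma wp_mono w c T T' (Q Q' : env -> (nat -> nat) -> Prop) s M :
  wp w c T Q s M -> T <= T' -> (forall s' M', Q s' M' -> Q' s' M') ->
  wp w c T' Q' s M.
Proof.
  intros H HT HQ P b x H1 H2 H3 H4.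
  destruct (H P b x) as (n & y & s' & H5 & H6 & H7 & H8 & H9); auto.
  exists n, y, s'; repeat split; auto. lia.
Qed.

Lemma wp_skip w (Q : env -> (nat -> nat) -> Prop) s M : Q s M -> wp w Skip 0 Q s M.
Proof.
  intros H P b x H1 H2 H3 H4. exists 0, x, s; repeat split; simpl; auto; try lia.
  congruence.
Qed.

Lemma wp_asg w r e (Q : env -> (nat -> nat) -> Prop) s M :
  safe w s e -> Q (set s r (ev s e)) M -> wp w (Asg r e) (esize e + 1) Q s M.
Proof.
  intros Hs HQ P b x HP Hpc Ha HM. simpl in HP.
  apply placed_app in HP as [HP1 HP]. rewrite comp_expr_length in HP.
  apply placed_cons in HP as [HP _].
  destruct (comp_expr_steps w P s e tmp b x) as (y & S1 & P1 & A1 & M1 & R1 & F1);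
    auto; [unfold scratch, tmp; lia|].
  exists (esize e + 1), (State (S (pc y)) (upd (reg y) (idx r) (ev s e)) (mem y)),
    (set s r (ev s e)).
  repeat split; simpl; auto; try lia.
  - eapply steps_trans; eauto. eexists; split; [|reflexivity].
    unfold step. rewrite P1, HP, R1, eval_Or_self; auto. apply ev_lt; auto.
  - apply agree_set; auto.
  - congruence.
Qed.

Lemma wp_fetch w r e (Q : env -> (nat -> nat) -> Prop) s M :
  safe w s e -> Q (set s r (M (ev s e))) M -> wp w (Fetch r e) (esize e + 1) Q s M.
Proof.
  intros Hs HQ P b x HP Hpc Ha HM. simpl in HP.
  apply placed_app in HP as [HP1 HP]. rewrite comp_expr_length in HP.
  apply placed_cons in HP as [HP _].
  destruct (comp_expr_steps w P s e tmp b x) as (y & S1 & P1 & A1 & M1 & R1 & F1);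
    auto; [unfold scratch, tmp; lia|].
  exists (esize e + 1), (State (S (pc y)) (upd (reg y) (idx r) (M (ev s e))) (mem y)),
    (set s r (M (ev s e))).
  repeat split; simpl; auto; try lia.
  - eapply steps_trans; eauto. eexists; split; [|reflexivity].
    unfold step. rewrite P1, HP, R1. congruence.
  - apply agree_set; auto.
  - congruence.
Qed.

Lemma comp_pair_steps w P s e1 e2 b x :
  safe w s e1 -> safe w s e2 ->
  placed P b (comp_expr e1 tmp ++ comp_expr e2 (S tmp)) -> pc x = b -> agree s x ->
  exists y, steps w P (esize e1 + esize e2) x y /\ pc y = b + (esize e1 + esize e2) /\
    agree s y /\ mem y = mem x /\ reg y tmp = ev s e1 /\ reg y (S tmp) = ev s e2.
Proof.
  intros H1 H2 HP Hpc Ha. apply placed_app in HP as [HP1 HP2].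
  rewrite comp_expr_length in HP2.
  destruct (comp_expr_steps w P s e1 tmp b x) as (y1 & S1 & P1 & A1 & M1 & R1 & F1);
    auto; [unfold scratch, tmp; lia|].
  destruct (comp_expr_steps w P s e2 (S tmp) (b + esize e1) y1)
    as (y2 & S2 & P2 & A2 & M2 & R2 & F2); auto; [unfold scratch, tmp; lia|].
  exists y2; repeat split; auto; try lia; try congruence.
  - eapply steps_trans; eauto.
  - rewrite F2; auto.
Qed.

Lemma wp_store w e1 e2 (Q : env -> (nat -> nat) -> Prop) s M :
  safe w s e1 -> safe w s e2 -> Q s (upd M (ev s e1) (ev s e2)) ->
  wp w (Store e1 e2) (esize e1 + esize e2 + 1) Q s M.
Proof.
  intros Hs1 Hs2 HQ P b x HP Hpc Ha HM. simpl in HP.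
  apply placed_app in HP as [HP1 HP].
  rewrite length_app, !comp_expr_length in HP.
  apply placed_cons in HP as [HP _].
  destruct (comp_pair_steps w P s e1 e2 b x) as (y & S1 & P1 & A1 & M1 & R1 & R2); auto.
  exists (esize e1 + esize e2 + 1),
    (State (S (pc y)) (reg y) (upd (mem y) (ev s e1) (ev s e2))), s.
  repeat split; simpl; auto; try lia.
  - eapply steps_trans; eauto. eexists; split; [|reflexivity].
    unfold step. rewrite P1, HP, R1, R2. reflexivity.
  - congruence.
Qed.

Lemma wp_seq w c1 c2 T1 T2 (Q : env -> (nat -> nat) -> Prop) s M :
  wp w c1 T1 (fun s' M' => wp w c2 T2 Q s' M') s M ->
  wp w (Seq c1 c2) (T1 + T2) Q s M.
Proof.
  intros H P b x HP Hpc Ha HM. simpl in HP.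
  apply placed_app in HP as [HP1 HP2]. rewrite comp_length in HP2.
  destruct (H P b x) as (n & y & s' & H5 & H6 & H7 & H8 & H9); auto.
  destruct (H9 P (b + csize c1) y) as (n' & y' & s'' & G5 & G6 & G7 & G8 & G9); auto.
  exists (n + n'), y', s''; repeat split; auto; try lia.
  - eapply steps_trans; eauto.
  - simpl; lia.
Qed.

Lemma wp_ifeq w e1 e2 c1 c2 T (Q : env -> (nat -> nat) -> Prop) s M :
  safe w s e1 -> safe w s e2 ->
  (ev s e1 = ev s e2 -> wp w c1 T Q s M) ->
  (ev s e1 <> ev s e2 -> wp w c2 T Q s M) ->
  wp w (IfEq e1 e2 c1 c2) (esize e1 + esize e2 + 3 + T) Q s M.
Proof.
  intros Hs1 Hs2 H1 H2 P b x HP Hpc Ha HM. simpl in HP.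
  apply placed_app in HP as [HP1 HP].
  rewrite length_app, !comp_expr_length in HP.
  apply placed_cons in HP as [HJ1 HP]. apply placed_cons in HP as [HJ2 HP].
  apply placed_app in HP as [HPc1 HP]. rewrite comp_length in HP.
  apply placed_cons in HP as [HJ3 HPc2].
  destruct (comp_pair_steps w P s e1 e2 b x) as (y & S1 & P1 & A1 & M1 & R1 & R2); auto.
  set (b1 := b + (esize e1 + esize e2) + 2) in *.
  set (b2 := b1 + csize c1 + 1) in *.
  replace (S (S (b + (esize e1 + esize e2)))) with b1 in * by (unfold b1; lia).
  replace (S (b1 + csize c1)) with b2 in * by (unfold b2; lia).
  assert (Hstep1 : step w P y = Some (State (if ev s e1 <? ev s e2 then b2 else S (pc y)) (reg y) (mem y))).
  { unfold step. rewrite P1, HJ1, R1, R2. reflexivity. }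
  destruct (Nat.eq_dec (ev s e1) (ev s e2)) as [E|E].
  - specialize (H1 E).
    replace (ev s e1 <? ev s e2) with false in Hstep1
      by (symmetry; apply Nat.ltb_ge; lia).
    destruct (H1 P b1 (State b1 (reg y) (mem y)))
      as (n & y' & s' & G5 & G6 & G7 & G8 & G9); auto.
    { simpl; congruence. }
    exists (esize e1 + esize e2 + (2 + (n + 1))), (State (b2 + csize c2) (reg y') (mem y')), s'.
    repeat split; auto; try lia.
    + eapply steps_trans; eauto. eapply (steps_trans w P 2).
      * eexists; split; [eassumption|]. eexists; split; [|reflexivity].
        unfold step; cbn [pc reg mem]. rewrite P1, HJ2, R1, R2.
        replace (ev s e2 <? ev s e1) with false by (symmetry; apply Nat.ltb_ge; lia).
        reflexivity.
      * replace (S (S (b + (esize e1 + esize e2)))) with b1 by (unfold b1; lia).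
        eapply steps_trans; eauto.
        eexists; split; [|reflexivity]. unfold step. rewrite G7, HJ3. reflexivity.
    + simpl. unfold b2, b1; lia.
  - specialize (H2 E).
    destruct (H2 P b2 (State b2 (reg y) (mem y)))
      as (n & y' & s' & G5 & G6 & G7 & G8 & G9); auto.
    { simpl; congruence. }
    destruct (Nat.ltb_spec (ev s e1) (ev s e2)) as [Hlt|Hge].
    + exists (esize e1 + esize e2 + (1 + n)), y', s'; repeat split; auto; try lia.
      * eapply steps_trans; eauto. eapply (steps_trans w P 1); eauto.
        eexists; split; [eassumption|reflexivity].
      * rewrite G7; simpl; unfold b2, b1; lia.
    + exists (esize e1 + esize e2 + (2 + n)), y', s'; repeat split; auto; try lia.
      * eapply steps_trans; eauto. eapply (steps_trans w P 2); eauto.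
        eexists; split; [eassumption|]. eexists; split; [|reflexivity].
        unfold step; cbn [pc reg mem]. rewrite P1, HJ2, R1, R2.
        replace (ev s e2 <? ev s e1) with true by (symmetry; apply Nat.ltb_lt; lia).
        reflexivity.
      * rewrite G7; simpl; unfold b2, b1; lia.
Qed.

Lemma wp_while_stop w e1 e2 c T (Q : env -> (nat -> nat) -> Prop) s M :
  safe w s e1 -> safe w s e2 -> ev s e2 <= ev s e1 -> Q s M ->
  esize e1 + esize e2 + 2 <= T -> wp w (While e1 e2 c) T Q s M.
Proof.
  intros Hs1 Hs2 Hle HQ HT P b x HP Hpc Ha HM. simpl in HP.
  apply placed_app in HP as [HP1 HP].
  rewrite length_app, !comp_expr_length in HP.
  apply placed_cons in HP as [HJ1 HP]. apply placed_cons in HP as [HJ2 HP].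
  destruct (comp_pair_steps w P s e1 e2 b x) as (y & S1 & P1 & A1 & M1 & R1 & R2); auto.
  exists (esize e1 + esize e2 + 2),
    (State (b + (esize e1 + esize e2) + 2 + csize c + 1) (reg y) (mem y)), s.
  repeat split; auto.
  - eapply steps_trans; eauto. eexists; split.
    + unfold step. rewrite P1, HJ1, R1, R2.
      replace (ev s e1 <? ev s e2) with false by (symmetry; apply Nat.ltb_ge; lia).
      reflexivity.
    + eexists; split; [|reflexivity]. unfold step; cbn [pc reg mem]. rewrite HJ2. reflexivity.
  - simpl; lia.
  - simpl; congruence.
Qed.

Lemma wp_while_step w e1 e2 c T1 T2 T (Q : env -> (nat -> nat) -> Prop) s M :
  safe w s e1 -> safe w s e2 -> ev s e1 < ev s e2 ->
  wp w c T1 (fun s' M' => wp w (While e1 e2 c) T2 Q s' M') s M ->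
  esize e1 + esize e2 + 2 + T1 + T2 <= T ->
  wp w (While e1 e2 c) T Q s M.
Proof.
  intros Hs1 Hs2 Hlt H HT P b x HP Hpc Ha HM. pose proof HP as HP0. simpl in HP.
  apply placed_app in HP as [HP1 HP].
  rewrite length_app, !comp_expr_length in HP.
  apply placed_cons in HP as [HJ1 HP]. apply placed_cons in HP as [HJ2 HP].
  apply placed_app in HP as [HPc HP]. rewrite comp_length in HP.
  apply placed_cons in HP as [HJ3 _].
  destruct (comp_pair_steps w P s e1 e2 b x) as (y & S1 & P1 & A1 & M1 & R1 & R2); auto.
  set (b1 := b + (esize e1 + esize e2) + 2) in *.
  replace (S (S (b + (esize e1 + esize e2)))) with b1 in * by (unfold b1; lia).
  destruct (H P b1 (State b1 (reg y) (mem y)))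
    as (n & y' & s' & G5 & G6 & G7 & G8 & G9); auto.
  { simpl; congruence. }
  destruct (G9 P b (State b (reg y') (mem y')))
    as (n' & y'' & s'' & K5 & K6 & K7 & K8 & K9); auto.
  exists (esize e1 + esize e2 + (1 + (n + (1 + n')))), y'', s''; repeat split; auto; try lia.
  eapply steps_trans; eauto. eapply (steps_trans w P 1).
  - eexists; split; [|reflexivity]. unfold step. rewrite P1, HJ1, R1, R2.
    replace (ev s e1 <? ev s e2) with true by (symmetry; apply Nat.ltb_lt; lia).
    reflexivity.
  - eapply steps_trans; eauto. eapply (steps_trans w P 1); eauto.
    eexists; split; [|reflexivity]. unfold step. rewrite G7, HJ3. reflexivity.
Qed.

(** * Simulation of a machine with shorter words *)

Definition bounded (w : nat) (x : state) : Prop :=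
  (forall r, reg x r < 2 ^ w) /\ (forall a, mem x a < 2 ^ w).

Lemma bounded_upd w f a v :
  (forall b, f b < 2 ^ w) -> v < 2 ^ w -> forall b, upd f a v b < 2 ^ w.
Proof. intros Hf Hv b. unfold upd. destruct (b =? a); auto. Qed.

(** Addresses come from registers, which stay below [2 ^ w]; hence cells beyond that are never
    written. This confines each simulated machine to its region. *)
Lemma step_bounded w Q x y :
  step w Q x = Some y -> bounded w x ->
  bounded w y /\ forall a, 2 ^ w <= a -> mem y a = mem x a.
Proof.
  unfold step. intros H [Hr Hm].
  destruct (nth_error Q (pc x)) as [[]|]; try discriminate H;
    injection H as <-; unfold bounded; simpl; repeat split;
    intros; auto; try (apply bounded_upd; auto); try apply trunc_lt.
  apply upd_other. specialize (Hr a). lia.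
Qed.

Lemma exec_bounded w Q x T y :
  exec w Q x T y -> bounded w x ->
  bounded w y /\ forall a, 2 ^ w <= a -> mem y a = mem x a.
Proof.
  induction 1 as [x Hx|x y z T Hs He IH]; intros Hb; auto.
  destruct (step_bounded _ _ _ _ Hs Hb) as [Hb' Hm].
  destruct (IH Hb') as [Hb'' Hm']. split; auto.
  intros a Ha. rewrite Hm', Hm; auto.
Qed.

Lemma start_bounded w args M :
  (forall a, M a < 2 ^ w) -> bounded w (start w args M).
Proof. intros H; split; simpl; auto. intros r; apply trunc_lt. Qed.

Lemma prog_regs_spec Q i j :
  nth_error Q j = Some i -> instr_regs i < prog_regs Q.
Proof.
  intros H. apply nth_error_In in H. unfold prog_regs.
  induction Q as [|a Q IH]; simpl in *; [tauto|].
  destruct H as [->|H]; [lia|]. specialize (IH H). lia.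
Qed.

Lemma placed_flat_map P b (f : instr -> program) Q j i :
  (forall a, length (f a) = 2) -> placed P b (flat_map f Q) ->
  nth_error Q j = Some i -> placed P (b + 2 * j) (f i).
Proof.
  intros Hf. revert b j. induction Q as [|a Q IH]; intros b j HP Hj.
  - destruct j; discriminate Hj.
  - simpl in HP. apply placed_app in HP as [HP1 HP2]. rewrite Hf in HP2.
    destruct j as [|j]; simpl in Hj.
    + injection Hj as <-. rewrite Nat.mul_0_r, Nat.add_0_r; auto.
    + replace (b + 2 * S j) with (b + 2 + 2 * j) by lia. auto.
Qed.

Lemma mod_pow_trunc wD w x : wD <= w -> trunc w x mod 2 ^ wD = x mod 2 ^ wD.
Proof.
  intros H. unfold trunc.
  replace (2 ^ w) with (2 ^ wD * 2 ^ (w - wD)) by (rewrite <- Nat.pow_add_r; f_equal; lia).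
  rewrite Nat.Div0.mod_mul_r.
  rewrite (Nat.mul_comm (2 ^ wD)), Nat.Div0.mod_add.
  apply Nat.Div0.mod_mod.
Qed.

(** Since [2 ^ wD] divides [2 ^ w], reducing the long result gives the short one. Only [Sub]
    mentions the modulus itself, and its two versions differ by a multiple of [2 ^ wD]. *)
Lemma eval_op_trunc wD w o x y :
  wD < w -> y < 2 ^ wD ->
  eval_op w Mod (eval_op w o x y) (2 ^ wD) = eval_op wD o x y.
Proof.
  intros Hw Hy.
  assert (Hlt : 2 ^ wD < 2 ^ w) by (apply Nat.pow_lt_mono_r; lia).
  assert (Hmod : forall z, z mod 2 ^ wD < 2 ^ wD) by (intros; apply trunc_lt).
  unfold eval_op at 1. rewrite trunc_small by (specialize (Hmod (eval_op w o x y)); lia).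
  unfold eval_op. rewrite mod_pow_trunc by lia.
  destruct o; try reflexivity.
  unfold trunc.
  assert (E : 2 ^ w = 2 ^ (w - wD) * 2 ^ wD)
    by (rewrite <- Nat.pow_add_r; f_equal; lia).
  assert (0 < 2 ^ (w - wD)) by (apply Nat.neq_0_lt_0, Nat.pow_nonzero; lia).
  replace (x + (2 ^ w - y)) with (x + (2 ^ wD - y) + (2 ^ (w - wD) - 1) * 2 ^ wD).
  - rewrite Nat.Div0.mod_add. reflexivity.
  - rewrite Nat.mul_sub_distr_r, <- E. lia.
Qed.

(** Clamping the program counter sends every position outside the simulated text, where that machine
    has halted, to the first cell after the block. Simulated memory starts at [bs]; cells below it
    keep the contents of [M0]. *)
Definition simulates (b n k bs : nat) (s : env) (M0 : nat -> nat) (x x' : state)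
    : Prop :=
  pc x' = b + 2 * Nat.min (pc x) n /\
  (forall r, r < k -> reg x' (tmp + r) = reg x r) /\
  (forall a, mem x' (bs + a) = mem x a) /\
  (forall a, a < bs -> mem x' a = M0 a) /\
  agree s x'.

Lemma sim_step wD w P Q b s M0 x x' y :
  placed P b (sim Q b) -> s vW = 2 ^ wD -> wD < w -> s vBase + 2 ^ wD <= 2 ^ w ->
  bounded wD x ->
  simulates b (length Q) (prog_regs Q) (s vBase) s M0 x x' ->
  step wD Q x = Some y ->
  exists n y', n <= 2 /\ steps w P n x' y' /\
    simulates b (length Q) (prog_regs Q) (s vBase) s M0 y y'.
Proof.
  intros HP HW Hw Hb [HBr HBm] (Hpc & Hr & Hm & Hm0 & Ha) Hs.
  unfold step in Hs. destruct (nth_error Q (pc x)) as [i|] eqn:Ei; [|discriminate Hs].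
  assert (Hlen : pc x < length Q) by (apply nth_error_Some; congruence).
  rewrite Nat.min_l in Hpc by lia.
  assert (HPi : placed P (pc x') (sim_instr b (length Q) i)).
  { rewrite Hpc. eapply placed_flat_map; eauto. intros []; reflexivity. }
  pose proof (prog_regs_spec _ _ _ Ei) as Hreg.
  destruct i as [r v|o r a c|r a|a c|l|a c l|]; cbn [sim_instr] in HPi; simpl in Hreg;
    try discriminate Hs; injection Hs as <-;
    apply placed_cons in HPi as [HP1 HP2]; apply placed_cons in HP2 as [HP2 _].
  - eexists 2, _. split; [lia|]. split.
    + eexists; split; [unfold step; rewrite HP1; reflexivity|].
      eexists; split; [unfold step; cbn [pc reg mem]; rewrite HP2; reflexivity|reflexivity].
    + cbn [reg]. rewrite upd_same.
      rewrite (upd_other _ _ _ (idx vW)) by (pose proof (idx_lt vW); unfold tmp, scratch in *; lia).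
      rewrite Ha, HW.
      assert (E : eval_op w Mod (trunc w v) (2 ^ wD) = trunc wD v).
      { unfold eval_op. rewrite mod_pow_trunc by lia. apply trunc_small.
        apply Nat.lt_trans with (2 ^ wD); [apply (trunc_lt wD)|].
        apply Nat.pow_lt_mono_r; lia. }
      rewrite E. repeat split; cbn [pc reg mem]; auto.
      * lia.
      * intros r' Hr'. unfold upd. rewrite <- Hr by lia.
        destruct (Nat.eqb_spec (tmp + r') (tmp + r)), (Nat.eqb_spec r' r); auto; lia.
      * intros y; cbn [reg]. pose proof (idx_lt y).
        rewrite !upd_other; auto; unfold tmp, scratch in *; lia.
  - eexists 2, _. split; [lia|]. split.
    + eexists; split; [unfold step; rewrite HP1; reflexivity|].
      eexists; split; [unfold step; cbn [pc reg mem]; rewrite HP2; reflexivity|reflexivity].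
    + cbn [reg]. rewrite upd_same.
      rewrite (upd_other _ _ _ (idx vW)) by (pose proof (idx_lt vW); unfold tmp, scratch in *; lia).
      rewrite Ha, HW, !Hr by lia. rewrite eval_op_trunc by auto.
      repeat split; cbn [pc reg mem]; auto.
      * lia.
      * intros r' Hr'. unfold upd. rewrite <- Hr by lia.
        destruct (Nat.eqb_spec (tmp + r') (tmp + r)), (Nat.eqb_spec r' r); auto; lia.
      * intros y; cbn [reg]. pose proof (idx_lt y).
        rewrite !upd_other; auto; unfold tmp, scratch in *; lia.
  - eexists 2, _. split; [lia|]. split.
    + eexists; split; [unfold step; rewrite HP1; reflexivity|].
      eexists; split; [unfold step; cbn [pc reg mem]; rewrite HP2; reflexivity|reflexivity].
    + cbn [reg mem]. rewrite upd_same, Ha, Hr by lia.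
      (* The shifted address does not wrap around, because the whole simulated range above the base
         fits into [2 ^ w]. *)
      assert (E : eval_op w Add (s vBase) (reg x a) = s vBase + reg x a)
        by (apply trunc_small; specialize (HBr a); lia).
      rewrite E, Hm.
      repeat split; cbn [pc reg mem]; auto.
      * lia.
      * intros r' Hr'. unfold upd. rewrite <- Hr by lia.
        destruct (Nat.eqb_spec (tmp + r') (tmp + r)), (Nat.eqb_spec r' r); auto; try lia.
        destruct (Nat.eqb_spec (tmp + r') scratch); auto. unfold tmp, scratch in *; lia.
      * intros y; cbn [reg]. pose proof (idx_lt y).
        rewrite !upd_other; auto; unfold tmp, scratch in *; lia.
  - eexists 2, _. split; [lia|]. split.
    + eexists; split; [unfold step; rewrite HP1; reflexivity|].
      eexists; split; [unfold step; cbn [pc reg mem]; rewrite HP2; reflexivity|reflexivity].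
    + cbn [reg mem]. rewrite upd_same, Ha, Hr by lia.
      rewrite upd_other by (unfold tmp, scratch; lia). rewrite Hr by lia.
      assert (E : eval_op w Add (s vBase) (reg x a) = s vBase + reg x a)
        by (apply trunc_small; specialize (HBr a); lia).
      rewrite E.
      repeat split; cbn [pc reg mem]; auto.
      * lia.
      * intros a'. unfold upd. rewrite <- Hm.
        destruct (Nat.eqb_spec (s vBase + a') (s vBase + reg x a)),
          (Nat.eqb_spec a' (reg x a)); auto; lia.
      * intros a' Ha'. rewrite upd_other; auto; lia.
      * intros v; cbn. rewrite upd_other; auto.
        pose proof (idx_lt v); lia.
  - exists 1, (State (b + 2 * Nat.min l (length Q)) (reg x') (mem x')).
    split; [lia|]. split.
    + eexists; split; [unfold step; rewrite HP1; reflexivity|reflexivity].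
    + repeat split; auto.
  - destruct (reg x a <? reg x c) eqn:E.
    + exists 1, (State (b + 2 * Nat.min l (length Q)) (reg x') (mem x')).
      split; [lia|]. split.
      * eexists; split; [unfold step; rewrite HP1, !Hr, E by lia; reflexivity|reflexivity].
      * repeat split; auto.
    + eexists 2, _.
      split; [lia|]. split.
      * eexists; split; [unfold step; rewrite HP1, !Hr, E by lia; reflexivity|].
        eexists; split; [unfold step; cbn [pc reg mem]; rewrite HP2; reflexivity|reflexivity].
      * repeat split; cbn [pc reg mem]; auto.
        -- lia.
        -- apply agree_upd; [lia|auto].
Qed.

(** The extra step is the jump that stands for [Halt]; a machine that ran off its text is already at
    the end of the block. *)
Lemma sim_exec wD w P Q b s M0 x x' T y :
  placed P b (sim Q b) -> s vW = 2 ^ wD -> wD < w -> s vBase + 2 ^ wD <= 2 ^ w ->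
  exec wD Q x T y -> bounded wD x ->
  simulates b (length Q) (prog_regs Q) (s vBase) s M0 x x' ->
  exists n y', n <= 2 * T + 1 /\ steps w P n x' y' /\
    pc y' = b + 2 * length Q /\ reg y' tmp = reg y 0 /\
    (forall a, mem y' (s vBase + a) = mem y a) /\
    (forall a, a < s vBase -> mem y' a = M0 a) /\ agree s y'.
Proof.
  intros HP HW Hw Hb He. revert x'.
  induction He as [x Hx|x y z T Hs He IH]; intros x' HB HS.
  - destruct HS as (Hpc & Hr & Hm & Hm0 & Ha).
    assert (Hr0 : reg x' tmp = reg x 0).
    { rewrite <- (Nat.add_0_r tmp). apply Hr. unfold prog_regs; lia. }
    unfold step in Hx. destruct (nth_error Q (pc x)) as [i|] eqn:Ei.
    + assert (Hlen : pc x < length Q) by (apply nth_error_Some; congruence).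
      destruct i; try discriminate Hx.
      assert (HPi : placed P (b + 2 * pc x) (sim_instr b (length Q) Halt)).
      { eapply placed_flat_map; eauto. intros []; reflexivity. }
      simpl sim_instr in HPi. apply placed_cons in HPi as [HP1 _].
      rewrite Nat.min_l in Hpc by lia.
      exists 1, (State (b + 2 * length Q) (reg x') (mem x')).
      split; [lia|]. split; [|repeat split; auto].
      eexists; split; [|reflexivity]. unfold step. rewrite Hpc, HP1. reflexivity.
    + apply nth_error_None in Ei. rewrite Nat.min_r in Hpc by lia.
      exists 0, x'. repeat split; auto. lia.
  - destruct (sim_step wD w P Q b s M0 x x' y) as (n & y' & Hn & Hst & HS'); auto.
    destruct (step_bounded _ _ _ _ Hs HB) as [HB' _].
    destruct (IH y' HB' HS') as (n' & z' & Hn' & Hst' & H).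
    exists (n + n'), z'. split; [lia|]. split; auto. eapply steps_trans; eauto.
Qed.

Lemma comp_args_steps wD w P s args t b x :
  scratch <= t -> Forall (safe w s) args -> s vW = 2 ^ wD -> wD < w ->
  placed P b (comp_args args t) -> pc x = b -> agree s x ->
  exists y, steps w P (length (comp_args args t)) x y /\
    pc y = b + length (comp_args args t) /\ agree s y /\ mem y = mem x /\
    (forall j, j < length args ->
       reg y (t + j) = trunc wD (nth j (map (ev s) args) 0)) /\
    (forall r, r < t -> reg y r = reg x r).
Proof.
  intros Ht Hs HW Hw. revert t b x Ht Hs.
  induction args as [|e args IH]; intros t b x Ht Hs HP Hpc Ha.
  - exists x; simpl; repeat split; auto; lia.
  - cbn [comp_args app] in HP. inversion Hs as [|? ? Hs1 Hs2]; subst.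
    apply placed_app in HP as [HP1 HP]. rewrite comp_expr_length in HP.
    apply placed_cons in HP as [HP2 HP3].
    destruct (comp_expr_steps w P s e t (pc x) x) as (y & S1 & P1 & A1 & M1 & R1 & F1); auto.
    destruct (IH (S t) (S (pc x + esize e))
      (State (S (pc y)) (upd (reg y) t (trunc wD (ev s e))) (mem y)))
      as (z & S2 & P2 & A2 & M2 & R2 & F2); auto.
    + simpl; lia.
    + apply agree_upd; auto.
    + exists z. repeat split; auto.
      * simpl. rewrite length_app, comp_expr_length. simpl.
        eapply steps_trans; eauto.
        eexists; split; [|eassumption]. unfold step. rewrite P1, HP2, R1, A1, HW.
        f_equal. f_equal. f_equal. unfold eval_op.
        apply trunc_small.
        apply Nat.lt_trans with (2 ^ wD); [apply (trunc_lt wD)|].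
        apply Nat.pow_lt_mono_r; lia.
      * rewrite P2. simpl. rewrite length_app, comp_expr_length. simpl. lia.
      * rewrite M2; auto.
      * intros [|j] Hj; simpl.
        -- rewrite Nat.add_0_r, F2 by lia. simpl. apply upd_same.
        -- rewrite <- Nat.add_succ_comm. rewrite R2; auto. simpl in Hj; lia.
      * intros r Hr. rewrite F2 by lia. simpl. rewrite upd_other, F1; auto; lia.
Qed.

Lemma zero_regs_steps w P s t n b x :
  scratch <= t -> placed P b (zero_regs t n) -> pc x = b -> agree s x ->
  exists y, steps w P n x y /\ pc y = b + n /\ agree s y /\ mem y = mem x /\
    (forall r, t <= r < t + n -> reg y r = 0) /\
    (forall r, r < t -> reg y r = reg x r).
Proof.
  revert t b x; induction n as [|n IH]; intros t b x Ht HP Hpc Ha.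
  - exists x; simpl; repeat split; auto; lia.
  - unfold zero_regs in HP; simpl in HP. apply placed_cons in HP as [HP1 HP2].
    destruct (IH (S t) (S b) (State (S b) (upd (reg x) t 0) (mem x)))
      as (z & S2 & P2 & A2 & M2 & R2 & F2); auto.
    + apply agree_upd; auto.
    + exists z. repeat split; auto.
      * eexists; split; [|eassumption]. unfold step. rewrite Hpc, HP1.
        unfold trunc. rewrite Nat.Div0.mod_0_l. reflexivity.
      * lia.
      * intros r Hr. destruct (Nat.eq_dec r t) as [->|Hne].
        -- rewrite F2 by lia. simpl. apply upd_same.
        -- apply R2; lia.
      * intros r Hr. rewrite F2 by lia. simpl. apply upd_other; lia.
Qed.

Definition call_cost (Q : program) (args : list expr) : nat :=
  length (call_setup Q args) + 2.

(** The memory from [vBase] on, read as a memory of its own, is what the callee sees. Its entries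
    must be short words, for otherwise the callee would start in a state that it could never
    reach. *)
Lemma wp_call wD w Q args r (Post : env -> (nat -> nat) -> Prop) s M T y :
  Forall (safe w s) args -> s vW = 2 ^ wD -> wD < w -> s vBase + 2 ^ wD <= 2 ^ w ->
  (forall a, M (s vBase + a) < 2 ^ wD) ->
  exec wD Q (start wD (map (ev s) args) (fun a => M (s vBase + a))) T y ->
  (forall M', (forall a, a < s vBase -> M' a = M a) ->
     (fun a => M' (s vBase + a)) = mem y ->
     Post (set s r (reg y 0)) M') ->
  wp w (Call Q args r) (call_cost Q args + 2 * T) Post s M.
Proof.
  intros Hsafe HW Hw Hb HM He HPost P b x HP Hpc Ha Hmem. cbn [comp csize] in *.
  apply placed_app in HP as [HP1 HP]. apply placed_app in HP as [HP2 HP].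
  rewrite sim_length in HP. apply placed_cons in HP as [HP3 _].
  unfold call_setup in HP1. apply placed_app in HP1 as [HP0 HP1].
  destruct (comp_args_steps wD w P s args tmp b x) as (x1 & S1 & P1 & A1 & M1 & R1 & F1); auto.
  { unfold tmp, scratch; lia. }
  destruct (zero_regs_steps w P s (tmp + length args) (prog_regs Q)
     (b + length (comp_args args tmp)) x1) as (x2 & S2 & P2 & A2 & M2 & R2 & F2); auto.
  { unfold tmp, scratch; lia. }
  set (x0 := start wD (map (ev s) args) (fun a => M (s vBase + a))) in *.
  assert (HB0 : bounded wD x0) by (apply start_bounded; auto).
  assert (Hlen : length (call_setup Q args) = length (comp_args args tmp) + prog_regs Q).
  { unfold call_setup, zero_regs. rewrite length_app, length_map, length_seq. auto. }
  destruct (sim_exec wD w P Q (b + length (call_setup Q args)) s M x0 x2 T y)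
    as (n & x3 & Hn & S3 & P3 & R3 & M3 & M3' & A3); auto.
  { repeat split; auto.
    - simpl. lia.
    - intros j Hj. unfold x0, start, words; cbn [reg].
      destruct (Nat.lt_ge_cases j (length args)) as [Hl|Hl].
      + rewrite F2 by lia. rewrite R1 by lia. reflexivity.
      + rewrite R2 by lia. rewrite nth_overflow by (rewrite length_map; lia).
        unfold trunc. rewrite Nat.Div0.mod_0_l. reflexivity.
    - intros a. rewrite M2, M1, Hmem. reflexivity.
    - intros a _. congruence. }
  destruct (exec_bounded _ _ _ _ _ He HB0) as [[HBr HBm] _].
  exists (length (comp_args args tmp) + (prog_regs Q + (n + 1))),
    (State (S (pc x3)) (upd (reg x3) (idx r) (reg y 0)) (mem x3)),
    (set s r (reg y 0)).
  split; [unfold call_cost; lia|]. split; [|split; [|split]].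
  - eapply steps_trans; eauto. eapply steps_trans; eauto. eapply steps_trans; eauto.
    eexists; split; [|reflexivity]. unfold step. rewrite P3, HP3, R3, eval_Or_self; auto.
    specialize (HBr 0). assert (2 ^ wD < 2 ^ w) by (apply Nat.pow_lt_mono_r; lia). lia.
  - simpl; lia.
  - apply agree_set; auto.
  - simpl. apply HPost; auto. apply functional_extensionality; auto.
Qed.

(** * Colour coding by decision lists *)

(** The number of possible steps of a decision list: a bit position, the value of that bit, the old
    colour and the new colour. *)
Definition color_base (L k : nat) : nat := L * 2 * k * k.

(** Mixed-radix decoding of a step: position [s mod L], then the bit value, then the colour to be
    replaced, then its replacement. The reductions modulo [k] keep colours in range for every number
    [s]. *)
Definition color_step (L k v s y : nat) : nat :=
  if y =? (s / L / 2) mod k then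
    if Nat.shiftr v (s mod L) mod 2 =? (s / L) mod 2 then (s / L / 2 / k) mod k
    else y
  else y.

Fixpoint color_from (L k r z v y : nat) : nat :=
  match r with
  | 0 => y
  | S r' => color_from L k r' (z / color_base L k) v
              (color_step L k v (z mod color_base L k) y)
  end.

Definition color (L k z v : nat) : nat := color_from L k k z v 0.

Lemma color_step_lt L k v s y : 0 < k -> y < k -> color_step L k v s y < k.
Proof.
  intros Hk Hy. unfold color_step.
  destruct (_ =? _); [destruct (_ =? _)|]; auto.
  apply Nat.mod_upper_bound; lia.
Qed.

Lemma color_from_lt L k r z v y : 0 < k -> y < k -> color_from L k r z v y < k.
Proof.
  intros Hk. revert z y; induction r as [|r IH]; intros z y Hy; simpl; auto.
  apply IH, color_step_lt; auto.
Qed.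

(** The least significant digit is applied first, so a list is extended at its end by a new leading
    digit, without touching the earlier steps. *)
Lemma color_from_snoc L k r z v s y :
  z < color_base L k ^ r -> s < color_base L k ->
  color_from L k (S r) (z + color_base L k ^ r * s) v y =
  color_step L k v s (color_from L k r z v y).
Proof.
  set (D := color_base L k). intros Hz Hs. revert z y Hz.
  induction r as [|r IH]; intros z y Hz.
  - simpl in *. fold D. replace (z + (s + 0)) with s by lia.
    rewrite Nat.mod_small; auto.
  - change (color_from L k (S (S r)) (z + D ^ S r * s) v y) with
      (color_from L k (S r) ((z + D ^ S r * s) / D) v
         (color_step L k v ((z + D ^ S r * s) mod D) y)).
    change (color_from L k (S r) z v y) with
      (color_from L k r (z / D) v (color_step L k v (z mod D) y)).
    replace (z + D ^ S r * s) with (z + (D ^ r * s) * D) by (simpl; ring).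
    rewrite Nat.Div0.mod_add, Nat.div_add by lia.
    apply IH. apply Nat.Div0.div_lt_upper_bound. simpl in Hz; lia.
Qed.

Lemma shiftr_bits_inj L x y :
  x < 2 ^ L -> y < 2 ^ L ->
  (forall p, p < L -> Nat.shiftr x p mod 2 = Nat.shiftr y p mod 2) -> x = y.
Proof.
  revert x y; induction L as [|L IH]; intros x y Hx Hy H.
  - simpl in *; lia.
  - assert (H0 := H 0 (Nat.lt_0_succ L)). rewrite !Nat.shiftr_0_r in H0.
    assert (E : x / 2 = y / 2).
    { simpl in Hx, Hy. apply IH; try (apply Nat.Div0.div_lt_upper_bound; lia).
      intros p Hp. specialize (H (S p)).
      rewrite !Nat.shiftr_div_pow2 in *. rewrite Nat.pow_succ_r' in H.
      rewrite <- !Nat.Div0.div_div in H. apply H; lia. }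
    rewrite (Nat.div_mod_eq x 2), (Nat.div_mod_eq y 2); lia.
Qed.

Lemma differing_bit L x y :
  x < 2 ^ L -> y < 2 ^ L -> x <> y ->
  exists p, p < L /\ Nat.shiftr x p mod 2 <> Nat.shiftr y p mod 2.
Proof.
  intros Hx Hy Hne.
  destruct (existsb (fun p => negb (Nat.shiftr x p mod 2 =? Nat.shiftr y p mod 2)) (seq 0 L)) eqn:E.
  - apply existsb_exists in E as (p & Hp & E). apply in_seq in Hp.
    exists p. split; [lia|]. apply Bool.negb_true_iff, Nat.eqb_neq in E; auto.
  - exfalso. apply Hne, (shiftr_bits_inj L); auto. intros p Hp.
    destruct (Nat.eq_dec (Nat.shiftr x p mod 2) (Nat.shiftr y p mod 2)) as [|Hn]; auto.
    assert (existsb (fun p => negb (Nat.shiftr x p mod 2 =? Nat.shiftr y p mod 2)) (seq 0 L) = true).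
    { apply existsb_exists. exists p. split; [apply in_seq; lia|].
      apply Bool.negb_true_iff, Nat.eqb_neq; auto. }
    congruence.
Qed.

Lemma color_step_encode L k v y p b a c :
  p < L -> b < 2 -> a < k -> c < k ->
  let s := p + L * (b + 2 * (a + k * c)) in
  s < color_base L k /\
  color_step L k v s y =
    if y =? a then if Nat.shiftr v p mod 2 =? b then c else y else y.
Proof.
  intros Hp Hb Ha Hc s.
  assert (E1 : s mod L = p).
  { unfold s. rewrite Nat.mul_comm, Nat.Div0.mod_add. apply Nat.mod_small; auto. }
  assert (E2 : s / L = b + 2 * (a + k * c)).
  { unfold s. rewrite (Nat.mul_comm L), Nat.div_add, Nat.div_small by lia. lia. }
  assert (E3 : (s / L) mod 2 = b).
  { rewrite E2, (Nat.mul_comm 2), Nat.Div0.mod_add. apply Nat.mod_small; auto. }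
  assert (E4 : s / L / 2 = a + k * c).
  { rewrite E2, (Nat.mul_comm 2), Nat.div_add, Nat.div_small by lia. lia. }
  assert (E5 : (s / L / 2) mod k = a).
  { rewrite E4, (Nat.mul_comm k), Nat.Div0.mod_add. apply Nat.mod_small; auto. }
  assert (E6 : s / L / 2 / k = c).
  { rewrite E4, (Nat.mul_comm k), Nat.div_add, Nat.div_small by lia. lia. }
  split.
  - unfold s, color_base.
    assert (a + k * c + 1 <= k * k) by nia.
    assert (b + 2 * (a + k * c) + 1 <= 2 * (k * k)) by nia.
    assert (L * (b + 2 * (a + k * c) + 1) <= L * (2 * (k * k))) by (apply Nat.mul_le_mono_l; auto).
    nia.
  - unfold color_step. rewrite E1, E3, E5, E6, (Nat.mod_small c) by auto. reflexivity.
Qed.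

(** Vertices are separated one at a time: the newcomer collides with at most one
    of the vertices already coloured, and one bit tells the two apart. *)
Lemma color_from_complete L k (f : nat -> nat) r :
  0 < L -> r <= k -> (forall i, i < k -> f i < 2 ^ L) ->
  (forall i j, i < k -> j < k -> f i = f j -> i = j) ->
  exists z, z < color_base L k ^ r /\
    forall i, i < r -> color_from L k r z (f i) 0 = i.
Proof.
  intros HL Hr Hf Hinj. induction r as [|r IH].
  - exists 0. split; [simpl; lia|]. intros; lia.
  - destruct IH as (z & Hz & Hc); [lia|].
    set (y := color_from L k r z (f r) 0).
    assert (Hy : y < k) by (apply color_from_lt; lia).
    assert (Hp : exists p, p < L /\ (y < r -> Nat.shiftr (f r) p mod 2 <> Nat.shiftr (f y) p mod 2)).
    { destruct (Nat.lt_ge_cases y r) as [Hlt|Hge].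
      - destruct (differing_bit L (f r) (f y)) as (p & Hp & Hd).
        + apply Hf; lia.
        + apply Hf; lia.
        + intros E. apply Hinj in E; lia.
        + exists p; auto.
      (* Here no vertex coloured so far has colour [y], so any bit will do. *)
      - exists 0; split; [lia|]. intros; lia. }
    destruct Hp as (p & Hp & Hd).
    set (b := Nat.shiftr (f r) p mod 2).
    assert (Hb : b < 2) by (apply Nat.mod_upper_bound; lia).
    set (s := p + L * (b + 2 * (y + k * r))).
    assert (HD : s < color_base L k) by (apply color_step_encode; auto; lia).
    exists (z + color_base L k ^ r * s). split.
    + simpl. nia.
    + intros i Hi. rewrite color_from_snoc by auto.
      unfold s. rewrite (proj2 (color_step_encode L k (f i) _ p b y r Hp Hb Hy ltac:(lia))).
      destruct (Nat.eq_dec i r) as [->|Hne].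
      * fold y. rewrite Nat.eqb_refl. fold b. rewrite Nat.eqb_refl. reflexivity.
      * rewrite Hc by lia. destruct (Nat.eqb_spec i y) as [->|]; auto.
        destruct (Nat.eqb_spec (Nat.shiftr (f y) p mod 2) b) as [E|]; auto.
        exfalso. apply Hd; [lia|]. auto.
Qed.

Lemma color_lt L k z v : 0 < k -> color L k z v < k.
Proof. intros; apply color_from_lt; auto. Qed.

Lemma color_complete L k (f : nat -> nat) :
  0 < L -> (forall i, i < k -> f i < 2 ^ L) ->
  (forall i j, i < k -> j < k -> f i = f j -> i = j) ->
  exists z, z < color_base L k ^ k /\ forall i, i < k -> color L k z (f i) = i.
Proof. intros; apply color_from_complete; auto. Qed.

(** * The host graph *)

Record host : Set := Host {
  hN : nat;
  hk : nat;
  ho : orientation;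
  hE : list (nat * nat);
  hcol : nat -> nat }.

(** The vertex set is padded to [2 m], the largest size allowed for the input. Then [N] is also the
    number of arc slots, two per edge, and all sizes depend on [m] alone. *)
Definition host_wf (h : host) : Prop :=
  hN h = 2 * length (hE h) /\ 1 <= length (hE h) /\ 3 <= hk h /\
  simple_graph (ho h) (hN h) (hE h) /\ forall v, hcol h v < hk h.

(** Slot [2 e + 1] holds the reversal of edge [e], or a loop (which never joins
    consecutive colours) when edges are directed. *)
Definition arc (h : host) (q : nat) : nat * nat :=
  let '(u, v) := nth (q / 2) (hE h) (0, 0) in
  if Nat.even q then (u, v)
  else (v, match ho h with Undirected => u | Directed => v end).

Definition out_id (h : host) (u : nat) : nat :=
  if hcol h u =? 0 then hN h + u else u.

Definition in_id (h : host) (v : nat) : nat :=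
  if hcol h v =? 0 then 2 * hN h + v else v.

Definition slot (h : host) (q : nat) : nat * nat :=
  let '(u, v) := arc h q in
  if (hcol h u + 1) mod hk h =? hcol h v then (out_id h u, in_id h v)
  else (5 * hN h + 2, 5 * hN h + 3 + q).

(** Vertex names, with [N = hN h]: a vertex [v] of nonzero colour is [v], one of
    colour zero is split into a source [N + v] and a sink [2 N + v]; the two
    paths are [3 N + j] and [4 N + 1 + j] for [j <= N]; the last names are the
    centre and the leaves of a star that replaces the unused slots. *)
Definition host_pair (h : host) (j : nat) : nat * nat :=
  let N := hN h in
  if j <? 2 * N then
    if Nat.even j then (2 * N + j / 2, 4 * N + 1 + j / 2)
    else (3 * N + j / 2, N + j / 2)
  else if j <? 4 * N then
    let i := (j - 2 * N) / 2 in
    if Nat.even (j - 2 * N) then (3 * N + i, 3 * N + (i + 1))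
    else (4 * N + 1 + i, 4 * N + 1 + (i + 1))
  else slot h (j - 4 * N).

(** A relation containing every pair of [j] and [host_pair h j], stated without division and parity
    so that case analysis leaves linear arithmetic. *)
Inductive host_edge (h : host) : nat -> nat * nat -> Prop :=
| he_sink i : i < hN h ->
    host_edge h (2 * i) (2 * hN h + i, 4 * hN h + 1 + i)
| he_source i : i < hN h ->
    host_edge h (2 * i + 1) (3 * hN h + i, hN h + i)
| he_path_s i : i < hN h ->
    host_edge h (2 * hN h + 2 * i) (3 * hN h + i, 3 * hN h + (i + 1))
| he_path_t i : i < hN h ->
    host_edge h (2 * hN h + (2 * i + 1)) (4 * hN h + 1 + i, 4 * hN h + 1 + (i + 1))
| he_arc q u v : q < hN h -> arc h q = (u, v) ->
    (hcol h u + 1) mod hk h = hcol h v ->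
    host_edge h (4 * hN h + q) (out_id h u, in_id h v)
| he_star q : q < hN h ->
    host_edge h (4 * hN h + q) (5 * hN h + 2, 5 * hN h + 3 + q).

Lemma half_even i : 2 * i / 2 = i.
Proof. rewrite Nat.mul_comm. apply Nat.div_mul; lia. Qed.

Lemma half_odd i : (2 * i + 1) / 2 = i.
Proof. symmetry. apply (Nat.div_unique _ 2 _ 1); lia. Qed.

Lemma even_double i : Nat.even (2 * i) = true.
Proof. apply Nat.even_spec. exists i; auto. Qed.

Lemma even_double_succ i : Nat.even (2 * i + 1) = false.
Proof. rewrite Nat.add_1_r, Nat.even_succ. rewrite <- Nat.negb_even, even_double. auto. Qed.

Lemma parity_cases j : exists i, j = 2 * i \/ j = 2 * i + 1.
Proof.
  destruct (Nat.Even_or_Odd j) as [[i ->]|[i ->]]; exists i; auto.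
Qed.

Lemma host_pair_sink h i : i < hN h ->
  host_pair h (2 * i) = (2 * hN h + i, 4 * hN h + 1 + i).
Proof.
  intros H. unfold host_pair. rewrite (proj2 (Nat.ltb_lt _ _)) by lia.
  rewrite even_double, half_even. reflexivity.
Qed.

Lemma host_pair_source h i : i < hN h ->
  host_pair h (2 * i + 1) = (3 * hN h + i, hN h + i).
Proof.
  intros H. unfold host_pair. rewrite (proj2 (Nat.ltb_lt _ _)) by lia.
  rewrite even_double_succ, half_odd. reflexivity.
Qed.

Lemma host_pair_path_s h i : i < hN h ->
  host_pair h (2 * hN h + 2 * i) = (3 * hN h + i, 3 * hN h + (i + 1)).
Proof.
  intros H. unfold host_pair. rewrite (proj2 (Nat.ltb_ge _ _)) by lia.
  rewrite (proj2 (Nat.ltb_lt _ _)) by lia.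
  replace (2 * hN h + 2 * i - 2 * hN h) with (2 * i) by lia.
  rewrite even_double, half_even. reflexivity.
Qed.

Lemma host_pair_path_t h i : i < hN h ->
  host_pair h (2 * hN h + (2 * i + 1)) = (4 * hN h + 1 + i, 4 * hN h + 1 + (i + 1)).
Proof.
  intros H. unfold host_pair. rewrite (proj2 (Nat.ltb_ge _ _)) by lia.
  rewrite (proj2 (Nat.ltb_lt _ _)) by lia.
  replace (2 * hN h + (2 * i + 1) - 2 * hN h) with (2 * i + 1) by lia.
  rewrite even_double_succ, half_odd. reflexivity.
Qed.

Lemma host_pair_slot h q : host_pair h (4 * hN h + q) = slot h q.
Proof.
  unfold host_pair. rewrite !(proj2 (Nat.ltb_ge _ _)) by lia. f_equal; lia.
Qed.

Lemma host_pair_edge h j : j < 5 * hN h -> host_edge h j (host_pair h j).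
Proof.
  intros Hj.
  destruct (Nat.lt_ge_cases j (2 * hN h)) as [H1|H1].
  - destruct (parity_cases j) as [i [->| ->]].
    + rewrite host_pair_sink by lia. constructor; lia.
    + rewrite host_pair_source by lia. constructor; lia.
  - destruct (Nat.lt_ge_cases j (4 * hN h)) as [H2|H2].
    + replace j with (2 * hN h + (j - 2 * hN h)) in * by lia.
      destruct (parity_cases (j - 2 * hN h)) as [i [E|E]]; rewrite E in *.
      * rewrite host_pair_path_s by lia. constructor; lia.
      * rewrite host_pair_path_t by lia. constructor; lia.
    + replace j with (4 * hN h + (j - 4 * hN h)) in * by lia.
      set (q := j - 4 * hN h) in *. rewrite host_pair_slot. unfold slot.
      destruct (arc h q) as [u v] eqn:Ea.
      destruct (Nat.eqb_spec ((hcol h u + 1) mod hk h) (hcol h v)) as [E|E].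
      * eapply he_arc; eauto; lia.
      * constructor; lia.
Qed.

Lemma nth_edge_in h e : host_wf h -> 2 * e < hN h -> In (nth e (hE h) (0, 0)) (hE h).
Proof. intros (HN & _) H. apply nth_In. lia. Qed.

Lemma arc_lt h q u v :
  host_wf h -> q < hN h -> arc h q = (u, v) -> u < hN h /\ v < hN h.
Proof.
  intros Hwf Hq Ha. pose proof Hwf as (HN & Hm & Hk & (_ & HE & _) & _).
  assert (Hin : In (nth (q / 2) (hE h) (0, 0)) (hE h)).
  { apply nth_edge_in; auto. pose proof (Nat.Div0.mul_div_le q 2). lia. }
  unfold arc in Ha. destruct (nth (q / 2) (hE h) (0, 0)) as [a b].
  specialize (HE a b Hin). destruct (Nat.even q); [|destruct (ho h)];
    injection Ha as <- <-; lia.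
Qed.

(** With directed edges one loop can fill several slots, hence [u <> v]. With undirected edges
    simplicity forbids listing both an edge and its reversal. *)
Lemma arc_inj h q q' u v :
  host_wf h -> q < hN h -> q' < hN h -> u <> v ->
  arc h q = (u, v) -> arc h q' = (u, v) -> q = q'.
Proof.
  intros Hwf Hq Hq' Hne Ha Ha'. pose proof Hwf as (HN & Hm & Hk & (HD & HE & HU) & _).
  assert (Hinj : forall e e', 2 * e < hN h -> 2 * e' < hN h ->
    nth e (hE h) (0, 0) = nth e' (hE h) (0, 0) -> e = e').
  { intros e e' H1 H2 H3. apply (proj1 (NoDup_nth (hE h) (0, 0)) HD); auto; lia. }
  unfold arc in Ha, Ha'.
  destruct (parity_cases q) as [e [->| ->]], (parity_cases q') as [e' [->| ->]];
    rewrite ?even_double, ?even_double_succ, ?half_even, ?half_odd in *;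
    specialize (Hinj e e' ltac:(lia) ltac:(lia));
    assert (Hi := nth_edge_in h e Hwf ltac:(lia));
    assert (Hi' := nth_edge_in h e' Hwf ltac:(lia));
    destruct (nth e (hE h) (0, 0)) as [a b], (nth e' (hE h) (0, 0)) as [a' b'].
  all: destruct (ho h); injection Ha as ? ?; injection Ha' as ? ?; subst; try congruence.
  (* These are the slots of equal parity, which name the same edge; the other two goals would place
     an edge and its reversal in the list. *)
  1, 2, 5: rewrite Hinj; auto.
  all: exfalso; eapply HU; eauto.
Qed.

Lemma succ_color_cases h u v :
  host_wf h -> (hcol h u + 1) mod hk h = hcol h v ->
  (hcol h u + 1 = hk h /\ hcol h v = 0) \/
  (hcol h v = hcol h u + 1 /\ hcol h u + 1 < hk h).
Proof.
  intros (_ & _ & Hk & _ & Hc) H. specialize (Hc u).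
  destruct (Nat.eq_dec (hcol h u + 1) (hk h)) as [E|E].
  - left. rewrite E, Nat.Div0.mod_same in H. auto.
  - right. rewrite Nat.mod_small in H; lia.
Qed.

Lemma out_id_cases h u :
  (hcol h u = 0 /\ out_id h u = hN h + u) \/ (hcol h u <> 0 /\ out_id h u = u).
Proof. unfold out_id. destruct (Nat.eqb_spec (hcol h u) 0); auto. Qed.

Lemma in_id_cases h u :
  (hcol h u = 0 /\ in_id h u = 2 * hN h + u) \/ (hcol h u <> 0 /\ in_id h u = u).
Proof. unfold in_id. destruct (Nat.eqb_spec (hcol h u) 0); auto. Qed.

Lemma out_id_inj h u u' : u < hN h -> u' < hN h -> out_id h u = out_id h u' -> u = u'.
Proof. destruct (out_id_cases h u), (out_id_cases h u'); lia. Qed.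

Lemma in_id_inj h u u' : u < hN h -> u' < hN h -> in_id h u = in_id h u' -> u = u'.
Proof. destruct (in_id_cases h u), (in_id_cases h u'); lia. Qed.

(** The kinds of edges use disjoint ranges of names, except that two arcs may meet. Arcs with the
    same ends in the same order are the same arc; in opposite order they cannot be, since after the
    splitting of colour zero each arc climbs one layer. *)
Lemma host_edge_inj h j x y j' x' y' :
  host_wf h -> host_edge h j (x, y) -> host_edge h j' (x', y') ->
  (x = x' /\ y = y') \/ (x = y' /\ y = x') -> j = j'.
Proof.
  intros Hwf H1 H2 HE. pose proof (proj1 (proj2 (proj2 Hwf))) as Hk.
  assert (Harc : forall q u v, q < hN h -> arc h q = (u, v) -> u < hN h /\ v < hN h)
    by (intros; eapply arc_lt; eauto).
  inversion H1 as [i Hi Ej|i Hi Ej|i Hi Ej|i Hi Ej|q u v Hq Ha Hc Ej|q Hq Ej]; subst;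
  inversion H2 as [i' Hi' Ej'|i' Hi' Ej'|i' Hi' Ej'|i' Hi' Ej'|q' u' v' Hq' Ha' Hc' Ej'|q' Hq' Ej']; subst;
  try (specialize (Harc _ _ _ Hq Ha) as Hb; destruct (out_id_cases h u), (in_id_cases h v));
  try (specialize (Harc _ _ _ Hq' Ha') as Hb'; destruct (out_id_cases h u'), (in_id_cases h v'));
  try lia;
  pose proof (succ_color_cases _ _ _ Hwf Hc); pose proof (succ_color_cases _ _ _ Hwf Hc');
  f_equal;
  (destruct HE as [[E1 E2]|[E1 E2]];
    [assert (u' = u) by (apply (out_id_inj h); lia);
     assert (v' = v) by (apply (in_id_inj h); lia);
     subst u' v'; apply (arc_inj h q q' u v); auto; intros E; subst v; lia
    |exfalso; try lia;
     assert (u = v') by lia; assert (v = u') by lia; subst; lia]).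
Qed.

Lemma host_edge_lt h j x y :
  host_wf h -> host_edge h j (x, y) ->
  x < 6 * hN h + 3 /\ y < 6 * hN h + 3 /\ x <> y.
Proof.
  intros Hwf H. pose proof (proj1 (proj2 (proj2 Hwf))) as Hk.
  inversion H as [i Hi|i Hi|i Hi|i Hi|q u v Hq Ha Hc|q Hq]; subst; try lia.
  destruct (arc_lt _ _ _ _ Hwf Hq Ha).
  destruct (out_id_cases h u), (in_id_cases h v);
    pose proof (succ_color_cases _ _ _ Hwf Hc); repeat split; try lia;
    intros E; assert (u = v) by lia; subst; lia.
Qed.

(** Both orders of updates (deleting from the front, inserting in reverse) only
    ever leave a suffix of the edge sequence. *)
Definition host_graph (h : host) (p : nat) : list wedge :=
  map (fun j => (host_pair h j, 1)) (seq p (5 * hN h - p)).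

Lemma in_host_graph h p x y l :
  In ((x, y), l) (host_graph h p) ->
  l = 1 /\ exists j, p <= j < 5 * hN h /\ host_edge h j (x, y).
Proof.
  intros H. apply in_map_iff in H as (j & E & Hj). apply in_seq in Hj.
  injection E as E <-. split; auto. exists j. split; [lia|].
  rewrite <- E. apply host_pair_edge; lia.
Qed.

Lemma host_graph_in h p j x y :
  p <= j < 5 * hN h -> host_pair h j = (x, y) -> In ((x, y), 1) (host_graph h p).
Proof.
  intros H E. apply in_map_iff. exists j. rewrite E. split; auto. apply in_seq; lia.
Qed.

Lemma host_graph_cons h p :
  p < 5 * hN h -> host_graph h p = (host_pair h p, 1) :: host_graph h (S p).
Proof.
  intros H. unfold host_graph.
  replace (5 * hN h - p) with (S (5 * hN h - S p)) by lia. reflexivity.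
Qed.

Lemma host_graph_length h p : length (host_graph h p) = 5 * hN h - p.
Proof. unfold host_graph. rewrite length_map, length_seq. auto. Qed.

Lemma NoDup_map_seq {A : Type} (f : nat -> A) n p :
  (forall i j, p <= i < p + n -> p <= j < p + n -> f i = f j -> i = j) ->
  NoDup (map f (seq p n)).
Proof.
  revert p. induction n as [|n IH]; intros p H; simpl; constructor.
  - intros Hin. apply in_map_iff in Hin as (j & E & Hj). apply in_seq in Hj.
    apply H in E; lia.
  - apply IH. intros i j Hi Hj. apply H; lia.
Qed.

Lemma host_graph_weighted h p W :
  host_wf h -> 1 <= W -> weighted_graph (6 * hN h + 3) W (host_graph h p).
Proof.
  intros Hwf HW.
  assert (Hin : forall x y, In (x, y) (map fst (host_graph h p)) ->
     exists j, p <= j < 5 * hN h /\ host_edge h j (x, y) /\ host_pair h j = (x, y)).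
  { intros x y H. unfold host_graph in H. rewrite map_map in H.
    apply in_map_iff in H as (j & E & Hj). apply in_seq in Hj. simpl in E.
    exists j. rewrite <- E. repeat split; try lia. apply host_pair_edge; lia. }
  split; [split; [|split]|].
  - unfold host_graph. rewrite map_map. simpl. apply NoDup_map_seq.
    intros i j Hi Hj E.
    assert (Hi' := host_pair_edge h i ltac:(lia)).
    assert (Hj' := host_pair_edge h j ltac:(lia)). rewrite <- E in Hj'.
    destruct (host_pair h i) as [x y]. eapply host_edge_inj; eauto.
  - intros x y H. apply Hin in H as (j & Hj & H & _). eapply host_edge_lt; eauto.
  - intros _ x y H H'. apply Hin in H as (j & Hj & H & E).
    apply Hin in H' as (j' & Hj' & H' & E').
    assert (j = j') by (eapply host_edge_inj; eauto). subst j'.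
    destruct (host_edge_lt _ _ _ _ Hwf H) as (_ & _ & Hne). congruence.
  - intros [[x y] l] H. apply in_host_graph in H as (-> & _). simpl; lia.
Qed.

(** [Delete] filters the whole list, but by [host_edge_inj] no other index carries this pair in
    either orientation, so only the head disappears. *)
Lemma host_graph_delete h p :
  host_wf h -> p < 5 * hN h ->
  apply_op (Delete (fst (host_pair h p)) (snd (host_pair h p))) (host_graph h p)
  = host_graph h (S p).
Proof.
  intros Hwf Hp. rewrite host_graph_cons by auto.
  destruct (host_pair h p) as [x y] eqn:E. cbn [apply_op filter fst snd].
  replace (joins x y (x, y, 1)) with true
    by (unfold joins; rewrite !Nat.eqb_refl; reflexivity).
  simpl negb. cbn iota. apply forallb_filter_id. apply forallb_forall.
  intros [[x' y'] l] Hin. apply in_host_graph in Hin as (_ & j & Hj & He).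
  assert (He0 := host_pair_edge h p Hp). rewrite E in He0.
  destruct (joins x y (x', y', l)) eqn:Ej; auto. exfalso.
  assert (j = p); [|lia].
  eapply host_edge_inj; eauto. unfold joins in Ej.
  apply Bool.orb_true_iff in Ej as [Ej|Ej]; apply andb_prop in Ej as [E1 E2];
    apply Nat.eqb_eq in E1; apply Nat.eqb_eq in E2; auto.
Qed.

Lemma host_graph_joins h p :
  p < 5 * hN h ->
  exists e, In e (host_graph h p) /\
    joins (fst (host_pair h p)) (snd (host_pair h p)) e = true.
Proof.
  intros H. exists (host_pair h p, 1). rewrite host_graph_cons by auto.
  split; [left; auto|]. destruct (host_pair h p). unfold joins. simpl.
  rewrite !Nat.eqb_refl. reflexivity.
Qed.

(** * Distances in the host graph *)

(** The potential grows by at most one along every edge of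
    [host_graph h (2 * i)] and by [2 i + k + 2] from end to end, so a walk of
    that length climbs at every step. *)
Definition potential (h : host) (i x : nat) : nat :=
  let N := hN h in
  if x <? N then i + 1 + hcol h x
  else if x <? 2 * N then i + 1
  else if x <? 3 * N then i + 1 + hk h
  else if x <? 4 * N + 1 then Nat.min (x - 3 * N) i
  else if x <? 5 * N + 2 then i + hk h + 2 + (i - (x - (4 * N + 1)))
  else 0.

Ltac split_ltb := repeat
  match goal with
  | |- context [?a <? ?b] => destruct (Nat.ltb_spec a b); try lia
  end.

Lemma potential_plain h i v : v < hN h -> potential h i v = i + 1 + hcol h v.
Proof. intros H; unfold potential; split_ltb. Qed.

Lemma potential_source h i v : v < hN h -> potential h i (hN h + v) = i + 1.
Proof. intros H; unfold potential; split_ltb. Qed.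

Lemma potential_sink h i v : v < hN h -> potential h i (2 * hN h + v) = i + 1 + hk h.
Proof. intros H; unfold potential; split_ltb. Qed.

Lemma potential_path_s h i j :
  j <= hN h -> potential h i (3 * hN h + j) = Nat.min j i.
Proof. intros H; unfold potential; split_ltb. Qed.

Lemma potential_path_t h i j :
  j <= hN h -> potential h i (4 * hN h + 1 + j) = i + hk h + 2 + (i - j).
Proof. intros H; unfold potential; split_ltb. Qed.

Lemma potential_star h i x : 5 * hN h + 2 <= x -> potential h i x = 0.
Proof. intros H; unfold potential; split_ltb. Qed.

Lemma potential_out h i u : u < hN h -> potential h i (out_id h u) = i + 1 + hcol h u.
Proof.
  intros H. destruct (out_id_cases h u) as [[E ->]|[E ->]].
  - rewrite potential_source, E by auto. lia.
  - apply potential_plain; auto.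
Qed.

Lemma potential_in h i u v :
  host_wf h -> v < hN h -> (hcol h u + 1) mod hk h = hcol h v ->
  potential h i (in_id h v) = i + 1 + hcol h u + 1.
Proof.
  intros Hwf H Hc. apply succ_color_cases in Hc; auto.
  destruct (in_id_cases h v) as [[E ->]|[E ->]].
  - rewrite potential_sink by auto. lia.
  - rewrite potential_plain; auto. lia.
Qed.

(** The condition [2 * i <= j] matters for the attachments: theirs have index at least [i], where
    the truncations on the two paths have reached their end values. *)
Lemma potential_edge h i j x y :
  host_wf h -> 2 * i <= j -> host_edge h j (x, y) ->
  potential h i y <= potential h i x + 1 /\ potential h i x <= potential h i y + 1.
Proof.
  intros Hwf Hj He.
  inversion He as [a Ha|a Ha|a Ha|a Ha|q u v Hq Ha Hc|q Hq]; subst.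
  - rewrite potential_sink, potential_path_t by lia. lia.
  - rewrite potential_path_s, potential_source by lia. lia.
  - rewrite !potential_path_s by lia. lia.
  - rewrite !potential_path_t by lia. lia.
  - destruct (arc_lt _ _ _ _ Hwf Hq Ha).
    rewrite potential_out, (potential_in h i u v) by auto. lia.
  - rewrite !potential_star by lia. lia.
Qed.

Lemma walk_potential h i x t d :
  host_wf h -> walk (host_graph h (2 * i)) x t d ->
  potential h i t <= potential h i x + d.
Proof.
  intros Hwf. induction 1 as [u|u v t l d Hin Hw IH]; [lia|].
  destruct Hin as [Hin|Hin]; apply in_host_graph in Hin as (-> & j & Hj & He);
    apply (potential_edge h i) in He; auto; lia.
Qed.

(** The rest of a coloured cycle through [i] from colour [c] on: [f] is indexed by colours, and
    position [hk h] stands for the return to [i]. *)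
Definition colored_path (h : host) (i c v : nat) : Prop :=
  exists f, f c = v /\ f (hk h) = i /\
    forall a, c <= a < hk h ->
      hcol h (f a) = a /\ exists q, q < hN h /\ arc h q = (f a, f (S a)).

Definition colored_cycle (h : host) (i : nat) : Prop := colored_path h i 0 i.

Lemma colored_path_last h i u q :
  q < hN h -> hcol h u + 1 = hk h -> arc h q = (u, i) ->
  colored_path h i (hcol h u) u.
Proof.
  intros Hq Hc Ha. exists (fun a => if a =? hcol h u then u else i).
  rewrite Nat.eqb_refl. split; auto. split.
  - destruct (Nat.eqb_spec (hk h) (hcol h u)); auto. lia.
  - intros a Hr. replace a with (hcol h u) by lia. rewrite Nat.eqb_refl.
    destruct (Nat.eqb_spec (S (hcol h u)) (hcol h u)); [lia|]. eauto.
Qed.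

Lemma colored_path_cons h i u v q :
  q < hN h -> arc h q = (u, v) -> colored_path h i (S (hcol h u)) v ->
  hcol h u < hk h -> colored_path h i (hcol h u) u.
Proof.
  intros Hq Ha (f & Hf & Hfk & H) Hlt.
  exists (fun a => if a =? hcol h u then u else f a).
  rewrite Nat.eqb_refl. split; auto. split.
  - destruct (Nat.eqb_spec (hk h) (hcol h u)); auto. lia.
  - intros a Hr.
    destruct (Nat.eqb_spec (S a) (hcol h u)); [lia|].
    destruct (Nat.eqb_spec a (hcol h u)) as [->|].
    + rewrite Hf. eauto.
    + apply H. lia.
Qed.

(** Induction from the end [t] backwards, with one claim for each kind of vertex where the walk may
    be. The last path can only be entered at an index at most [i], while the remaining attachments
    have index at least [i]; so the sink is that of [i], and for the same reason so is the
    source. *)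
Lemma tight_walk h i x t d :
  host_wf h -> i < hN h -> walk (host_graph h (2 * i)) x t d ->
  t = 4 * hN h + 1 -> potential h i x + d = potential h i t ->
  (forall j, j <= i -> x = 3 * hN h + j -> colored_cycle h i) /\
  (forall v, v < hN h -> x = 2 * hN h + v -> v = i) /\
  (forall j, j <= hN h -> x = 4 * hN h + 1 + j -> j <= i) /\
  (forall v, v < hN h -> x = hN h + v -> hcol h v = 0 /\ colored_path h i 0 v) /\
  (forall v, v < hN h -> x = v -> colored_path h i (hcol h v) v).
Proof.
  intros Hwf Hi Hw Ht.
  induction Hw as [x|x y t l d Hin Hw IH]; intros Hd.
  - subst x. repeat split; intros; try lia; exfalso; lia.
  - specialize (IH Ht). subst t.
    assert (Hp := walk_potential _ _ _ _ _ Hwf Hw).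
    assert (Hx : exists j, 2 * i <= j < 5 * hN h /\
      (host_edge h j (x, y) \/ host_edge h j (y, x)) /\ l = 1).
    { destruct Hin as [Hin|Hin]; apply in_host_graph in Hin as (-> & j & Hj & He); eauto. }
    clear Hin. destruct Hx as (j & Hj & He & ->).
    assert (Hyx : potential h i y = potential h i x + 1).
    { destruct He as [He|He]; apply (potential_edge h i) in He; auto; lia. }
    specialize (IH ltac:(lia)). destruct IH as (IHs & IHk & IHt & IHc & IHp).
    (* Edges traversed as listed come first, then reversed ones. Moving against the climb
       contradicts [Hyx]; on the path to [t], whose indices fall towards [t], the reversed traversal
       is the climbing one. *)
    destruct He as [He|He];
      inversion He as [a Ha|a Ha|a Ha|a Ha|q u v Hq Ha Hc|q Hq]; subst.
    + repeat split; intros; try lia.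
      assert (a <= i) by (apply IHt; lia). lia.
    + repeat split; intros; try lia.
      (* The vertex of the first path has index at most [i], and this attachment is still present,
         so [a = i]. *)
      replace a with i in * by lia. apply (IHc i); lia.
    + rewrite !potential_path_s in Hyx by lia.
      repeat split; intros; try lia. apply (IHs (a + 1)); lia.
    + rewrite !potential_path_t in Hyx by lia. lia.
    + destruct (arc_lt _ _ _ _ Hwf Hq Ha) as [Hu Hv].
      assert (HP : colored_path h i (hcol h u) u).
      { assert (Hlt : hcol h u < hk h) by apply Hwf.
        destruct (succ_color_cases _ _ _ Hwf Hc) as [[E1 E2]|[E1 E2]];
          destruct (in_id_cases h v) as [[E3 E4]|[E3 E4]]; try lia.
        - rewrite E4 in *. specialize (IHk v Hv eq_refl). subst v.
          apply (colored_path_last h i u q); auto.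
        - rewrite E4 in *. specialize (IHp v Hv eq_refl).
          replace (hcol h v) with (S (hcol h u)) in IHp by lia.
          apply (colored_path_cons h i u v q); auto. }
      destruct (out_id_cases h u) as [[E1 E2]|[E1 E2]]; rewrite E2 in *.
      * repeat split; intros; try lia; replace v0 with u by lia; auto.
        rewrite <- E1 at 1; auto.
      * repeat split; intros; try lia. subst v0. auto.
    + rewrite !potential_star in Hyx by lia. lia.
    + rewrite potential_sink, potential_path_t in Hyx by lia. lia.
    + rewrite potential_path_s, potential_source in Hyx by lia. lia.
    + rewrite !potential_path_s in Hyx by lia. lia.
    + rewrite !potential_path_t in Hyx by lia.
      repeat split; intros; try lia.
    + destruct (arc_lt _ _ _ _ Hwf Hq Ha) as [Hu Hv].
      rewrite potential_out, (potential_in h i u v) in Hyx by auto. lia.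
    + rewrite !potential_star in Hyx by lia. lia.
Qed.

Lemma walk_step E u v t d :
  In ((u, v), 1) E \/ In ((v, u), 1) E -> walk E v t d -> walk E u t (S d).
Proof. intros H Hw. exact (walk_cons E u v t 1 d H Hw). Qed.

Lemma walk_path_t h i j :
  i <= hN h -> j <= hN h -> 
  walk (host_graph h (2 * i)) (4 * hN h + 1 + j) (4 * hN h + 1) j.
Proof.
  intros Hi. induction j as [|j IH]; intros Hj.
  - rewrite Nat.add_0_r. constructor.
  - apply walk_step with (4 * hN h + 1 + j); [|apply IH; lia]. right.
    eapply (host_graph_in h _ (2 * hN h + (2 * j + 1))); [lia|].
    rewrite host_pair_path_t by lia. f_equal; lia.
Qed.

Lemma slot_good h q u v :
  arc h q = (u, v) -> (hcol h u + 1) mod hk h = hcol h v ->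
  slot h q = (out_id h u, in_id h v).
Proof. intros Ha Hc. unfold slot. rewrite Ha, Hc, Nat.eqb_refl. reflexivity. Qed.

(** The length consists of [hk h - c] arcs, the attachment of the sink of [i], and [i] edges of the
    path to [t]. *)
Lemma walk_colored_path h i c v :
  host_wf h -> i < hN h -> c < hk h -> hcol h i = 0 ->
  colored_path h i c v ->
  walk (host_graph h (2 * i)) (out_id h v) (4 * hN h + 1) (hk h - c + 1 + i).
Proof.
  intros Hwf Hi Hc Hi0 (f & Hf & Hfk & H).
  assert (Hgen : forall r c, hk h = c + S r -> 
    (forall a, c <= a < hk h ->
      hcol h (f a) = a /\ exists q, q < hN h /\ arc h q = (f a, f (S a))) ->
    walk (host_graph h (2 * i)) (out_id h (f c)) (4 * hN h + 1) (S r + 1 + i)).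
  { clear c v Hc Hf H. induction r as [|r IH]; intros c Hr H.
    - destruct (H c) as (Hcol & q & Hq & Ha); [lia|].
      replace (S c) with (hk h) in Ha by lia. rewrite Hfk in Ha.
      apply walk_step with (in_id h i).
      + left. eapply (host_graph_in h _ (4 * hN h + q)); [lia|].
        rewrite host_pair_slot. apply slot_good; auto.
        rewrite Hcol, Hi0. replace (c + 1) with (hk h) by lia. apply Nat.Div0.mod_same.
      + unfold in_id. rewrite Hi0. simpl (0 =? 0). cbn iota.
        apply walk_step with (4 * hN h + 1 + i).
        * left. eapply (host_graph_in h _ (2 * i)); [lia|]. apply host_pair_sink; auto.
        * apply walk_path_t; lia.
    - destruct (H c) as (Hcol & q & Hq & Ha); [lia|].
      destruct (H (S c)) as (Hcol' & _); [lia|].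
      apply walk_step with (in_id h (f (S c))).
      + left. eapply (host_graph_in h _ (4 * hN h + q)); [lia|].
        rewrite host_pair_slot. apply slot_good; auto.
        rewrite Hcol, Hcol', Nat.mod_small; lia.
      (* Inner vertices have nonzero colour and are not split, so the vertex entered is the vertex
         left. *)
      + replace (in_id h (f (S c))) with (out_id h (f (S c))).
        * apply IH; [lia|]. intros; apply H; lia.
        * unfold in_id, out_id. rewrite Hcol'. reflexivity. }
  subst v. replace (hk h - c + 1 + i) with (S (hk h - c - 1) + 1 + i) by lia.
  apply Hgen; auto. lia.
Qed.

Lemma walk_path_s h i r t d :
  i < hN h -> r <= i -> walk (host_graph h (2 * i)) (3 * hN h + i) t d ->
  walk (host_graph h (2 * i)) (3 * hN h + (i - r)) t (r + d).
Proof.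
  intros Hi. induction r as [|r IH]; intros Hr Hw.
  - rewrite Nat.sub_0_r. auto.
  - apply walk_step with (3 * hN h + (i - r)); [|apply IH; auto; lia]. left.
    eapply (host_graph_in h _ (2 * hN h + 2 * (i - S r))); [lia|].
    rewrite host_pair_path_s by lia. f_equal; lia.
Qed.

Lemma walk_colored_cycle h i :
  host_wf h -> i < hN h -> colored_cycle h i ->
  walk (host_graph h (2 * i)) (3 * hN h) (4 * hN h + 1) (2 * i + hk h + 2).
Proof.
  intros Hwf Hi Hc. pose proof Hwf as (_ & _ & Hk & _).
  assert (Hi0 : hcol h i = 0).
  { destruct Hc as (f & Hf & _ & H). rewrite <- Hf. apply (H 0). lia. }
  replace (3 * hN h) with (3 * hN h + (i - i)) by lia.
  replace (2 * i + hk h + 2) with (i + S (hk h - 0 + 1 + i)) by lia.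
  apply walk_path_s; auto. apply walk_step with (hN h + i).
  - left. eapply (host_graph_in h _ (2 * i + 1)); [lia|]. apply host_pair_source; auto.
  - replace (hN h + i) with (out_id h i) by (unfold out_id; rewrite Hi0; reflexivity).
    apply walk_colored_path; auto. lia.
Qed.

(** The distance to be recognised is [i] edges on each path, two attachments and [hk h] arcs;
    answers are reported with one added. *)
Lemma answer_colored_cycle h i a :
  host_wf h -> i < hN h ->
  is_answer (host_graph h (2 * i)) (3 * hN h) (4 * hN h + 1) a ->
  a = 2 * i + hk h + 3 <-> colored_cycle h i.
Proof.
  intros Hwf Hi Ha.
  assert (Ps : potential h i (3 * hN h) = 0).
  { rewrite <- (Nat.add_0_r (3 * hN h)), potential_path_s by lia. lia. }
  assert (Pt : potential h i (4 * hN h + 1) = 2 * i + hk h + 2).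
  { rewrite <- (Nat.add_0_r (4 * hN h + 1)), potential_path_t by lia. lia. }
  split.
  - intros ->. replace (2 * i + hk h + 3) with (S (2 * i + hk h + 2)) in Ha by lia.
    destruct Ha as [Hw _].
    apply (tight_walk h i _ _ _ Hwf Hi Hw) with (j := 0); lia.
  - intros Hc. assert (Hw := walk_colored_cycle h i Hwf Hi Hc).
    destruct a as [|d]; cbn [is_answer] in Ha.
    + exfalso. eapply Ha; eauto.
    + destruct Ha as [Hw' Hmin]. apply Hmin in Hw.
      apply (walk_potential h i) in Hw'; auto. lia.
Qed.

(** * Coloured cycles against cycles of the given graph *)

Lemma edge_arc h u v :
  host_wf h -> u <> v ->
  edge (ho h) (hE h) u v <-> exists q, q < hN h /\ arc h q = (u, v).
Proof.
  intros Hwf Hne. pose proof Hwf as (HN & _). split.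
  - intros [H|[Ho H]]; apply (In_nth _ _ (0, 0)) in H as (e & He & H).
    + exists (2 * e). split; [lia|]. unfold arc. rewrite half_even, H, even_double. auto.
    + exists (2 * e + 1). split; [lia|]. unfold arc.
      rewrite half_odd, H, even_double_succ, Ho. auto.
  - intros (q & Hq & Ha). unfold arc in Ha.
    destruct (parity_cases q) as [e [->| ->]];
      rewrite ?even_double, ?even_double_succ, ?half_even, ?half_odd in *;
      assert (Hi := nth_edge_in h e Hwf ltac:(lia));
      destruct (nth e (hE h) (0, 0)) as [a b].
    + injection Ha as -> ->. left; auto.
    + unfold edge. destruct (ho h); injection Ha as ? ?; subst; [congruence|]. auto.
Qed.

(** Distinct colours force distinct vertices, so the closed walk is simple. This holds for every
    colouring, which makes trying all of them sound. *)
Lemma colored_cycle_has_cycle h i :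
  host_wf h -> colored_cycle h i -> has_cycle (ho h) (hk h) (hE h).
Proof.
  intros Hwf (f & Hf0 & Hfk & H). pose proof Hwf as (_ & _ & Hk & _).
  exists (map f (seq 0 (hk h))). rewrite length_map, length_seq.
  split; auto. split.
  - apply NoDup_map_seq. intros a b Hra Hrb E.
    destruct (H a) as [<- _]; [lia|]. destruct (H b) as [<- _]; [lia|]. congruence.
  - assert (Hnth : forall a, a < hk h -> nth a (map f (seq 0 (hk h))) 0 = f a).
    { intros a Ha. rewrite (nth_indep _ 0 (f 0)) by (rewrite length_map, length_seq; auto).
      rewrite map_nth, seq_nth; auto. }
    intros a Ha. rewrite Hnth by auto.
    rewrite Hnth by (apply Nat.mod_upper_bound; lia).
    assert (E : f ((a + 1) mod hk h) = f (S a)).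
    { destruct (Nat.eq_dec (a + 1) (hk h)) as [E|E].
      - rewrite E, Nat.Div0.mod_same. replace (S a) with (hk h) by lia. congruence.
      - rewrite Nat.mod_small by lia. f_equal; lia. }
    rewrite E. destruct (H a) as [Hc Hq]; [lia|].
    apply edge_arc; auto. intros E'.
    destruct (Nat.eq_dec (S a) (hk h)) as [Ek|Ek].
    + rewrite Ek in E'. destruct (H 0) as [Hc0 _]; [lia|]. rewrite E', Hfk, <- Hf0 in Hc. lia.
    + destruct (H (S a)) as [Hc1 _]; [lia|]. rewrite <- E' in Hc1. lia.
Qed.

Lemma has_cycle_colored_cycle h (p : list nat) :
  host_wf h -> length p = hk h -> NoDup p ->
  (forall i, i < hk h -> edge (ho h) (hE h) (nth i p 0) (nth ((i + 1) mod hk h) p 0)) ->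
  (forall i, i < hk h -> hcol h (nth i p 0) = i) ->
  exists i, i < hN h /\ colored_cycle h i.
Proof.
  intros Hwf Hl Hnd He Hc. pose proof Hwf as (_ & _ & Hk & _).
  assert (Hq : forall a, a < hk h -> exists q, q < hN h /\
     arc h q = (nth a p 0, nth ((a + 1) mod hk h) p 0)).
  { intros a Ha. apply edge_arc; auto. intros E.
    assert (Hlt : (a + 1) mod hk h < hk h) by (apply Nat.mod_upper_bound; lia).
    apply (proj1 (NoDup_nth p 0) Hnd) in E; try lia.
    destruct (Nat.eq_dec (a + 1) (hk h)) as [E'|E'].
    - rewrite E', Nat.Div0.mod_same in E. lia.
    - rewrite Nat.mod_small in E; lia. }
  exists (nth 0 p 0). split.
  - destruct (Hq 0) as (q & Hlt & Ha); [lia|]. apply (arc_lt _ _ _ _ Hwf Hlt Ha).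
  (* The reduction makes the closing position [hk h] the starting vertex again. *)
  - exists (fun a => nth (a mod hk h) p 0).
    rewrite Nat.Div0.mod_same, Nat.Div0.mod_0_l. split; auto. split; auto.
    intros a Ha. rewrite (Nat.mod_small a) by lia. split.
    + apply Hc; lia.
    + rewrite <- Nat.add_1_r. apply Hq; lia.
Qed.

Lemma has_cycle_iff_colored o k (E : list (nat * nat)) L n :
  let N := 2 * length E in
  let h z := Host N k o E (color L k z) in
  simple_graph o n E -> n <= N -> 1 <= length E -> 3 <= k -> N <= 2 ^ L -> 0 < L ->
  (has_cycle o k E <->
   exists z i, z < color_base L k ^ k /\ i < N /\ colored_cycle (h z) i).
Proof.
  intros N h Hg Hn Hm Hk HL HL0.
  assert (Hwf : forall z, host_wf (h z)).
  { intros z. destruct Hg as (G1 & G2 & G3).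
    split; [reflexivity|]. split; [auto|]. split; [auto|]. split.
    - split; [auto|]. split; [|auto]. intros u v H. apply G2 in H. simpl; lia.
    - intros v. apply color_lt. simpl; lia. }
  split.
  - intros (p & Hl & Hnd & He).
    assert (Hlt : forall i, i < k -> nth i p 0 < 2 ^ L).
    { intros i Hi. apply Nat.lt_le_trans with N; auto.
      destruct (He i Hi) as [H|[_ H]]; apply (proj1 (proj2 Hg)) in H; lia. }
    destruct (color_complete L k (fun i => nth i p 0)) as (z & Hz & Hc); auto.
    + intros i j Hi Hj E'. apply (proj1 (NoDup_nth p 0) Hnd); auto; lia.
    + destruct (has_cycle_colored_cycle (h z) p) as (i & Hi & Hcc); auto.
      exists z, i. auto.
  - intros (z & i & _ & _ & Hcc). apply (colored_cycle_has_cycle _ _ (Hwf z) Hcc).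
Qed.

(** * Update sequences *)

Definition del (h : host) (p : nat) : operation :=
  Delete (fst (host_pair h p)) (snd (host_pair h p)).

Definition ins (h : host) (p : nat) : operation :=
  Insert (fst (host_pair h p)) (snd (host_pair h p)) 1.

Fixpoint dec_ops (h : host) (i n : nat) : list operation :=
  match n with
  | 0 => []
  | S n' => Query :: del h (2 * i) :: del h (2 * i + 1) :: dec_ops h (S i) n'
  end.

(** [Insert] puts the new edge in front, so the larger index goes first if the graph is to remain a
    suffix of the edge sequence. *)
Fixpoint inc_ops (h : host) (n : nat) : list operation :=
  match n with
  | 0 => []
  | S n' => ins h (2 * n' + 1) :: ins h (2 * n') :: Query :: inc_ops h n'
  end.

Definition host_ops (md : mode) (h : host) : list operation :=
  match md with
  | Decremental => dec_ops h 0 (hN h)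
  | Incremental => inc_ops h (hN h)
  end.

Definition first_edge (md : mode) (N : nat) : nat :=
  match md with Decremental => 0 | Incremental => 2 * N end.

Lemma apply_ins h p :
  p < 5 * hN h -> apply_op (ins h p) (host_graph h (S p)) = host_graph h p.
Proof.
  intros Hp. rewrite (host_graph_cons h p) by auto. simpl.
  rewrite <- surjective_pairing. reflexivity.
Qed.

Lemma dec_ops_length h i n : length (dec_ops h i n) = 3 * n.
Proof. revert i; induction n as [|n IH]; intros i; simpl; auto. rewrite IH. lia. Qed.

Lemma inc_ops_length h n : length (inc_ops h n) = 3 * n.
Proof. induction n as [|n IH]; simpl; auto. rewrite IH. lia. Qed.

Lemma host_ops_length md h : length (host_ops md h) = 3 * hN h.
Proof. destruct md; [apply inc_ops_length|apply dec_ops_length]. Qed.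

Lemma dec_ops_valid h W i n :
  host_wf h -> 1 <= W -> i + n <= hN h ->
  valid_ops Decremental (6 * hN h + 3) W (host_graph h (2 * i)) (dec_ops h i n) /\
  max_edges (host_graph h (2 * i)) (dec_ops h i n) = 5 * hN h - 2 * i.
Proof.
  intros Hwf HW. revert i. induction n as [|n IH]; intros i Hi.
  - cbn [dec_ops valid_ops max_edges]. rewrite host_graph_length.
    split; [split; [apply host_graph_weighted; auto|auto]|lia].
  - destruct (IH (S i)) as [IH1 IH2]; [lia|].
    assert (E1 : apply_op (del h (2 * i)) (host_graph h (2 * i)) = host_graph h (S (2 * i))).
    { apply host_graph_delete; auto; lia. }
    assert (E2 : apply_op (del h (2 * i + 1)) (host_graph h (S (2 * i))) = host_graph h (2 * S i)).
    { replace (S (2 * i)) with (2 * i + 1) by lia.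
      replace (2 * S i) with (S (2 * i + 1)) by lia.
      apply host_graph_delete; auto; lia. }
    assert (E0 : apply_op Query (host_graph h (2 * i)) = host_graph h (2 * i)) by reflexivity.
    cbn [dec_ops valid_ops max_edges]. rewrite E0, E1, E2, IH2, !host_graph_length.
    split; [|lia].
    split; [apply host_graph_weighted; auto|]. split; [exact I|].
    split; [apply host_graph_weighted; auto|].
    split; [split; [auto|apply host_graph_joins; lia]|].
    split; [apply host_graph_weighted; auto|]. split; [split; [auto|]|auto].
    replace (S (2 * i)) with (2 * i + 1) by lia. apply host_graph_joins; lia.
Qed.

Lemma inc_ops_valid h W n :
  host_wf h -> 1 <= W -> n <= hN h ->
  valid_ops Incremental (6 * hN h + 3) W (host_graph h (2 * n)) (inc_ops h n) /\
  max_edges (host_graph h (2 * n)) (inc_ops h n) = 5 * hN h.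
Proof.
  intros Hwf HW. induction n as [|n IH]; intros Hn.
  - cbn [inc_ops valid_ops max_edges]. rewrite host_graph_length.
    split; [split; [apply host_graph_weighted; auto|auto]|lia].
  - destruct IH as [IH1 IH2]; [lia|].
    assert (E1 : apply_op (ins h (2 * n + 1)) (host_graph h (2 * S n)) = host_graph h (2 * n + 1)).
    { replace (2 * S n) with (S (2 * n + 1)) by lia. apply apply_ins; lia. }
    assert (E2 : apply_op (ins h (2 * n)) (host_graph h (2 * n + 1)) = host_graph h (2 * n)).
    { replace (2 * n + 1) with (S (2 * n)) by lia. apply apply_ins; lia. }
    assert (E0 : apply_op Query (host_graph h (2 * n)) = host_graph h (2 * n)) by reflexivity.
    cbn [inc_ops valid_ops max_edges]. rewrite E1, E2, E0, IH2, !host_graph_length.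
    split; [|lia].
    split; [apply host_graph_weighted; auto|]. split; [reflexivity|].
    split; [apply host_graph_weighted; auto|]. split; [reflexivity|].
    split; [apply host_graph_weighted; auto|]. split; [exact I|auto].
Qed.

(** The full graph occurs in both modes, at the start or at the end. The exact value of the maximum
    is needed because it determines the word size. *)
Lemma host_ops_valid md h W :
  host_wf h -> 1 <= W ->
  valid_ops md (6 * hN h + 3) W (host_graph h (first_edge md (hN h))) (host_ops md h) /\
  max_edges (host_graph h (first_edge md (hN h))) (host_ops md h) = 5 * hN h.
Proof.
  intros Hwf HW. destruct md; simpl first_edge; unfold host_ops.
  - apply inc_ops_valid; auto.
  - pose proof (dec_ops_valid h W 0 (hN h) Hwf HW (Nat.le_refl _)) as H.
    rewrite Nat.mul_0_r, Nat.sub_0_r in H. auto.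
Qed.

(** * The reduction as a program *)

Lemma wp_le w c T T' (Q : env -> (nat -> nat) -> Prop) s M :
  wp w c T Q s M -> T <= T' -> wp w c T' Q s M.
Proof. intros H HT; eapply wp_mono; eauto. Qed.

(** Adding the budgets of the branches, instead of sharing one, lets each branch determine its own
    by unification. *)
Lemma wp_if w e1 e2 c1 c2 T1 T2 (Q : env -> (nat -> nat) -> Prop) s M :
  safe w s e1 -> safe w s e2 ->
  (ev s e1 = ev s e2 -> wp w c1 T1 Q s M) ->
  (ev s e1 <> ev s e2 -> wp w c2 T2 Q s M) ->
  wp w (IfEq e1 e2 c1 c2) (esize e1 + esize e2 + 3 + (T1 + T2)) Q s M.
Proof.
  intros H1 H2 H3 H4. apply wp_ifeq; auto; intros E.
  - apply wp_le with T1; auto; lia.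
  - apply wp_le with T2; auto; lia.
Qed.

Fixpoint rep (n : nat) (c : cmd) : cmd :=
  match n with 0 => Skip | S n' => Seq c (rep n' c) end.

Definition For (x y : var) (c : cmd) : cmd :=
  Seq (Asg x (C 0)) (While (V x) (V y) (Seq c (Asg x (B Add (V x) (C 1))))).

(** Each round adds four steps for the test and its jumps and four for the increment; initialisation
    takes two and the last test four. *)
Lemma wp_for w x y n c T (I : nat -> env -> (nat -> nat) -> Prop)
    (Q : env -> (nat -> nat) -> Prop) s M :
  n + 1 < 2 ^ w ->
  (forall i s' M', i <= n -> I i s' M' -> s' x = i /\ s' y = n) ->
  I 0 (set s x 0) M ->
  (forall i s' M', i < n -> I i s' M' ->
     wp w c T (fun s2 M2 => s2 x = i /\ I (S i) (set s2 x (S i)) M2) s' M') ->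
  (forall s' M', I n s' M' -> Q s' M') ->
  wp w (For x y c) (n * (T + 8) + 6) Q s M.
Proof.
  intros Hn Hxy H0 Hstep HQ. apply wp_le with (2 + (n * (T + 8) + 4)); [|lia].
  apply wp_seq, wp_asg; [simpl; lia|].
  cbn [ev].
  assert (Hloop : forall r i s' M', i + r = n -> I i s' M' ->
    wp w (While (V x) (V y) (Seq c (Asg x (B Add (V x) (C 1))))) (r * (T + 8) + 4) Q s' M').
  { induction r as [|r IH]; intros i s' M' Hr Hi;
      destruct (Hxy i s' M') as [Ex Ey]; auto; try lia.
    - apply wp_while_stop; simpl; try lia.
      apply HQ. replace n with i by lia. auto.
    - eapply wp_while_step with (T2 := r * (T + 8) + 4); simpl; try lia.
      + apply wp_seq. eapply wp_mono; [apply (Hstep i); auto; lia|apply Nat.le_refl|].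
        intros s2 M2 [E2 H2]. apply wp_asg; simpl; [lia|].
        rewrite E2, Nat.add_1_r. apply (IH (S i)); auto. lia.
      + simpl; lia. }
  apply (Hloop n 0); auto.
Qed.

Lemma safe_div w s e1 e2 : safe w s e1 -> safe w s e2 -> safe w s (B Div e1 e2).
Proof.
  intros H1 H2. simpl. repeat split; auto.
  apply Nat.le_lt_trans with (ev s e1); [|apply ev_lt; auto].
  destruct (ev s e2) as [|n]; [simpl; lia|].
  apply Nat.Div0.div_le_upper_bound. nia.
Qed.

Lemma safe_mod w s e1 e2 : safe w s e1 -> safe w s e2 -> safe w s (B Mod e1 e2).
Proof.
  intros H1 H2. simpl. repeat split; auto.
  apply Nat.le_lt_trans with (ev s e1); [|apply ev_lt; auto].
  apply Nat.Div0.mod_le.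
Qed.

Lemma safe_shr w s e1 e2 : safe w s e1 -> safe w s e2 -> safe w s (B Shr e1 e2).
Proof.
  intros H1 H2. simpl. repeat split; auto.
  apply Nat.le_lt_trans with (ev s e1); [|apply ev_lt; auto].
  rewrite Nat.shiftr_div_pow2.
  apply Nat.Div0.div_le_upper_bound.
  assert (0 < 2 ^ ev s e2) by (apply Nat.neq_0_lt_0, Nat.pow_nonzero; lia). nia.
Qed.

Lemma safe_add w s e1 e2 :
  safe w s e1 -> safe w s e2 -> ev s e1 + ev s e2 < 2 ^ w -> safe w s (B Add e1 e2).
Proof. simpl; auto. Qed.

Lemma safe_mul w s e1 e2 :
  safe w s e1 -> safe w s e2 -> ev s e1 * ev s e2 < 2 ^ w -> safe w s (B Mul e1 e2).
Proof. simpl; auto. Qed.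

Lemma safe_sub w s e1 e2 :
  safe w s e1 -> safe w s e2 -> ev s e2 <= ev s e1 -> safe w s (B Sub e1 e2).
Proof. intros H1 H2 H. simpl. apply ev_lt in H1 as H3. repeat split; auto; lia. Qed.

Ltac vsimp := cbn [ev ideal_op set var_beq safe].

Ltac solve_safe :=
  repeat match goal with
  | |- safe _ _ (B Div _ _) => apply safe_div
  | |- safe _ _ (B Mod _ _) => apply safe_mod
  | |- safe _ _ (B Shr _ _) => apply safe_shr
  | |- safe _ _ (B Add _ _) => apply safe_add
  | |- safe _ _ (B Mul _ _) => apply safe_mul
  | |- safe _ _ (B Sub _ _) => apply safe_sub
  end; vsimp; try lia.

(** Budgets remain existential variables here; the proofs open with [wp_le] and compare the
    accumulated sum with a rounded constant at the end. *)
Ltac wstep :=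
  lazymatch goal with
  | |- wp _ (Seq _ _) _ _ _ _ => eapply wp_seq
  | |- wp _ (Asg _ _) _ _ _ _ => eapply wp_asg; [solve_safe|]
  | |- wp _ (Fetch _ _) _ _ _ _ => eapply wp_fetch; [solve_safe|]
  | |- wp _ (Store _ _) _ _ _ _ => eapply wp_store; [solve_safe|solve_safe|]
  | |- wp _ Skip _ _ _ _ => eapply wp_skip
  | |- wp _ (IfEq _ _ _ _) _ _ _ _ => eapply wp_if; [solve_safe|solve_safe| |]
  end.

Definition same_except (l : list var) (s s' : env) : Prop :=
  forall x, ~ In x l -> s' x = s x.

Lemma same_except_refl l s : same_except l s s.
Proof. intros x Hx; auto. Qed.

Lemma same_except_set l s s' x v :
  In x l -> same_except l s s' -> same_except l s (set s' x v).
Proof.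
  intros Hx H y Hy. unfold set. destruct (var_beq y x) eqn:E; auto.
  apply internal_var_dec_bl in E. congruence.
Qed.

Lemma same_except_weaken l l' s s' :
  same_except l s s' -> forallb (fun x => existsb (var_beq x) l') l = true ->
  same_except l' s s'.
Proof.
  intros H Hl x Hx. apply H. intros Hin. apply Hx.
  rewrite forallb_forall in Hl. apply Hl, existsb_exists in Hin as (y & Hy & E).
  apply internal_var_dec_bl in E. congruence.
Qed.

Lemma same_except_trans l s1 s2 s3 :
  same_except l s1 s2 -> same_except l s2 s3 -> same_except l s1 s3.
Proof. intros H1 H2 x Hx. rewrite H2, H1; auto. Qed.

Ltac frame :=
  repeat (apply same_except_set; [cbn; tauto|]);
  first [apply same_except_refl
        |eapply same_except_weaken; [eassumption|reflexivity]].

Ltac not_in := cbn; intuition discriminate.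

(** [sw] is the word size of the reduction, [swD] that of the simulated
    algorithm, [sL] the number of bits of a vertex, [sS] the stride between the
    simulated memories and [sZ] the number of colourings. *)
Record setup : Set := Setup {
  sk : nat;
  so : orientation;
  sE : list (nat * nat);
  sL : nat;
  sw : nat;
  swD : nat }.

Definition sN (g : setup) : nat := 2 * length (sE g).
Definition sW (g : setup) : nat := 2 ^ swD g.
(** A region must contain the cells that the simulated machine can address and the three words for
    each of [5 N] edges, which may be more when its words are short. The product bounds both. *)
Definition sS (g : setup) : nat := sW g * (15 * sN g).
Definition sD (g : setup) : nat := color_base (sL g) (sk g).
Definition sZ (g : setup) : nat := sD g ^ sk g.

(** The inequality leaves room for the input and one region per colouring; its smaller terms cover
    vertex names, counters and the constants in expressions. *)
Definition setup_ok (g : setup) : Prop :=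
  1 <= length (sE g) /\ 3 <= sk g /\ 1 <= sL g /\ swD g < sw g /\
  (sZ g + 2) * sS g + 20 * sN g + sk g + 10 <= 2 ^ sw g /\
  simple_graph (so g) (sN g) (sE g) /\ sN g <= 2 ^ sL g.

Definition glob (g : setup) (s : env) : Prop :=
  s vm = length (sE g) /\ s vN = sN g /\ s vW = sW g /\ s vS = sS g /\
  s vL = sL g /\ s vD = sD g /\ s vZ = sZ g.

Lemma glob_frame g s s' l :
  glob g s -> same_except l s s' ->
  forallb (fun x => negb (existsb (var_beq x) l)) [vm; vN; vW; vS; vL; vD; vZ] = true ->
  glob g s'.
Proof.
  intros Hg Hs Hl.
  assert (H : forall x, In x [vm; vN; vW; vS; vL; vD; vZ] -> s' x = s x).
  { intros x Hx. apply Hs. intros Hin.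
    rewrite forallb_forall in Hl. specialize (Hl x Hx).
    apply Bool.negb_true_iff in Hl.
    assert (existsb (var_beq x) l = true); [|congruence].
    apply existsb_exists. exists x. split; auto. apply internal_var_dec_lb; auto. }
  unfold glob. rewrite !H by (cbn; tauto). exact Hg.
Qed.

(** Consequences in which products such as [sZ g * sS g] are atoms, so that overflow conditions
    become linear. *)
Record sizes (g : setup) : Prop := Sizes {
  sizes_k : 3 <= sk g;
  sizes_L : 1 <= sL g;
  sizes_N : 2 <= sN g;
  sizes_W : 1 <= sW g;
  sizes_WS : sW g <= sS g;
  sizes_NS : 15 * sN g <= sS g;
  sizes_LD : sL g <= sD g;
  sizes_kD : sk g <= sD g;
  sizes_DZ : sD g <= sZ g;
  sizes_ZS : sZ g * sS g + 2 * sS g + 20 * sN g + sk g + 10 <= 2 ^ sw g;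
  sizes_Z : sZ g <= sZ g * sS g }.

Lemma setup_sizes g : setup_ok g -> sizes g.
Proof.
  intros (Hm & Hk & HL & Hw & Hroom & _).
  assert (HN : 2 <= sN g) by (unfold sN; lia).
  assert (HW : 1 <= sW g).
  { unfold sW. apply Nat.neq_0_lt_0, Nat.pow_nonzero; lia. }
  assert (HS : sW g <= sS g) by (unfold sS; nia).
  assert (HS' : 15 * sN g <= sS g) by (unfold sS; nia).
  assert (HD : sL g <= sD g).
  { unfold sD, color_base. assert (1 <= sk g * sk g) by nia. nia. }
  assert (HD' : sk g <= sD g).
  { unfold sD, color_base. nia. }
  assert (HZ : sD g <= sZ g).
  { unfold sZ. rewrite <- (Nat.pow_1_r (sD g)) at 1. apply Nat.pow_le_mono_r; lia. }
  split; auto; nia.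
Qed.

(** * The program that colours a vertex *)

Definition color_step_cmd (k : nat) : cmd :=
  Seq (Asg vT (B Mod (V vQ) (V vD)))
  (Seq (Asg vQ (B Div (V vQ) (V vD)))
  (IfEq (V vY) (B Mod (B Div (B Div (V vT) (V vL)) (C 2)) (C k))
    (IfEq (B Mod (B Shr (V vX) (B Mod (V vT) (V vL))) (C 2))
          (B Mod (B Div (V vT) (V vL)) (C 2))
      (Asg vY (B Mod (B Div (B Div (B Div (V vT) (V vL)) (C 2)) (C k)) (C k)))
      Skip)
    Skip)).

Lemma wp_color_step g s M q y v (Q : env -> (nat -> nat) -> Prop) :
  sizes g -> glob g s -> s vQ = q -> s vY = y -> s vX = v ->
  q < 2 ^ sw g -> y < sk g -> v < 2 ^ sw g ->
  (forall s', same_except [vY; vQ; vT] s s' -> s' vQ = q / sD g ->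
     s' vY = color_step (sL g) (sk g) v (q mod sD g) y -> Q s' M) ->
  wp (sw g) (color_step_cmd (sk g)) 60 Q s M.
Proof.
  intros Hsz (Gm & GN & GW & GS & GL & GD & GZ) Hq Hy Hv Bq By Bv HQ.
  destruct Hsz.
  assert (Bt : s vQ mod s vD < 2 ^ sw g).
  { apply Nat.le_lt_trans with (s vQ); [apply Nat.Div0.mod_le|lia]. }
  assert (Bd : s vQ / s vD < 2 ^ sw g).
  { apply Nat.le_lt_trans with (s vQ); [|lia].
    apply Nat.Div0.div_le_upper_bound. nia. }
  pose proof Bt as Bt'. rewrite Hq, GD in Bt'.
  pose proof Bd as Bd'. rewrite Hq, GD in Bd'.
  eapply wp_le.
  - unfold color_step_cmd. wstep. wstep. wstep. wstep. wstep.
    + vsimp. rewrite Hq, GD, Hy, GL. intros E1. wstep.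
      * vsimp. rewrite ?Hq, ?GD, ?GL, ?Hv. intros E2. wstep.
        vsimp. rewrite ?Hq, ?GD, ?GL. apply HQ.
        -- frame.
        -- vsimp. reflexivity.
        -- vsimp. unfold color_step. rewrite <- E1, E2, !Nat.eqb_refl. reflexivity.
      * vsimp. rewrite ?Hq, ?GD, ?GL, ?Hv. intros E2. wstep. apply HQ.
        -- frame.
        -- vsimp. congruence.
        -- vsimp. unfold color_step. rewrite <- E1, Nat.eqb_refl.
           apply Nat.eqb_neq in E2. rewrite E2. auto.
    + vsimp. rewrite Hq, GD, Hy, GL. intros E1. wstep. apply HQ.
      * frame.
      * vsimp. congruence.
      * vsimp. unfold color_step. apply Nat.eqb_neq in E1. rewrite E1. auto.
  - cbn. lia.
Qed.

Definition color_cmd (k : nat) : cmd :=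
  Seq (Asg vY (C 0)) (Seq (Asg vQ (V vz)) (rep k (color_step_cmd k))).

Lemma wp_color g s M v (Q : env -> (nat -> nat) -> Prop) :
  sizes g -> glob g s -> s vX = v -> s vz < 2 ^ sw g -> v < 2 ^ sw g ->
  (forall s', same_except [vY; vQ; vT] s s' ->
     s' vY = color (sL g) (sk g) (s vz) v -> Q s' M) ->
  wp (sw g) (color_cmd (sk g)) (sk g * 60 + 4) Q s M.
Proof.
  intros Hsz Hg Hv Bz Bv HQ.
  assert (Hrep : forall r s0 q y, glob g s0 -> same_except [vY; vQ; vT] s s0 ->
    s0 vQ = q -> s0 vY = y -> q < 2 ^ sw g -> y < sk g ->
    (forall s', same_except [vY; vQ; vT] s s' ->
       s' vY = color_from (sL g) (sk g) r q v y -> Q s' M) ->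
    wp (sw g) (rep r (color_step_cmd (sk g))) (r * 60) Q s0 M).
  { induction r as [|r IH]; intros s0 q y G0 F0 E1 E2 B1 B2 HQ0.
    - apply wp_skip. apply HQ0; auto.
    - apply (wp_seq _ _ _ 60 (r * 60)).
      apply (wp_color_step g s0 M q y v); auto.
      { rewrite F0; auto. not_in. }
      intros s' F' E1' E2'.
      assert (F2 : same_except [vY; vQ; vT] s s').
      { intros x Hx. rewrite F'; auto. }
      apply (IH s' (q / sD g) (color_step (sL g) (sk g) v (q mod sD g) y)); auto.
      + eapply glob_frame; eauto.
      + apply Nat.le_lt_trans with q; auto.
        destruct (sD g) as [|n]; [simpl; lia|]. apply Nat.Div0.div_le_upper_bound. nia.
      + apply color_step_lt; auto. destruct Hsz; lia. }
  destruct Hsz.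
  eapply wp_le.
  - unfold color_cmd. wstep. wstep. wstep. wstep. vsimp.
    apply (Hrep (sk g) _ (s vz) 0); vsimp; auto; try lia.
    frame.
  - cbn. lia.
Qed.

(** * The program that writes the host graph into a region *)

Definition loc (g : setup) (b z f : nat) (s : env) : Prop :=
  glob g s /\ s vBase = b /\ s vz = z /\ s vFound = f.

Definition fits (g : setup) (b z : nat) : Prop :=
  z < sZ g /\ b + sS g + 20 * sN g + sk g + 10 <= 2 ^ sw g /\ sN g <= b.

Definition input (g : setup) (M : nat -> nat) : Prop :=
  forall a, a < sN g -> M a = nth a (edge_words (sE g)) 0.

(** The invariant while the edge list is written. As [a] is arbitrary, it also says that all cells
    after the written words are still zero, as preprocessing expects. *)
Definition gen (g : setup) (b z f : nat) (L : list wedge) (s : env) (M : nat -> nat)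
    : Prop :=
  loc g b z f s /\ s vPtr = b + 3 * length L /\ input g M /\
  forall a, M (b + a) = words (swD g) (wedge_words L) a.

Lemma loc_frame g b z f s s' l :
  loc g b z f s -> same_except l s s' ->
  forallb (fun x => negb (existsb (var_beq x) l))
    [vm; vN; vW; vS; vL; vD; vZ; vBase; vz; vFound] = true ->
  loc g b z f s'.
Proof.
  intros (Hg & H1 & H2 & H3) Hs Hl.
  rewrite forallb_forall in Hl.
  assert (H : forall x, In x [vBase; vz; vFound] -> s' x = s x).
  { intros x Hx. apply Hs. intros Hin.
    assert (Hl' := Hl x ltac:(cbn in *; tauto)).
    apply Bool.negb_true_iff in Hl'.
    assert (existsb (var_beq x) l = true); [|congruence].
    apply existsb_exists. exists x. split; auto. apply internal_var_dec_lb; auto. }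
  split; [|rewrite !H by (cbn; tauto); auto].
  eapply glob_frame; eauto. apply forallb_forall. intros x Hx. apply Hl. cbn in *; tauto.
Qed.

(** The reductions reproduce the truncation made by [words]; even the length 1 is reduced, since
    [vW] is 1 when the simulated words have no bits. *)
Definition emit (e1 e2 : expr) : cmd :=
  Seq (Store (V vPtr) (B Mod e1 (V vW)))
  (Seq (Store (B Add (V vPtr) (C 1)) (B Mod e2 (V vW)))
  (Seq (Store (B Add (V vPtr) (C 2)) (B Mod (C 1) (V vW)))
       (Asg vPtr (B Add (V vPtr) (C 3))))).

Lemma wedge_words_length L : length (wedge_words L) = 3 * length L.
Proof.
  induction L as [|[[u v] x] L IH]; simpl; auto. simpl in IH. rewrite IH. lia.
Qed.

Lemma wedge_words_app L L' : wedge_words (L ++ L') = wedge_words L ++ wedge_words L'.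
Proof. apply flat_map_app. Qed.

Lemma wp_emit g b z f L e1 e2 s M (Q : env -> (nat -> nat) -> Prop) :
  sizes g -> fits g b z -> gen g b z f L s M -> length L < 5 * sN g ->
  safe (sw g) s e1 -> safe (sw g) s e2 ->
  (forall M', gen g b z f (L ++ [((ev s e1, ev s e2), 1)])
       (set s vPtr (b + 3 * S (length L))) M' ->
     Q (set s vPtr (b + 3 * S (length L))) M') ->
  wp (sw g) (emit e1 e2) (esize e1 + esize e2 + 30) Q s M.
Proof.
  intros Hsz (F1 & F2 & F3) (Hloc & Hptr & Hin & Hmem) Hlen Hs1 Hs2 HQ.
  pose proof Hloc as ((Gm & GN & GW & GS & GL & GD & GZ) & Hb & Hz & Hf).
  destruct Hsz.
  eapply wp_le.
  - unfold emit. wstep. wstep; auto. wstep. wstep; auto. wstep. wstep. wstep.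
    vsimp. rewrite Hptr, GW. replace (b + 3 * length L + 3) with (b + 3 * S (length L)) by lia.
    apply HQ. split; [|split; [|split]].
    + unfold loc, glob. vsimp. auto 10.
    + vsimp. rewrite length_app. simpl length. lia.
    + intros a Ha. rewrite !upd_other by lia. auto.
    + intros a. unfold words. rewrite wedge_words_app.
      cbn [wedge_words flat_map app]. unfold upd.
      destruct (Nat.eqb_spec (b + a) (b + 3 * length L + 2)).
      { rewrite app_nth2 by (rewrite wedge_words_length; lia).
        rewrite wedge_words_length. replace (a - 3 * length L) with 2 by lia. reflexivity. }
      destruct (Nat.eqb_spec (b + a) (b + 3 * length L + 1)).
      { rewrite app_nth2 by (rewrite wedge_words_length; lia).
        rewrite wedge_words_length. replace (a - 3 * length L) with 1 by lia. reflexivity. }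
      destruct (Nat.eqb_spec (b + a) (b + 3 * length L)).
      { rewrite app_nth2 by (rewrite wedge_words_length; lia).
        rewrite wedge_words_length. replace (a - 3 * length L) with 0 by lia. reflexivity. }
      rewrite Hmem. unfold words.
      destruct (Nat.lt_ge_cases a (3 * length L)).
      * rewrite app_nth1; auto. rewrite wedge_words_length; auto.
      * rewrite !nth_overflow; auto; rewrite ?length_app, wedge_words_length; simpl; lia.
  - cbn. lia.
Qed.

Definition hst (g : setup) (z : nat) : host :=
  Host (sN g) (sk g) (so g) (sE g) (color (sL g) (sk g) z).

Lemma hst_wf g z : setup_ok g -> host_wf (hst g z).
Proof.
  intros (Hm & Hk & HL & Hw & Hroom & Hg & HN).
  split; [reflexivity|]. split; [auto|]. split; [auto|]. split; [auto|].
  intros v. apply color_lt. simpl; lia.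
Qed.

Definition host_part (h : host) (p n : nat) : list wedge :=
  map (fun j => (host_pair h j, 1)) (seq p (n - p)).

Lemma host_part_snoc h p n :
  p <= n -> host_part h p (S n) = host_part h p n ++ [(host_pair h n, 1)].
Proof.
  intros H. unfold host_part. replace (S n - p) with (S (n - p)) by lia.
  rewrite seq_S, map_app. simpl. replace (p + (n - p)) with n by lia. reflexivity.
Qed.

Lemma host_part_length h p n : length (host_part h p n) = n - p.
Proof. unfold host_part. rewrite length_map, length_seq. auto. Qed.

Lemma wp_emit_next g b z f p n e1 e2 s M (Q : env -> (nat -> nat) -> Prop) :
  sizes g -> fits g b z -> gen g b z f (host_part (hst g z) p n) s M ->
  p <= n < 5 * sN g -> host_pair (hst g z) n = (ev s e1, ev s e2) ->
  safe (sw g) s e1 -> safe (sw g) s e2 ->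
  (forall r M', gen g b z f (host_part (hst g z) p (S n)) (set s vPtr r) M' ->
     Q (set s vPtr r) M') ->
  wp (sw g) (emit e1 e2) (esize e1 + esize e2 + 30) Q s M.
Proof.
  intros Hsz Hfit Hgen Hn Hp Hs1 Hs2 HQ.
  eapply wp_emit; eauto.
  - rewrite host_part_length. lia.
  - intros M' HM'. apply HQ. rewrite host_part_snoc, Hp by lia. auto.
Qed.

Definition mulN (c : nat) : expr := B Mul (C c) (V vN).

Definition sink_e (i : var) : expr := B Add (mulN 2) (V i).
Definition path_t_e (i : var) : expr := B Add (B Add (mulN 4) (C 1)) (V i).
Definition path_s_e (i : var) : expr := B Add (mulN 3) (V i).
Definition source_e (i : var) : expr := B Add (mulN 1) (V i).

Ltac host_exprs := unfold sink_e, path_t_e, path_s_e, source_e, mulN in *.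

Definition attach_cmd : cmd :=
  For vI vN (Seq (emit (sink_e vI) (path_t_e vI)) (emit (path_s_e vI) (source_e vI))).

Definition paths_cmd : cmd :=
  For vI vN
    (Seq (emit (path_s_e vI) (B Add (mulN 3) (B Add (V vI) (C 1))))
         (emit (path_t_e vI) (B Add (B Add (mulN 4) (C 1)) (B Add (V vI) (C 1))))).

Lemma gen_set_vI g b z f L s M i : gen g b z f L s M -> gen g b z f L (set s vI i) M.
Proof.
  intros (H1 & H2 & H3 & H4). split; [|split; auto].
  eapply (loc_frame _ _ _ _ s _ [vI]); eauto.
  frame.
Qed.

Ltac unloc H :=
  let Gm := fresh "Gm" in let GN := fresh "GN" in let GW := fresh "GW" in
  let GS := fresh "GS" in let GL := fresh "GL" in let GD := fresh "GD" in
  let GZ := fresh "GZ" in let Gb := fresh "Gb" in let Gz := fresh "Gz" in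
  let Gf := fresh "Gf" in
  pose proof H as ((Gm & GN & GW & GS & GL & GD & GZ) & Gb & Gz & Gf).

Lemma wp_attach g b z f s M (Q : env -> (nat -> nat) -> Prop) :
  sizes g -> fits g b z -> gen g b z f (host_part (hst g z) 0 0) s M ->
  (forall s' M', gen g b z f (host_part (hst g z) 0 (2 * sN g)) s' M' -> Q s' M') ->
  wp (sw g) attach_cmd (sN g * (102 + 8) + 6) Q s M.
Proof.
  intros Hsz Hfit H0 HQ. pose proof Hfit as (F1 & F2 & F3). pose proof Hsz as Hsz'. destruct Hsz'.
  unfold attach_cmd. apply wp_for with (I := fun i s M =>
    gen g b z f (host_part (hst g z) 0 (2 * i)) s M /\ s vI = i) (T := 102).
  - lia.
  - intros i s' M' Hi (Hgen & HI). split; auto. apply Hgen.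
  - split; [|reflexivity]. apply gen_set_vI. auto.
  - intros i s' M' Hi (Hgen & HI). pose proof Hgen as (Hl & _). unloc Hl.
    eapply wp_le.
    + wstep. eapply (wp_emit_next g b z f 0 (2 * i)); eauto; try lia.
      * rewrite host_pair_sink by auto. host_exprs. vsimp. cbn [hN hst]. f_equal; lia.
      * unfold sink_e, mulN. solve_safe.
      * unfold path_t_e, mulN. solve_safe.
      * intros r M1 H1. pose proof H1 as (Hl1 & _). unloc Hl1.
        eapply (wp_emit_next g b z f 0 (S (2 * i))); eauto; try lia.
        -- rewrite <- Nat.add_1_r, host_pair_source by auto. host_exprs. vsimp. cbn [hN hst]. f_equal; lia.
        -- unfold path_s_e, mulN. solve_safe.
        -- unfold source_e, mulN. solve_safe.
        -- intros r2 M2 H2. split; [vsimp; auto|]. split; [|reflexivity].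
           apply gen_set_vI. replace (2 * S i) with (S (S (2 * i))) by lia. auto.
    + cbn. lia.
  - intros s' M' (Hgen & _). auto.
Qed.

Lemma wp_paths g b z f p s M (Q : env -> (nat -> nat) -> Prop) :
  sizes g -> fits g b z -> p <= 2 * sN g ->
  gen g b z f (host_part (hst g z) p (2 * sN g)) s M ->
  (forall s' M', gen g b z f (host_part (hst g z) p (4 * sN g)) s' M' -> Q s' M') ->
  wp (sw g) paths_cmd (sN g * (112 + 8) + 6) Q s M.
Proof.
  intros Hsz Hfit Hp H0 HQ. pose proof Hfit as (F1 & F2 & F3). pose proof Hsz as Hsz'. destruct Hsz'.
  unfold paths_cmd. apply wp_for with (I := fun i s M =>
    gen g b z f (host_part (hst g z) p (2 * sN g + 2 * i)) s M /\ s vI = i) (T := 112).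
  - lia.
  - intros i s' M' Hi (Hgen & HI). split; auto. apply Hgen.
  - split; [|reflexivity]. apply gen_set_vI. rewrite Nat.mul_0_r, Nat.add_0_r. auto.
  - intros i s' M' Hi (Hgen & HI). pose proof Hgen as (Hl & _). unloc Hl.
    eapply wp_le.
    + wstep. eapply (wp_emit_next g b z f p (2 * sN g + 2 * i)); eauto; try lia.
      * change (sN g) with (hN (hst g z)) at 1.
        rewrite host_pair_path_s by auto. host_exprs. vsimp. cbn [hN hst]. f_equal; lia.
      * unfold path_s_e, mulN. solve_safe.
      * unfold mulN. solve_safe.
      * intros r M1 H1. pose proof H1 as (Hl1 & _). unloc Hl1.
        eapply (wp_emit_next g b z f p (S (2 * sN g + 2 * i))); eauto; try lia.
        -- replace (S (2 * sN g + 2 * i)) with (2 * hN (hst g z) + (2 * i + 1))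
             by (cbn [hN hst]; lia).
           rewrite host_pair_path_t by auto. host_exprs. vsimp. cbn [hN hst]. f_equal; lia.
        -- unfold path_t_e, mulN. solve_safe.
        -- unfold mulN. solve_safe.
        -- intros r2 M2 H2. split; [vsimp; auto|]. split; [|reflexivity].
           apply gen_set_vI.
           replace (2 * sN g + 2 * S i) with (S (S (2 * sN g + 2 * i))) by lia. auto.
    + cbn. lia.
  - intros s' M' (Hgen & _). apply HQ.
    replace (4 * sN g) with (2 * sN g + 2 * sN g) by lia. auto.
Qed.

(** Handles slot [2 * vI + c]: the edge as listed for [c = 0], its reversal or the loop for
    [c = 1]. *)
Definition slot_cmd (k c : nat) : cmd :=
  Seq (Asg vX (V vU)) (Seq (color_cmd k) (Seq (Asg vCu (V vY))
  (Seq (Asg vX (V vV)) (Seq (color_cmd k) (Seq (Asg vCv (V vY))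
  (IfEq (B Mod (B Add (V vCu) (C 1)) (C k)) (V vCv)
    (Seq (IfEq (V vCu) (C 0) (Asg vX (B Add (mulN 1) (V vU))) (Asg vX (V vU)))
    (Seq (IfEq (V vCv) (C 0) (Asg vT (B Add (mulN 2) (V vV))) (Asg vT (V vV)))
         (emit (V vX) (V vT))))
    (emit (B Add (mulN 5) (C 2))
       (B Add (B Add (mulN 5) (C 3)) (B Add (B Mul (C 2) (V vI)) (C c)))))))))).

Definition slot_vars : list var := [vX; vY; vQ; vT; vCu; vCv; vPtr].

Lemma gen_frame g b z f L s s' M l :
  gen g b z f L s M -> same_except l s s' ->
  forallb (fun x => negb (existsb (var_beq x) l))
    [vm; vN; vW; vS; vL; vD; vZ; vBase; vz; vFound; vPtr] = true ->
  gen g b z f L s' M.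
Proof.
  intros (H1 & H2 & H3 & H4) Hs Hl. split; [|split; [|split; auto]].
  - eapply loc_frame; eauto. rewrite forallb_forall in *. intros x Hx. apply Hl. cbn in *; tauto.
  - rewrite Hs; auto. intros Hin. rewrite forallb_forall in Hl.
    specialize (Hl vPtr ltac:(cbn; tauto)). apply Bool.negb_true_iff in Hl.
    assert (existsb (var_beq vPtr) l = true); [|congruence].
    apply existsb_exists. exists vPtr. split; auto.
Qed.

Lemma wp_slot g b z f p q c s M u v (Q : env -> (nat -> nat) -> Prop) :
  setup_ok g -> fits g b z -> p <= 4 * sN g -> q < sN g ->
  gen g b z f (host_part (hst g z) p (4 * sN g + q)) s M ->
  s vU = u -> s vV = v -> arc (hst g z) q = (u, v) -> q = 2 * s vI + c ->
  (forall s' M', gen g b z f (host_part (hst g z) p (S (4 * sN g + q))) s' M' ->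
     same_except slot_vars s s' -> Q s' M') ->
  wp (sw g) (slot_cmd (sk g) c) (sk g * 120 + 200) Q s M.
Proof.
  intros Hok Hfit Hp Hq Hgen HU HV Harc HI HQ.
  pose proof (setup_sizes g Hok) as Hsz. pose proof Hfit as (F1 & F2 & F3).
  pose proof Hsz as Hsz'. destruct Hsz'.
  pose proof (hst_wf g z Hok) as Hwf.
  destruct (arc_lt _ _ _ _ Hwf Hq Harc) as [Hu Hv]. cbn [hN hst] in Hu, Hv.
  pose proof Hgen as (Hl & _). unloc Hl.
  set (cu := color (sL g) (sk g) z u). set (cv := color (sL g) (sk g) z v).
  assert (Hcu : cu < sk g) by (apply color_lt; lia).
  assert (Hcv : cv < sk g) by (apply color_lt; lia).
  eapply wp_le.
  - unfold slot_cmd. wstep. wstep. vsimp. wstep.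
    eapply (wp_color g _ M u); auto; try (vsimp; lia).
    { eapply (glob_frame g s _ [vX]); [apply Hl| |reflexivity].
      frame. }
    intros s1 S1 E1. change (set s vX (s vU) vz) with (s vz) in E1.
    rewrite Gz in E1. fold cu in E1.
    assert (A1 : same_except [vX; vY; vQ; vT] s s1).
    { eapply same_except_trans; [|eapply same_except_weaken; [exact S1|reflexivity]]. frame. }
    wstep. wstep. wstep. wstep.
    { rewrite A1 by not_in. lia. }
    wstep.
    assert (A2 : same_except [vX; vY; vQ; vT; vCu] s (set (set s1 vCu (ev s1 (V vY))) vX
       (ev (set s1 vCu (ev s1 (V vY))) (V vV)))).
    { frame. }
    eapply (wp_color g _ M v); auto.
    { eapply glob_frame; [apply Hl|exact A2|reflexivity]. }
    { vsimp. rewrite A1 by not_in. auto. }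
    { vsimp. rewrite A1 by not_in. lia. }
    { lia. }
    intros s2 S2 E2.
    assert (A3 : same_except [vX; vY; vQ; vT; vCu] s s2).
    { eapply same_except_trans; [exact A2|]. frame. }
    assert (C2 : s2 vCu = cu).
    { rewrite S2 by not_in. exact E1. }
    replace (set (set s1 vCu (ev s1 (V vY))) vX (ev (set s1 vCu (ev s1 (V vY))) (V vV)) vz)
      with z in E2 by (vsimp; rewrite A1 by not_in; auto).
    fold cv in E2. clear S1 S2 A1 A2 E1 s1.
    wstep. wstep. vsimp. rewrite E2.
    set (s3 := set s2 vCv cv).
    assert (A4 : same_except [vX; vY; vQ; vT; vCu; vCv] s s3).
    { frame. }
    assert (C3 : s3 vCu = cu) by exact C2.
    assert (C4 : s3 vCv = cv) by reflexivity.
    assert (N3 : s3 vN = sN g) by (rewrite A4 by not_in; auto).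
    assert (U3 : s3 vU = u) by (rewrite A4 by not_in; auto).
    assert (V3 : s3 vV = v) by (rewrite A4 by not_in; auto).
    assert (I3 : s3 vI = s vI) by (rewrite A4 by not_in; auto).
    clearbody s3. clear A3 C2 E2 s2.
    assert (G3 : gen g b z f (host_part (hst g z) p (4 * sN g + q)) s3 M).
    { eapply gen_frame; eauto. }
    assert (HP : host_pair (hst g z) (4 * sN g + q) = slot (hst g z) q)
      by apply host_pair_slot.
    unfold slot in HP. rewrite Harc in HP. cbn [hcol hst hk hN] in HP. fold cu cv in HP.
    wstep.
    + vsimp. rewrite C3, C4. intros E. rewrite E, Nat.eqb_refl in HP.
      wstep. eapply (wp_mono _ _ _ _ (fun s4 M4 => M4 = M /\ s4 = set s3 vX (out_id (hst g z) u)));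
        [|apply Nat.le_refl|].
      { wstep; unfold mulN in *.
        - vsimp. intros E0. wstep. vsimp. split; auto. f_equal. unfold out_id.
          cbn [hcol hst hN]. fold cu. rewrite <- C3, E0. simpl. lia.
        - vsimp. intros E0. wstep. vsimp. split; auto. f_equal. unfold out_id.
          cbn [hcol hst hN]. fold cu. rewrite <- C3. apply Nat.eqb_neq in E0. rewrite E0. auto. }
      intros s4 M4 (-> & ->).
      wstep. eapply (wp_mono _ _ _ _ (fun s5 M5 => M5 = M /\
        s5 = set (set s3 vX (out_id (hst g z) u)) vT (in_id (hst g z) v)));
        [|apply Nat.le_refl|].
      { wstep; unfold mulN in *.
        - vsimp. intros E0. wstep. vsimp. split; auto. f_equal. unfold in_id.
          cbn [hcol hst hN]. fold cv. rewrite <- C4, E0. simpl. lia.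
        - vsimp. intros E0. wstep. vsimp. split; auto. f_equal. unfold in_id.
          cbn [hcol hst hN]. fold cv. rewrite <- C4. apply Nat.eqb_neq in E0. rewrite E0. auto. }
      intros s5 M5 (-> & ->).
      pose proof (out_id_cases (hst g z) u) as Ho.
      pose proof (in_id_cases (hst g z) v) as Hi. cbn [hN hst] in Ho, Hi.
      eapply (wp_emit_next g b z f p (4 * sN g + q));
        [exact Hsz|exact Hfit| |lia|exact HP|solve_safe|solve_safe|].
      * eapply (gen_frame _ _ _ _ _ s3 _ _ [vX; vT]); eauto.
        frame.
      * intros r M' HM'. apply HQ; auto.
        frame.
    + vsimp. rewrite C3, C4. intros E. apply Nat.eqb_neq in E. rewrite E in HP.
      eapply (wp_emit_next g b z f p (4 * sN g + q)); eauto; try lia.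
      * rewrite HP. unfold mulN. vsimp. rewrite N3, I3, HI. f_equal; lia.
      * unfold mulN. solve_safe.
      * unfold mulN. solve_safe.
      * intros r M' HM'. apply HQ; auto.
        frame.
  - cbn. lia.
Qed.

Definition reverse_cmd (o : orientation) : cmd :=
  match o with
  | Undirected => Seq (Asg vX (V vU)) (Seq (Asg vU (V vV)) (Asg vV (V vX)))
  | Directed => Asg vU (V vV)
  end.

Definition edges_cmd (o : orientation) (k : nat) : cmd :=
  For vI vm
    (Seq (Fetch vU (B Mul (C 2) (V vI)))
    (Seq (Fetch vV (B Add (B Mul (C 2) (V vI)) (C 1)))
    (Seq (slot_cmd k 0) (Seq (reverse_cmd o) (slot_cmd k 1))))).

Lemma edge_words_nth E i :
  nth (2 * i) (edge_words E) 0 = fst (nth i E (0, 0)) /\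
  nth (2 * i + 1) (edge_words E) 0 = snd (nth i E (0, 0)).
Proof.
  revert i; induction E as [|[u v] E IH]; intros i.
  - split; destruct i as [|i]; auto; simpl; destruct (i + S (i + 0)); auto.
  - destruct i as [|i]; [split; reflexivity|].
    replace (2 * S i) with (S (S (2 * i))) by lia. apply (IH i).
Qed.

Lemma arc_even h i : arc h (2 * i) = nth i (hE h) (0, 0).
Proof. unfold arc. rewrite half_even, even_double. destruct (nth i (hE h) (0, 0)); auto. Qed.

Lemma arc_odd h i :
  arc h (2 * i + 1) =
  (snd (nth i (hE h) (0, 0)),
   match ho h with
   | Undirected => fst (nth i (hE h) (0, 0))
   | Directed => snd (nth i (hE h) (0, 0))
   end).
Proof. unfold arc. rewrite half_odd, even_double_succ. destruct (nth i (hE h) (0, 0)); auto. Qed.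

Lemma wp_edges g b z f p s M (Q : env -> (nat -> nat) -> Prop) :
  setup_ok g -> fits g b z -> p <= 4 * sN g ->
  gen g b z f (host_part (hst g z) p (4 * sN g)) s M ->
  (forall s' M', gen g b z f (host_part (hst g z) p (5 * sN g)) s' M' -> Q s' M') ->
  wp (sw g) (edges_cmd (so g) (sk g))
    (length (sE g) * (sk g * 240 + 430 + 8) + 6) Q s M.
Proof.
  intros Hok Hfit Hp H0 HQ. pose proof (setup_sizes g Hok) as Hsz.
  pose proof Hfit as (F1 & F2 & F3). pose proof Hsz as Hsz'. destruct Hsz'.
  assert (HN : sN g = 2 * length (sE g)) by reflexivity.
  unfold edges_cmd. apply wp_for with (I := fun i s M =>
    gen g b z f (host_part (hst g z) p (4 * sN g + 2 * i)) s M /\ s vI = i)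
    (T := sk g * 240 + 430).
  - lia.
  - intros i s' M' Hi (Hgen & HI). split; auto. apply Hgen.
  - split; [|reflexivity]. apply gen_set_vI. rewrite Nat.mul_0_r, Nat.add_0_r. auto.
  - intros i s' M' Hi (Hgen & HI). pose proof Hgen as (Hl & _ & Hinp & _). unloc Hl.
    destruct (edge_words_nth (sE g) i) as [W1 W2].
    assert (M1 : M' (2 * s' vI) = fst (nth i (sE g) (0, 0))).
    { rewrite HI, <- W1. apply Hinp. lia. }
    assert (M2 : M' (2 * s' vI + 1) = snd (nth i (sE g) (0, 0))).
    { rewrite HI, <- W2. apply Hinp. lia. }
    pose proof (hst_wf g z Hok) as Hwf.
    assert (Harc : arc (hst g z) (2 * i) = (fst (nth i (sE g) (0, 0)), snd (nth i (sE g) (0, 0)))).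
    { rewrite arc_even. cbn [hE hst]. destruct (nth i (sE g) (0, 0)); auto. }
    destruct (arc_lt _ (2 * i) _ _ Hwf ltac:(cbn [hN hst]; lia) Harc) as [Bu Bv].
    cbn [hN hst] in Bu, Bv.
    assert (Harc' := arc_odd (hst g z) i). cbn [hE hst ho] in Harc'.
    set (u := fst (nth i (sE g) (0, 0))) in *. set (v := snd (nth i (sE g) (0, 0))) in *.
    eapply wp_le.
    + wstep. wstep. vsimp. wstep. wstep. vsimp. rewrite M1, M2. wstep.
      eapply (wp_slot g b z f p (2 * i) 0) with (u := u) (v := v); auto.
      { lia. }
      { vsimp. lia. }
      intros s1 M1' G1 A1.
      assert (U1 : s1 vU = u) by (rewrite A1 by not_in; reflexivity).
      assert (V1 : s1 vV = v) by (rewrite A1 by not_in; reflexivity).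
      assert (I1 : s1 vI = i) by (rewrite A1 by not_in; exact HI).
      clear A1. wstep.
      eapply (wp_mono _ _ 6 _ (fun s2 M2' => M2' = M1' /\ s2 vU = v /\
         s2 vV = match so g with Undirected => u | Directed => v end /\
         same_except [vX; vU; vV] s1 s2)); [|apply Nat.le_refl|].
      { unfold reverse_cmd. destruct (so g).
        - eapply wp_le; [wstep|cbn; lia]. vsimp. repeat split; auto. frame.
        - eapply wp_le; [wstep; wstep; wstep; wstep; wstep|cbn; lia].
          vsimp. repeat split; auto. frame. }
      intros s2 M2' (-> & U2 & V2 & A2).
      assert (I2 : s2 vI = i) by (rewrite A2 by not_in; exact I1).
      eapply (wp_slot g b z f p (2 * i + 1) 1); auto; try lia.
      { rewrite Nat.add_1_r, Nat.add_succ_r. eapply gen_frame; eauto. }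
      { rewrite U2, V2. auto. }
      intros s3 M3 G3 A3. split; [rewrite A3 by not_in; auto|].
      split; [|reflexivity]. apply gen_set_vI.
      replace (4 * sN g + 2 * S i) with (S (4 * sN g + (2 * i + 1))) by lia. auto.
    + cbn [esize]. lia.
  - intros s' M' (Hgen & _). apply HQ.
    replace (5 * sN g) with (4 * sN g + 2 * length (sE g)) by lia. auto.
Qed.

Definition build_cmd (md : mode) (o : orientation) (k : nat) : cmd :=
  Seq (Asg vBase (B Add (V vBase) (V vS))) (Seq (Asg vPtr (V vBase))
  (Seq (match md with Decremental => attach_cmd | Incremental => Skip end)
  (Seq paths_cmd (edges_cmd o k)))).

Lemma wp_build g md b z f s M (Q : env -> (nat -> nat) -> Prop) :
  setup_ok g -> fits g (b + sS g) z -> loc g b z f s -> input g M ->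
  (forall a, M (b + sS g + a) = 0) ->
  (forall s' M', gen g (b + sS g) z f
     (host_graph (hst g z) (first_edge md (sN g))) s' M' -> Q s' M') ->
  wp (sw g) (build_cmd md (so g) (sk g)) (sN g * (sk g * 240 + 700)) Q s M.
Proof.
  intros Hok Hfit Hl Hin Hz HQ. pose proof (setup_sizes g Hok) as Hsz.
  pose proof Hfit as (F1 & F2 & F3). pose proof Hsz as Hsz'. destruct Hsz'.
  unloc Hl.
  assert (HN : sN g = 2 * length (sE g)) by reflexivity.
  eapply wp_le.
  - unfold build_cmd. wstep. wstep. wstep. wstep. vsimp. rewrite Gb, GS.
    set (s1 := set (set s vBase (b + sS g)) vPtr (b + sS g)).
    assert (G1 : gen g (b + sS g) z f (host_part (hst g z) (first_edge md (sN g)) (first_edge md (sN g))) s1 M).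
    { unfold host_part. rewrite Nat.sub_diag. split; [|split; [|split; [exact Hin|]]].
      - unfold s1, loc, glob. vsimp. auto 10.
      - unfold s1. vsimp. simpl. lia.
      - intros a. rewrite Hz. unfold words. simpl. destruct a; unfold trunc; rewrite Nat.Div0.mod_0_l; auto. }
    wstep.
    eapply (wp_mono _ _ (sN g * (102 + 8) + 6) _ (fun s2 M2 =>
      gen g (b + sS g) z f (host_part (hst g z) (first_edge md (sN g)) (2 * sN g)) s2 M2));
      [|apply Nat.le_refl|].
    { destruct md; simpl first_edge in *.
      - eapply wp_le; [apply wp_skip; auto|lia].
      - eapply wp_attach; eauto. }
    assert (Hfe : first_edge md (sN g) <= 2 * sN g) by (destruct md; simpl; lia).
    intros s2 M2 G2. wstep. eapply wp_paths; eauto.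
    intros s3 M3 G3. eapply (wp_edges g _ z f (first_edge md (sN g))); [auto|eauto|lia|exact G3|exact HQ].
  - cbn [esize]. nia.
Qed.

(** * Calls of the dynamic algorithm and the phases of updates and queries *)

(** What holds between calls: the contents of the current region belong to the algorithm and are
    only known to be short words, while everything beyond it is still fresh. *)
Definition dmem (g : setup) (b : nat) (M : nat -> nat) : Prop :=
  input g M /\ (forall a, M (b + a) < 2 ^ swD g) /\
  (forall a, sS g <= a -> M (b + a) = 0).

(** A call preserves [dmem] because it writes nothing below the base and nothing from [sW g] on
    above it, and the region is at least that long. *)
Lemma wp_dcall g b z f P args s M T y (Q : env -> (nat -> nat) -> Prop) :
  setup_ok g -> fits g b z -> loc g b z f s -> dmem g b M ->
  Forall (safe (sw g) s) args ->
  exec (swD g) P (start (swD g) (map (ev s) args) (fun a => M (b + a))) T y ->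
  (forall M', dmem g b M' -> (fun a => M' (b + a)) = mem y -> reg y 0 < 2 ^ sw g ->
     Q (set s vR (reg y 0)) M') ->
  wp (sw g) (Call P args vR) (call_cost P args + 2 * T) Q s M.
Proof.
  intros Hok (F1 & F2 & F3) Hl (Hin & Hb & Hz) Hargs He HQ.
  pose proof (setup_sizes g Hok) as Hsz. destruct Hsz. unloc Hl.
  assert (Hw : swD g < sw g) by apply Hok. fold (sW g) in *.
  destruct (exec_bounded _ _ _ _ _ He) as [[Br Bm] Hhi].
  { apply start_bounded. auto. }
  assert (2 ^ swD g < 2 ^ sw g) by (apply Nat.pow_lt_mono_r; lia).
  eapply wp_call; eauto.
  - rewrite Gb. unfold sW in *. lia.
  - rewrite Gb. auto.
  - rewrite Gb. eauto.
  - rewrite Gb. intros M' HM' HE. apply HQ; auto.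
    + split; [|split].
      * intros a Ha. rewrite HM' by lia. auto.
      * intros a. change (M' (b + a)) with ((fun a => M' (b + a)) a). rewrite HE. auto.
      * intros a Ha. change (M' (b + a)) with ((fun a => M' (b + a)) a). rewrite HE.
        rewrite Hhi by (unfold sW in *; lia). simpl. auto.
    + specialize (Br 0). lia.
Qed.

Definition check_cmd (k : nat) (i : var) : cmd :=
  IfEq (V vR) (B Add (B Mul (C 2) (V i)) (C (k + 3))) (Asg vFound (C 1)) Skip.

Lemma wp_check g b z f i s M n (Q : env -> (nat -> nat) -> Prop) :
  setup_ok g -> fits g b z -> loc g b z f s -> s i = n -> n < sN g ->
  s vR < 2 ^ sw g ->
  is_answer (host_graph (hst g z) (2 * n)) (3 * sN g) (4 * sN g + 1) (s vR) ->
  (forall f' s', loc g b z f' s' -> same_except [vFound] s s' ->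
     (f' <> 0 <-> f <> 0 \/ colored_cycle (hst g z) n) -> Q s' M) ->
  wp (sw g) (check_cmd (sk g) i) 11 Q s M.
Proof.
  intros Hok (F1 & F2 & F3) Hl Hi Hn HR Hans HQ.
  pose proof (setup_sizes g Hok) as Hsz. destruct Hsz. unloc Hl.
  pose proof (answer_colored_cycle (hst g z) n (s vR) (hst_wf g z Hok) Hn Hans) as Hiff.
  cbn [hk hst] in Hiff.
  eapply wp_le.
  - unfold check_cmd. wstep.
    + vsimp. intros E. wstep. vsimp. apply (HQ 1).
      * unfold loc, glob. vsimp. auto 10.
      * frame.
      * split; [|lia]. intros _. right. apply Hiff. lia.
    + vsimp. intros E. wstep. apply (HQ f); auto.
      * frame.
      * split; [auto|]. intros [H|H]; auto. apply Hiff in H. lia.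
  - cbn. lia.
Qed.

Definition dec_body (D : dynamic_algorithm) (k : nat) : cmd :=
  Seq (Call (query_code D) [] vR)
  (Seq (check_cmd k vI)
  (Seq (Call (delete_code D) [sink_e vI; path_t_e vI] vR)
       (Call (delete_code D) [path_s_e vI; source_e vI] vR))).

(** Insertions run through the vertices downwards, so round [vI] attaches vertex [vN - vI - 1], its
    source (odd index) before its sink. *)
Definition inc_body (D : dynamic_algorithm) (k : nat) : cmd :=
  Seq (Asg vT (B Sub (V vN) (B Add (V vI) (C 1))))
  (Seq (Call (insert_code D) [path_s_e vT; source_e vT; C 1] vR)
  (Seq (Call (insert_code D) [sink_e vT; path_t_e vT; C 1] vR)
  (Seq (Call (query_code D) [] vR)
       (check_cmd k vT)))).

Definition phases_cmd (md : mode) (D : dynamic_algorithm) (k : nat) : cmd :=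
  For vI vN (match md with Decremental => dec_body D k | Incremental => inc_body D k end).

Definition phase_cost (D : dynamic_algorithm) : nat :=
  call_cost (query_code D) [] +
  call_cost (delete_code D) [sink_e vI; path_t_e vI] +
  call_cost (delete_code D) [path_s_e vI; source_e vI] +
  call_cost (insert_code D) [path_s_e vT; source_e vT; C 1] +
  call_cost (insert_code D) [sink_e vT; path_t_e vT; C 1] + 40.

Lemma loc_set g b z f s x v :
  loc g b z f s ->
  existsb (var_beq x) [vm; vN; vW; vS; vL; vD; vZ; vBase; vz; vFound] = false ->
  loc g b z f (set s x v).
Proof.
  intros Hl Hx. unloc Hl. unfold loc, glob.
  destruct x; try discriminate Hx; vsimp; auto 10.
Qed.

Lemma serves_query_inv w D s t E M ops T :
  serves w D s t E M (Query :: ops) T ->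
  exists T1 T2 y, T = T1 + T2 /\ exec w (query_code D) (start w [] M) T1 y /\
    is_answer E s t (reg y 0) /\ serves w D s t E (mem y) ops T2.
Proof. intros H. inversion H; subst. eauto 10. Qed.

Lemma serves_delete_inv w D s t E M u v ops T :
  serves w D s t E M (Delete u v :: ops) T ->
  exists T1 T2 y, T = T1 + T2 /\ exec w (delete_code D) (start w [u; v] M) T1 y /\
    serves w D s t (apply_op (Delete u v) E) (mem y) ops T2.
Proof. intros H. inversion H; subst. eauto 10. Qed.

Lemma serves_insert_inv w D s t E M u v x ops T :
  serves w D s t E M (Insert u v x :: ops) T ->
  exists T1 T2 y, T = T1 + T2 /\ exec w (insert_code D) (start w [u; v; x] M) T1 y /\
    serves w D s t (apply_op (Insert u v x) E) (mem y) ops T2.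
Proof. intros H. inversion H; subst. eauto 10. Qed.

(** The time of operations is bounded only in total, so rounds have no common budget and [wp_for]
    cannot be used; the induction carries the time [T] left for the remaining operations. *)
Lemma wp_dec_loop g b z D n : forall i f s M T (Q : env -> (nat -> nat) -> Prop),
  setup_ok g -> fits g b z -> i + n = sN g -> loc g b z f s -> dmem g b M -> s vI = i ->
  serves (swD g) D (3 * sN g) (4 * sN g + 1) (host_graph (hst g z) (2 * i))
    (fun a => M (b + a)) (dec_ops (hst g z) i n) T ->
  (forall f' s' M', loc g b z f' s' -> dmem g b M' ->
     (f' <> 0 <-> f <> 0 \/ exists j, i <= j < sN g /\ colored_cycle (hst g z) j) ->
     Q s' M') ->
  wp (sw g) (While (V vI) (V vN) (Seq (dec_body D (sk g)) (Asg vI (B Add (V vI) (C 1)))))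
    (n * phase_cost D + 2 * T + 4) Q s M.
Proof.
  induction n as [|n IH]; intros i f s M T Q Hok Hfit Hn Hl Hm Hi Hserv HQ;
    pose proof (setup_sizes g Hok) as Hsz; pose proof Hfit as (F1 & F2 & F3);
    destruct Hsz; pose proof Hl as Hl'; unloc Hl'.
  - apply wp_while_stop; vsimp; try lia.
    + apply (HQ f); auto. split; auto. intros [H|(j & Hj & _)]; auto; lia.
    + cbn. lia.
  - pose proof (hst_wf g z Hok) as Hwf.
    assert (Hlt : i < hN (hst g z)) by (cbn [hN hst]; lia).
    cbn [dec_ops] in Hserv.
    assert (E1 : apply_op (del (hst g z) (2 * i)) (host_graph (hst g z) (2 * i))
                 = host_graph (hst g z) (2 * i + 1)).
    { rewrite Nat.add_1_r. apply host_graph_delete; auto; lia. }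
    assert (E2 : apply_op (del (hst g z) (2 * i + 1)) (host_graph (hst g z) (2 * i + 1))
                 = host_graph (hst g z) (2 * S i)).
    { replace (2 * S i) with (S (2 * i + 1)) by lia. apply host_graph_delete; auto; lia. }
    unfold del in Hserv, E1, E2.
    rewrite host_pair_sink in Hserv, E1 by auto.
    rewrite host_pair_source in Hserv, E2 by auto.
    cbn [fst snd hN hst] in Hserv, E1, E2.
    apply serves_query_inv in Hserv as (T1 & T2 & y1 & -> & Hx1 & Hans & Hserv).
    apply serves_delete_inv in Hserv as (T3 & T4 & y2 & -> & Hx2 & Hserv).
    apply serves_delete_inv in Hserv as (T5 & T6 & y3 & -> & Hx3 & Hserv).
    rewrite E1, E2 in Hserv.
    eapply wp_while_step with (T2 := n * phase_cost D + 2 * T6 + 4); vsimp; try lia.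
    + unfold dec_body. wstep. wstep.
      eapply (wp_dcall g b z f); [auto|auto|exact Hl|auto|constructor|exact Hx1|].
      intros M1 Hm1 HE1 HR1. wstep.
      eapply (wp_check g b z f vI _ _ i);
        [auto|auto|apply loc_set; auto|exact Hi|lia|exact HR1|exact Hans|].
      intros f2 s2 Hl2 A2 Hf2. pose proof Hl2 as Hl2'. unloc Hl2'.
      assert (I2 : s2 vI = i) by (rewrite A2 by not_in; exact Hi).
      rewrite <- HE1 in Hx2. wstep.
      eapply (wp_dcall g b z f2); [auto|auto|exact Hl2|auto| | |].
      { repeat constructor; host_exprs; solve_safe. }
      { host_exprs. cbn [map ev ideal_op]. rewrite GN0, I2. exact Hx2. }
      intros M3 Hm3 HE3 _.
      assert (Hl3 : loc g b z f2 (set s2 vR (reg y2 0))) by (apply loc_set; auto).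
      rewrite <- HE3 in Hx3. 
      eapply (wp_dcall g b z f2); [auto|auto|exact Hl3|auto| | |].
      { repeat constructor; host_exprs; solve_safe. }
      { host_exprs. vsimp. cbn [map]. vsimp. rewrite GN0, I2, Nat.mul_1_l. exact Hx3. }
      intros M4 Hm4 HE4 _. wstep. vsimp. rewrite I2, Nat.add_1_r.
      eapply (IH (S i) f2);
        [auto|auto|lia|do 2 (apply loc_set; auto)|auto|reflexivity
        |rewrite HE4; exact Hserv|].
      * intros f' s' M' Hl4 Hm5 Hf'. apply (HQ f'); auto. rewrite Hf', Hf2. split.
        -- intros [[H|H]|(j & Hj & H)]; auto.
           ++ right. exists i. split; [lia|auto].
           ++ right. exists j. split; [lia|auto].
        -- intros [H|(j & Hj & H)]; auto.
           destruct (Nat.eq_dec j i) as [->|Hne]; auto.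
           right. exists j. split; [lia|auto].
    + unfold phase_cost. cbn [esize]. lia.
Qed.

Lemma wp_inc_loop g b z D n : forall f s M T (Q : env -> (nat -> nat) -> Prop),
  setup_ok g -> fits g b z -> s vI + n = sN g -> loc g b z f s -> dmem g b M ->
  serves (swD g) D (3 * sN g) (4 * sN g + 1) (host_graph (hst g z) (2 * n))
    (fun a => M (b + a)) (inc_ops (hst g z) n) T ->
  (forall f' s' M', loc g b z f' s' -> dmem g b M' ->
     (f' <> 0 <-> f <> 0 \/ exists j, j < n /\ colored_cycle (hst g z) j) ->
     Q s' M') ->
  wp (sw g) (While (V vI) (V vN) (Seq (inc_body D (sk g)) (Asg vI (B Add (V vI) (C 1)))))
    (n * phase_cost D + 2 * T + 4) Q s M.
Proof.
  induction n as [|n IH]; intros f s M T Q Hok Hfit Hn Hl Hm Hserv HQ;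
    pose proof (setup_sizes g Hok) as Hsz; pose proof Hfit as (F1 & F2 & F3);
    destruct Hsz; pose proof Hl as Hl'; unloc Hl'.
  - apply wp_while_stop; vsimp; try lia.
    + apply (HQ f); auto. split; auto. intros [H|(j & Hj & _)]; auto; lia.
    + cbn. lia.
  - pose proof (hst_wf g z Hok) as Hwf.
    assert (Hlt : n < hN (hst g z)) by (cbn [hN hst]; lia).
    cbn [inc_ops] in Hserv.
    assert (E1 : apply_op (ins (hst g z) (2 * n + 1)) (host_graph (hst g z) (2 * S n))
                 = host_graph (hst g z) (2 * n + 1)).
    { replace (2 * S n) with (S (2 * n + 1)) by lia. apply apply_ins; lia. }
    assert (E2 : apply_op (ins (hst g z) (2 * n)) (host_graph (hst g z) (2 * n + 1))
                 = host_graph (hst g z) (2 * n)).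
    { rewrite Nat.add_1_r. apply apply_ins; lia. }
    unfold ins in Hserv, E1, E2.
    rewrite host_pair_sink in Hserv, E2 by auto.
    rewrite host_pair_source in Hserv, E1 by auto.
    cbn [fst snd hN hst] in Hserv, E1, E2.
    apply serves_insert_inv in Hserv as (T1 & T2 & y1 & -> & Hx1 & Hserv).
    apply serves_insert_inv in Hserv as (T3 & T4 & y2 & -> & Hx2 & Hserv).
    apply serves_query_inv in Hserv as (T5 & T6 & y3 & -> & Hx3 & Hans & Hserv).
    rewrite E1, E2 in Hserv, Hans.
    eapply wp_while_step with (T2 := n * phase_cost D + 2 * T6 + 4); vsimp; try lia.
    + unfold inc_body. wstep. wstep. wstep. vsimp.
      replace (s vN - (s vI + 1)) with n by lia.
      set (s0 := set s vT n).
      assert (Hl0 : loc g b z f s0) by (apply loc_set; auto).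
      assert (T0 : s0 vT = n) by reflexivity.
      assert (N0 : s0 vN = sN g) by exact GN.
      assert (I0 : s0 vI = s vI) by reflexivity. clearbody s0.
      wstep. eapply (wp_dcall g b z f); [auto|auto|exact Hl0|auto| | |].
      { repeat constructor; host_exprs; solve_safe. }
      { host_exprs. cbn [map ev ideal_op]. rewrite N0, T0, Nat.mul_1_l. exact Hx1. }
      intros M1 Hm1 HE1 _.
      assert (Hl1 : loc g b z f (set s0 vR (reg y1 0))) by (apply loc_set; auto).
      rewrite <- HE1 in Hx2.
      wstep. eapply (wp_dcall g b z f); [auto|auto|exact Hl1|auto| | |].
      { repeat constructor; host_exprs; solve_safe. }
      { host_exprs. cbn [map]. vsimp. rewrite N0, T0. exact Hx2. }
      intros M2 Hm2 HE2 _.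
      assert (Hl2 : loc g b z f (set (set s0 vR (reg y1 0)) vR (reg y2 0)))
        by (apply loc_set; auto).
      rewrite <- HE2 in Hx3.
      wstep. eapply (wp_dcall g b z f); [auto|auto|exact Hl2|auto|constructor|exact Hx3|].
      intros M3 Hm3 HE3 HR3.
      eapply (wp_check g b z f vT _ _ n);
        [auto|auto|apply loc_set; auto|exact T0|lia|exact HR3|exact Hans|].
      intros f4 s4 Hl4 A4 Hf4. pose proof Hl4 as Hl4'. unloc Hl4'.
      assert (I4 : s4 vI = s vI) by (rewrite A4 by not_in; exact I0).
      wstep. vsimp.
      eapply (IH f4);
        [auto|auto|vsimp; lia|apply loc_set; auto|auto|rewrite HE3; exact Hserv|].
      * intros f' s' M' Hl5 Hm5 Hf'. apply (HQ f'); auto. rewrite Hf', Hf4. split.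
        -- intros [[H|H]|(j & Hj & H)]; auto.
           ++ right. exists n. split; [lia|auto].
           ++ right. exists j. split; [lia|auto].
        -- intros [H|(j & Hj & H)]; auto.
           destruct (Nat.eq_dec j n) as [->|Hne]; auto.
           right. exists j. split; [lia|auto].
    + unfold phase_cost. cbn [esize]. lia.
Qed.

Lemma wp_phases g b z f md D s M T (Q : env -> (nat -> nat) -> Prop) :
  setup_ok g -> fits g b z -> loc g b z f s -> dmem g b M ->
  serves (swD g) D (3 * sN g) (4 * sN g + 1)
    (host_graph (hst g z) (first_edge md (sN g)))
    (fun a => M (b + a)) (host_ops md (hst g z)) T ->
  (forall f' s' M', loc g b z f' s' -> dmem g b M' ->
     (f' <> 0 <-> f <> 0 \/ exists j, j < sN g /\ colored_cycle (hst g z) j) ->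
     Q s' M') ->
  wp (sw g) (phases_cmd md D (sk g)) (sN g * phase_cost D + 2 * T + 6) Q s M.
Proof.
  intros Hok Hfit Hl Hm Hserv HQ.
  pose proof (setup_sizes g Hok) as Hsz; pose proof Hfit as (F1 & F2 & F3); destruct Hsz.
  unfold phases_cmd, For.
  apply wp_le with (2 + (sN g * phase_cost D + 2 * T + 4)); [|lia].
  apply wp_seq. wstep. vsimp.
  assert (Hl0 : loc g b z f (set s vI 0)) by (apply loc_set; auto).
  destruct md; simpl first_edge in Hserv; unfold host_ops in Hserv; cbn [hN hst] in Hserv.
  - eapply (wp_inc_loop g b z D (sN g) f); eauto.
  - eapply (wp_dec_loop g b z D (sN g) 0 f); eauto.
    intros f' s' M' H1 H2 H3. apply (HQ f'); auto. rewrite H3.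
    split; (intros [H|(j & Hj & H)]; [auto|right; exists j; split; [lia|auto]]).
Qed.

Definition pre_args (md : mode) : list expr :=
  [B Add (mulN 6) (C 3); mulN 5; mulN 3; B Add (mulN 4) (C 1);
   match md with Decremental => mulN 5 | Incremental => mulN 3 end].

Definition body_cmd (md : mode) (D : dynamic_algorithm) (o : orientation) (k : nat)
    : cmd :=
  Seq (build_cmd md o k)
  (Seq (Call (preprocess D) (pre_args md) vR) (phases_cmd md D k)).

(** What the assumed algorithm provides for one colouring. [T] bounds preprocessing and all
    operations together, so amortised bounds suffice. *)
Definition solves (g : setup) (md : mode) (D : dynamic_algorithm) (z T : nat) : Prop :=
  let N := sN g in
  let E := host_graph (hst g z) (first_edge md N) in
  exists T1 T2 x,
    exec (swD g) (preprocess D)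
      (start (swD g) [6 * N + 3; 5 * N; 3 * N; 4 * N + 1; length E]
         (words (swD g) (wedge_words E))) T1 x /\
    serves (swD g) D (3 * N) (4 * N + 1) E (mem x) (host_ops md (hst g z)) T2 /\
    T1 + T2 <= T.

Definition body_cost (md : mode) (D : dynamic_algorithm) (k N T : nat) : nat :=
  N * (k * 240 + 700) + call_cost (preprocess D) (pre_args md) +
  N * phase_cost D + 2 * T + 6.

Lemma wp_body g md D b z f s M T (Q : env -> (nat -> nat) -> Prop) :
  setup_ok g -> fits g (b + sS g) z -> loc g b z f s -> input g M ->
  (forall a, M (b + sS g + a) = 0) -> solves g md D z T ->
  (forall f' s' M', loc g (b + sS g) z f' s' -> dmem g (b + sS g) M' ->
     (f' <> 0 <-> f <> 0 \/ exists j, j < sN g /\ colored_cycle (hst g z) j) ->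
     Q s' M') ->
  wp (sw g) (body_cmd md D (so g) (sk g)) (body_cost md D (sk g) (sN g) T) Q s M.
Proof.
  intros Hok Hfit Hl Hin Hz (T1 & T2 & x & Hpre & Hserv & HT) HQ.
  pose proof (setup_sizes g Hok) as Hsz; pose proof Hfit as (F1 & F2 & F3); destruct Hsz.
  eapply wp_le.
  - unfold body_cmd. wstep. eapply wp_build; eauto.
    intros s1 M1 (Hl1 & _ & Hin1 & Hm1). pose proof Hl1 as Hl1'. unloc Hl1'.
    rewrite host_graph_length in Hpre. cbn [hN hst] in Hpre.
    set (E := host_graph (hst g z) (first_edge md (sN g))) in *.
    assert (HM : (fun a => M1 (b + sS g + a)) = words (swD g) (wedge_words E))
      by (apply functional_extensionality; auto).
    assert (HE : length E <= 5 * sN g)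
      by (unfold E; rewrite host_graph_length; cbn [hN hst]; lia).
    wstep. eapply (wp_dcall g (b + sS g) z f); [auto|auto|exact Hl1| | | |].
    + split; [auto|]. split.
      * intros a. rewrite Hm1. apply trunc_lt.
      * intros a Ha. rewrite Hm1. unfold words.
        rewrite nth_overflow by (rewrite wedge_words_length; lia).
        unfold trunc. apply Nat.Div0.mod_0_l.
    + unfold pre_args, mulN. repeat constructor; try solve_safe.
      destruct md; solve_safe.
    + rewrite HM. unfold pre_args, mulN. cbn [map ev ideal_op].
      replace (ev s1 (match md with Decremental => B Mul (C 5) (V vN)
                                 | Incremental => B Mul (C 3) (V vN) end))
        with (5 * sN g - first_edge md (sN g)).
      * rewrite GN. exact Hpre.
      * destruct md; cbn [ev ideal_op first_edge]; lia.
    + intros M2 Hm2 HE2 _.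
      eapply (wp_phases g (b + sS g) z f md D _ _ T2);
        [auto|auto|apply loc_set; auto|auto|rewrite HE2; exact Hserv|exact HQ].
  - unfold body_cost. lia.
Qed.

(** * Initialisation and the loop over all colourings *)

(** Doubling [vX] finds the number [vL] of bits of the maximal edge count [5 N]. By [word_size] the
    algorithm has [c * vL] bits per word, so [vW] is the power [c] of [2 * vX]. *)
Definition init_cmd (c k : nat) : cmd :=
  Seq (Asg vFound (C 0)) (Seq (Asg vBase (C 0)) (Seq (Asg vN (B Add (V vm) (V vm)))
  (Seq (Asg vM (B Mul (C 5) (V vN))) (Seq (Asg vX (C 1)) (Seq (Asg vL (C 1))
  (Seq (While (B Add (V vX) (V vX)) (B Add (V vM) (C 1))
          (Seq (Asg vX (B Add (V vX) (V vX))) (Asg vL (B Add (V vL) (C 1)))))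
  (Seq (Asg vW (C 1)) (Seq (rep c (Asg vW (B Mul (V vW) (B Add (V vX) (V vX)))))
  (Seq (Asg vS (B Mul (V vW) (B Mul (C 15) (V vN))))
  (Seq (Asg vD (B Mul (B Mul (B Mul (V vL) (C 2)) (C k)) (C k)))
  (Seq (Asg vZ (C 1)) (rep k (Asg vZ (B Mul (V vZ) (V vD))))))))))))))).

Lemma wp_double_loop w n : forall r l s M (Q : env -> (nat -> nat) -> Prop),
  1 <= n -> 2 * n + 2 < 2 ^ w -> l + r = Nat.log2 n -> s vX = 2 ^ l -> s vL = S l ->
  s vM = n ->
  (forall s', same_except [vX; vL] s s' -> s' vX = 2 ^ Nat.log2 n ->
     s' vL = S (Nat.log2 n) -> Q s' M) ->
  wp w (While (B Add (V vX) (V vX)) (B Add (V vM) (C 1))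
          (Seq (Asg vX (B Add (V vX) (V vX))) (Asg vL (B Add (V vL) (C 1)))))
    (r * 16 + 8) Q s M.
Proof.
  induction r as [|r IH]; intros l s M Q Hn Hw Hl HX HL HM HQ;
    destruct (Nat.log2_spec n ltac:(lia)) as [Hlo Hhi];
    rewrite Nat.pow_succ_r' in Hhi.
  - replace l with (Nat.log2 n) in * by lia.
    apply wp_while_stop; vsimp; try lia; auto.
    apply HQ; auto. frame.
  - assert (Hp : 2 ^ S l <= n).
    { apply Nat.le_trans with (2 ^ Nat.log2 n); auto. apply Nat.pow_le_mono_r; lia. }
    assert (Hll : l < 2 ^ l) by (apply Nat.pow_gt_lin_r; lia).
    rewrite Nat.pow_succ_r' in Hp.
    eapply wp_while_step with (T2 := r * 16 + 8) (T1 := 8); vsimp; try lia.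
    + eapply wp_le; [|shelve]. wstep. wstep. wstep. vsimp.
      apply (IH (S l)); vsimp; auto.
      * lia.
      * rewrite Nat.pow_succ_r'. lia.
      * lia.
      * intros s' A E1 E2. apply HQ; auto.
        eapply same_except_trans; [|exact A]. frame.
      Unshelve. cbn. lia.
    + cbn. lia.
Qed.

Lemma wp_power_loop w x e n : forall r i s M (Q : env -> (nat -> nat) -> Prop) v,
  (forall s', same_except [x] s s' -> ev s' e = v /\ safe w s' e) -> 
  i + r = n -> s x = v ^ i -> 1 <= v -> v ^ n < 2 ^ w ->
  (forall s', same_except [x] s s' -> s' x = v ^ n -> Q s' M) ->
  wp w (rep r (Asg x (B Mul (V x) e))) (r * (esize e + 3)) Q s M.
Proof.
  induction r as [|r IH]; intros i s M Q v He Hi Hx Hv Hw HQ.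
  - apply wp_skip. apply HQ; [frame|]. rewrite Hx. f_equal; lia.
  - cbn [rep Nat.mul]. apply wp_seq.
    destruct (He s) as [Ev Sv]; [frame|].
    assert (Hle : forall j, j <= n -> v ^ j < 2 ^ w).
    { intros j Hj. apply Nat.le_lt_trans with (v ^ n); auto. apply Nat.pow_le_mono_r; lia. }
    assert (E : ev s (B Mul (V x) e) = v ^ S i).
    { cbn [ev ideal_op]. rewrite Ev, Hx, Nat.pow_succ_r'. lia. }
    eapply wp_le; [apply wp_asg|cbn; lia].
    + apply safe_mul; auto.
      * cbn. rewrite Hx. apply Hle; lia.
      * cbn [ev ideal_op] in E |- *. rewrite E. apply Hle; lia.
    + rewrite E. apply (IH (S i) _ _ _ v); auto.
      * intros s' A. apply He. eapply same_except_trans; [|exact A]. frame.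
      * lia.
      * unfold set. replace (var_beq x x) with true; auto.
        symmetry. apply internal_var_dec_lb; auto.
      * intros s' A Hs'. apply HQ; auto. eapply same_except_trans; [|exact A]. frame.
Qed.

Lemma wp_init g c s M (Q : env -> (nat -> nat) -> Prop) :
  setup_ok g -> sL g = Nat.log2 (5 * sN g) + 1 -> swD g = c * sL g ->
  s vm = length (sE g) ->
  (forall s', glob g s' -> s' vBase = 0 -> s' vFound = 0 -> Q s' M) ->
  wp (sw g) (init_cmd c (sk g)) (100 + 80 * sN g + c * 6 + sk g * 4) Q s M.
Proof.
  intros Hok HL HwD Hm HQ.
  pose proof (setup_sizes g Hok) as Hsz; destruct Hsz.
  assert (HN : sN g = 2 * length (sE g)) by reflexivity.
  assert (Hlog : Nat.log2 (5 * sN g) <= 5 * sN g) by apply Nat.log2_le_lin, Nat.le_0_l.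
  assert (HWp : sW g = (2 ^ sL g) ^ c).
  { unfold sW. rewrite HwD, Nat.mul_comm, Nat.pow_mul_r. reflexivity. }
  eapply wp_le.
  - unfold init_cmd.
    wstep. wstep. wstep. wstep. wstep. wstep. wstep. wstep. wstep. wstep. wstep. wstep. vsimp.
    set (s1 := set _ vL 1).
    assert (N1 : s1 vN = sN g) by (unfold s1; vsimp; lia).
    assert (M1 : s1 vM = 5 * sN g) by (unfold s1; vsimp; lia).
    assert (m1 : s1 vm = length (sE g)) by (unfold s1; vsimp; lia).
    assert (F1 : s1 vFound = 0) by reflexivity.
    assert (B1 : s1 vBase = 0) by reflexivity.
    assert (X1 : s1 vX = 2 ^ 0) by reflexivity.
    assert (L1 : s1 vL = 1) by reflexivity. clearbody s1.
    wstep. apply (wp_double_loop (sw g) (5 * sN g) (Nat.log2 (5 * sN g)) 0); auto; try lia.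
    intros s2 A2 X2 L2.
    assert (N2 : s2 vN = sN g) by (rewrite A2 by not_in; auto).
    assert (m2 : s2 vm = length (sE g)) by (rewrite A2 by not_in; auto).
    assert (F2 : s2 vFound = 0) by (rewrite A2 by not_in; auto).
    assert (B2 : s2 vBase = 0) by (rewrite A2 by not_in; auto).
    assert (Xpow : s2 vX + s2 vX = 2 ^ sL g).
    { rewrite X2, HL, Nat.add_1_r, Nat.pow_succ_r'. lia. }
    assert (XN : s2 vX <= 5 * sN g).
    { rewrite X2. apply Nat.log2_spec. lia. }
    replace (S (Nat.log2 (5 * sN g))) with (sL g) in L2 by lia.
    clear A2 X2. wstep. wstep. vsimp.
    wstep. apply (wp_power_loop (sw g) vW _ c c 0 _ _ _ (2 ^ sL g)).
    + intros s' A. assert (X' : s' vX = s2 vX) by (rewrite A by not_in; reflexivity).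
      split; [vsimp; lia|]. apply safe_add; vsimp; lia.
    + lia.
    + reflexivity.
    + apply Nat.neq_0_lt_0, Nat.pow_nonzero; lia.
    + rewrite <- HWp. lia.
    + intros s3 A3 W3. rewrite <- HWp in W3.
      assert (N3 : s3 vN = sN g) by (rewrite A3 by not_in; auto).
      assert (m3 : s3 vm = length (sE g)) by (rewrite A3 by not_in; auto).
      assert (F3 : s3 vFound = 0) by (rewrite A3 by not_in; auto).
      assert (B3 : s3 vBase = 0) by (rewrite A3 by not_in; auto).
      assert (L3 : s3 vL = sL g) by (rewrite A3 by not_in; auto).
      assert (HS3 : s3 vW * (15 * s3 vN) = sS g) by (rewrite W3, N3; reflexivity).
      assert (HD3 : s3 vL * 2 * sk g * sk g = sD g) by (rewrite L3; reflexivity).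
      assert (s3 vL * 2 * sk g <= sD g) by (rewrite <- HD3; nia).
      assert (s3 vL * 2 <= sD g) by nia.
      wstep. wstep. wstep. wstep. wstep. wstep. vsimp. rewrite HS3, HD3.
      apply (wp_power_loop (sw g) vZ (V vD) (sk g) (sk g) 0 _ _ _ (sD g)).
      * intros s' A.
        assert (E : s' vD = sD g) by (rewrite A by not_in; reflexivity).
        vsimp. lia.
      * lia.
      * reflexivity.
      * lia.
      * fold (sZ g). lia.
      * intros s4 A4 Z4. apply HQ.
        -- unfold glob. rewrite Z4. rewrite !A4 by not_in. vsimp. auto 10.
        -- rewrite A4 by not_in. auto.
        -- rewrite A4 by not_in. auto.
  - cbn [esize]. lia.
Qed.

Definition main_cmd (md : mode) (D : dynamic_algorithm) (o : orientation) (c k : nat)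
    : cmd :=
  Seq (init_cmd c k) (For vz vZ (body_cmd md D o k)).

Definition main_cost (md : mode) (D : dynamic_algorithm) (c k N Z T : nat) : nat :=
  100 + 80 * N + c * 6 + k * 4 + (Z * (body_cost md D k N T + 8) + 6).

Lemma wp_main g md D c T s M (Q : env -> (nat -> nat) -> Prop) :
  setup_ok g -> sL g = Nat.log2 (5 * sN g) + 1 -> swD g = c * sL g ->
  s vm = length (sE g) -> input g M -> (forall a, M (sS g + a) = 0) ->
  (forall z, z < sZ g -> solves g md D z T) ->
  (forall s' M',
     (s' vFound <> 0 <->
      exists z j, z < sZ g /\ j < sN g /\ colored_cycle (hst g z) j) -> Q s' M') ->
  wp (sw g) (main_cmd md D (so g) c (sk g)) (main_cost md D c (sk g) (sN g) (sZ g) T) Q s M.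
Proof.
  intros Hok HL HwD Hm Hin Hz Hsolve HQ.
  pose proof (setup_sizes g Hok) as Hsz; destruct Hsz.
  unfold main_cmd, main_cost. apply wp_seq. eapply wp_init; eauto.
  intros s1 G1 B1 F1.
  (* The body first advances [vBase], so colouring [z] works at [(z + 1) * sS g], above the input in
     region 0; from there on memory is still zero. *)
  apply wp_for with (I := fun z s M => loc g (z * sS g) z (s vFound) s /\ input g M /\
     (forall a, M (z * sS g + sS g + a) = 0) /\
     (s vFound <> 0 <->
      exists z' j, z' < z /\ j < sN g /\ colored_cycle (hst g z') j)).
  - lia.
  - intros z s' M' Hle (Hl & _). unloc Hl. auto.
  - split; [|split; [auto|split; [auto|]]].
    + unfold loc, glob in *. vsimp. auto 12.
    + vsimp. rewrite F1. split; [lia|]. intros (z' & j & Hlt & _); lia.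
  - intros z s' M' Hlt (Hl & Hin' & Hz' & Hf).
    assert (Hfit : fits g (z * sS g + sS g) z).
    { assert ((z + 1) * sS g <= sZ g * sS g) by (apply Nat.mul_le_mono_r; lia).
      split; [auto|]. split; nia. }
    eapply wp_body; eauto.
    intros f' s2 M2 Hl2 (Hin2 & _ & Hz2) Hf2. pose proof Hl2 as Hl2'. unloc Hl2'.
    split; [auto|]. split; [|split; [auto|split]].
    + unfold loc, glob. vsimp. rewrite Gb. repeat split; auto. lia.
    + intros a. replace (S z * sS g + sS g + a) with (z * sS g + sS g + (sS g + a)) by lia.
      apply Hz2. lia.
    + vsimp. rewrite Gf, Hf2, Hf. split.
      * intros [(z' & j & H1 & H2 & H3)|(j & H2 & H3)].
        -- exists z', j. auto.
        -- exists z, j. auto.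
      * intros (z' & j & H1 & H2 & H3).
        destruct (Nat.eq_dec z' z) as [->|Hne]; [right; eauto|].
        left. exists z', j. split; [lia|auto].
  - intros s' M' (_ & _ & _ & Hf). auto.
Qed.

Lemma edge_words_length E : length (edge_words E) = 2 * length E.
Proof. induction E as [|[u v] E IH]; simpl; auto. simpl in IH. rewrite IH. lia. Qed.

Lemma main_exec g md D c T n :
  setup_ok g -> sL g = Nat.log2 (5 * sN g) + 1 -> swD g = c * sL g ->
  (forall z, z < sZ g -> solves g md D z T) ->
  exists T' x,
    exec (sw g) (comp (main_cmd md D (so g) c (sk g)) 0)
      (start (sw g) [n; length (sE g)] (words (sw g) (edge_words (sE g)))) T' x /\
    T' <= main_cost md D c (sk g) (sN g) (sZ g) T /\
    (reg x 0 <> 0 <->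
     exists z j, z < sZ g /\ j < sN g /\ colored_cycle (hst g z) j).
Proof.
  intros Hok HL HwD Hsolve.
  pose proof (setup_sizes g Hok) as Hsz; destruct Hsz.
  assert (HN : sN g = 2 * length (sE g)) by reflexivity.
  set (x0 := start (sw g) [n; length (sE g)] (words (sw g) (edge_words (sE g)))).
  set (P := comp (main_cmd md D (so g) c (sk g)) 0).
  assert (Hwp := wp_main g md D c T (fun v => reg x0 (idx v)) (mem x0)
    (fun s' _ => s' vFound <> 0 <->
      exists z j, z < sZ g /\ j < sN g /\ colored_cycle (hst g z) j)).
  destruct (Hwp Hok HL HwD) with (P := P) (b := 0) (x := x0)
    as (T' & y & s' & HT & Hst & Hpc & Ha & Hres); auto.
  - simpl. apply trunc_small. lia.
  - intros a Hlt. apply trunc_small.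
    destruct Hok as (_ & _ & _ & _ & _ & (_ & HE & _) & _).
    assert (Hv : forall i, i < length (sE g) ->
      fst (nth i (sE g) (0, 0)) < sN g /\ snd (nth i (sE g) (0, 0)) < sN g).
    { intros i Hi. apply (nth_In _ (0, 0)) in Hi.
      destruct (nth i (sE g) (0, 0)) as [u v]. apply HE in Hi. simpl; lia. }
    destruct (parity_cases a) as [i [->| ->]]; destruct (edge_words_nth (sE g) i) as [W1 W2];
      rewrite ?W1, ?W2; specialize (Hv i ltac:(lia)); lia.
  - intros a. simpl. unfold words. rewrite nth_overflow by (rewrite edge_words_length; lia).
    apply Nat.Div0.mod_0_l.
  - intros i a Hi. exact Hi.
  - intros v. reflexivity.
  - exists T', y. split; [|split; [auto|]].
    + eapply steps_exec; eauto. unfold step.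
      (* The program halts by leaving its text. *)
      assert (Hend : nth_error P (pc y) = None).
      { apply nth_error_None. unfold P. rewrite comp_length, Hpc. apply Nat.le_refl. }
      rewrite Hend. reflexivity.
    + rewrite <- Hres, <- (Ha vFound). reflexivity.
Qed.

(** * Word size and running time *)

Lemma log2_ten m : 1 <= m -> Nat.log2 (10 * m) + 1 <= Nat.log2 m + 5.
Proof.
  intros Hm. assert (Nat.log2 (10 * m) <= Nat.log2 (m * 2 ^ 4)).
  { apply Nat.log2_le_mono. simpl. lia. }
  rewrite Nat.log2_mul_pow2 in H; lia.
Qed.

(** Bits counted in units of [log2 m + 1]: [(5 + 2 * k) * k] for the number of colourings, [5 * c]
    for the simulated address range, and the remainder for the factor [30 m], the small summands and
    constants. *)
Definition word_factor (c k : nat) : nat := 20 + (5 + 2 * k) * k + 5 * c + k.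

Lemma room_bound c k m :
  1 <= m -> 3 <= k ->
  let L := Nat.log2 (10 * m) + 1 in
  let w := word_size (word_factor c k) m in
  (color_base L k ^ k + 2) * (2 ^ (c * L) * (15 * (2 * m))) + 20 * (2 * m) + k + 10
    <= 2 ^ w /\ c * L < w.
Proof.
  intros Hm Hk L w. set (l := Nat.log2 m + 1).
  assert (Hl : 1 <= l) by (unfold l; lia).
  assert (HL : L <= 5 * l) by (pose proof (log2_ten m Hm); unfold L, l; lia).
  assert (HL1 : 1 <= L) by (unfold L; lia).
  assert (Hw : w = word_factor c k * l) by reflexivity.
  set (X := 18 + (5 + 2 * k) * k + 5 * c + k).
  assert (HX : word_factor c k = X + 2) by (unfold word_factor, X; lia).
  assert (Hpow : forall a b, a <= b * l -> 2 ^ a <= 2 ^ (b * l))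
    by (intros; apply Nat.pow_le_mono_r; lia).
  assert (Hmul : forall x y a b, x <= 2 ^ (a * l) -> y <= 2 ^ (b * l) ->
            x * y <= 2 ^ ((a + b) * l)).
  { intros x y a b Hx Hy. rewrite Nat.mul_add_distr_r, Nat.pow_add_r.
    apply Nat.mul_le_mono; auto. }
  assert (Hup : forall x a b, a <= b -> x <= 2 ^ (a * l) -> x <= 2 ^ (b * l)).
  { intros x a b Hab Hx. apply Nat.le_trans with (1 := Hx).
    apply Nat.pow_le_mono_r; nia. }
  assert (Bm : m <= 2 ^ (1 * l)).
  { destruct (Nat.log2_spec m ltac:(lia)) as [_ H]. unfold l.
    rewrite Nat.mul_1_l, Nat.add_1_r. lia. }
  assert (Bc : forall a b, a <= 2 ^ b -> a <= 2 ^ (b * l)).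
  { intros a b H. apply Nat.le_trans with (1 := H). apply Nat.pow_le_mono_r; nia. }
  assert (Bk : k <= 2 ^ (k * l)).
  { apply Bc. apply Nat.lt_le_incl, Nat.pow_gt_lin_r. lia. }
  assert (Bl : l <= 2 ^ (1 * l)).
  { rewrite Nat.mul_1_l. apply Nat.lt_le_incl, Nat.pow_gt_lin_r. lia. }
  assert (BL : L <= 2 ^ ((3 + 1) * l)).
  { apply Nat.le_trans with (1 := HL). apply Hmul; auto. apply Bc. simpl; lia. }
  assert (B2 : 2 <= 2 ^ (1 * l)) by (apply Bc; simpl; lia).
  assert (BD : color_base L k <= 2 ^ ((3 + 1 + 1 + k + k) * l)) by (unfold color_base; auto).
  assert (BZ : color_base L k ^ k <= 2 ^ (((5 + 2 * k) * k) * l)).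
  { replace ((5 + 2 * k) * k * l) with ((3 + 1 + 1 + k + k) * l * k) by lia.
    rewrite Nat.pow_mul_r. apply Nat.pow_le_mono_l. auto. }
  assert (HZ1 : 1 <= color_base L k ^ k).
  { apply Nat.neq_0_lt_0, Nat.pow_nonzero. unfold color_base. nia. }
  assert (BW : 2 ^ (c * L) <= 2 ^ ((5 * c) * l)).
  { apply Hpow. nia. }
  assert (BS : 2 ^ (c * L) * (15 * (2 * m)) <= 2 ^ ((5 * c + (4 + (1 + 1))) * l)).
  { apply Hmul; auto. apply Hmul; auto. apply Bc. simpl; lia. }
  assert (B1 : (color_base L k ^ k + 2) * (2 ^ (c * L) * (15 * (2 * m)))
               <= 2 ^ ((2 + (5 + 2 * k) * k + (5 * c + (4 + (1 + 1)))) * l)).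
  { apply Hmul; auto.
    (* Adding 2 to a positive number at most triples it, so two more bits are enough. *)
    apply Nat.le_trans with (2 ^ 2 * color_base L k ^ k); [simpl (2 ^ 2); lia|].
    apply Hmul; auto. }
  apply Hup with (b := X) in B1; [|unfold X; lia].
  assert (B3 : 20 * (2 * m) <= 2 ^ ((5 + (1 + 1)) * l)).
  { apply Hmul; auto. apply Bc. simpl; lia. }
  apply Hup with (b := X) in B3; [|unfold X; lia].
  assert (B4 : k + 10 <= 2 ^ ((4 + k) * l)).
  { apply Nat.le_trans with (2 ^ 4 * k); [simpl (2 ^ 4); lia|]. apply Hmul; auto. }
  apply Hup with (b := X) in B4; [|unfold X; lia].
  rewrite Hw, HX. split.
  (* Three quantities, each at most [2 ^ (X * l)]; the two units beyond [X] pay for their sum. *)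
  - apply Nat.le_trans with (2 ^ 2 * 2 ^ (X * l)); [simpl (2 ^ 2); lia|].
    rewrite <- Nat.pow_add_r. apply Nat.pow_le_mono_r; nia.
  - unfold X. nia.
Qed.

(** * Asymptotic estimates over the reals *)

Local Open Scope R_scope.

(** Combines [log2 m * ln 2 <= ln m] with the inequality [y <= exp y] at [y = delta * ln m]. *)
Lemma log2_Rpower delta (m : nat) :
  0 < delta -> (1 <= m)%nat ->
  INR (Nat.log2 m) <= / (delta * ln 2) * Rpower (INR m) delta.
Proof.
  intros Hd Hm.
  assert (Hln2 : 0 < ln 2) by (rewrite <- ln_1; apply ln_increasing; lra).
  assert (HmR : 1 <= INR m) by (apply (le_INR 1); auto).
  assert (H1 : INR (Nat.log2 m) * ln 2 <= ln (INR m)).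
  { rewrite <- ln_pow by lra.
    assert (Hp : 2 ^ Nat.log2 m <= INR m).
    { replace 2 with (INR 2) by (simpl; lra). rewrite <- pow_INR. apply le_INR.
      apply Nat.log2_spec. lia. }
    destruct Hp as [Hp|Hp]; [|rewrite Hp; lra].
    left. apply ln_increasing; auto. apply pow_lt; lra. }
  assert (H2 : delta * ln (INR m) <= Rpower (INR m) delta).
  { unfold Rpower. pose proof (exp_ineq1_le (delta * ln (INR m))). lra. }
  assert (H3 : 0 < delta * ln 2) by (apply Rmult_lt_0_compat; auto).
  apply (Rmult_le_reg_l (delta * ln 2)); auto.
  rewrite <- Rmult_assoc, Rinv_r, Rmult_1_l by lra. nra.
Qed.

Lemma Rpower_ge_1 x a : 1 <= x -> 0 <= a -> 1 <= Rpower x a.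
Proof.
  intros Hx Ha. rewrite <- (Rpower_O x) by lra. apply Rle_Rpower; auto.
Qed.

(** The base is linear in [log2 m], so it is bounded by a constant times [m ^ (delta / k)]; the
    power [k] restores [delta]. *)
Lemma color_count_bound k delta :
  (1 <= k)%nat -> 0 < delta ->
  exists K, 0 <= K /\ forall m, (1 <= m)%nat ->
    INR (color_base (Nat.log2 (10 * m) + 1) k ^ k) <= K * Rpower (INR m) delta.
Proof.
  intros Hk Hd. set (d := delta / INR k).
  assert (HkR : 1 <= INR k) by (apply (le_INR 1); auto).
  assert (Hd' : 0 < d) by (apply Rdiv_lt_0_compat; lra).
  assert (Hln2 : 0 < ln 2) by (rewrite <- ln_1; apply ln_increasing; lra).
  set (A := / (d * ln 2) + 5).
  assert (HA : 0 <= A).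
  { unfold A. assert (0 < / (d * ln 2)) by (apply Rinv_0_lt_compat, Rmult_lt_0_compat; auto). lra. }
  set (F := A * INR (2 * k * k)).
  assert (HF : 0 <= F) by (apply Rmult_le_pos; auto; apply pos_INR).
  exists (F ^ k). split; [apply pow_le; auto|].
  intros m Hm.
  assert (HmR : 1 <= INR m) by (apply (le_INR 1); auto).
  assert (HL : INR (Nat.log2 (10 * m) + 1) <= A * Rpower (INR m) d).
  { pose proof (log2_ten m Hm) as H. apply le_INR in H.
    rewrite (plus_INR (Nat.log2 m)) in H.
    pose proof (log2_Rpower d m Hd' Hm).
    pose proof (Rpower_ge_1 (INR m) d HmR ltac:(lra)).
    replace (INR 5) with 5 in H by (simpl; lra). unfold A. lra. }
  replace (color_base (Nat.log2 (10 * m) + 1) k)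
    with ((Nat.log2 (10 * m) + 1) * (2 * k * k))%nat by (unfold color_base; lia).
  rewrite pow_INR, mult_INR.
  apply Rle_trans with ((F * Rpower (INR m) d) ^ k).
  - apply pow_incr. split.
    + apply Rmult_le_pos; apply pos_INR.
    + unfold F. pose proof (pos_INR (2 * k * k)). nra.
  - rewrite Rpow_mult_distr. apply Rmult_le_compat_l; [apply pow_le; auto|].
    rewrite <- Rpower_pow by apply exp_pos. rewrite Rpower_mult.
    replace (d * INR k) with delta by (unfold d; field; lra). lra.
Qed.

Lemma main_cost_bound md D c k :
  exists B : nat, forall m Z T, (1 <= m)%nat -> (1 <= Z)%nat ->
    (main_cost md D c k (2 * m) Z T <= B * (Z * (m + T + 1)))%nat.
Proof.
  set (p := call_cost (preprocess D) (pre_args md)). set (q := phase_cost D).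
  exists (2 * (k * 240 + 700) + p + 2 * q + 16 + (106 + 160 + c * 6 + k * 4))%nat.
  intros m Z T Hm HZ. unfold main_cost, body_cost. fold p q.
  generalize (k * 240 + 700)%nat; intros r.
  set (A := (m + T + 1)%nat).
  assert (H1 : (2 * m * r + p + 2 * m * q + 2 * T + 6 + 8 <= (2 * r + p + 2 * q + 16) * A)%nat)
    by (unfold A; nia).
  assert (H2 : (100 + 80 * (2 * m) + c * 6 + k * 4 + 6 <= (106 + 160 + c * 6 + k * 4) * A)%nat)
    by (unfold A; nia).
  apply (Nat.mul_le_mono_l _ _ Z) in H1.
  assert (H3 : (A <= Z * A)%nat) by nia.
  apply (Nat.mul_le_mono_l _ _ (106 + 160 + c * 6 + k * 4)) in H3.
  nia.
Qed.

(** The program logic wants a natural number as time bound, whereas the hypothesis gives a real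
    one. *)
Lemma nat_ceil x : exists n : nat, INR n <= Rmax 0 x + 1 /\ forall a, INR a <= x -> (a <= n)%nat.
Proof.
  assert (Hx : 0 <= Rmax 0 x) by apply Rmax_l.
  destruct (archimed (Rmax 0 x)) as [H1 H2].
  assert (Hup : (0 <= up (Rmax 0 x))%Z) by (apply le_IZR; simpl; lra).
  exists (Z.to_nat (up (Rmax 0 x))). rewrite INR_IZR_INZ, Z2Nat.id by auto.
  split; [lra|]. intros a Ha.
  apply INR_le. rewrite (INR_IZR_INZ (Z.to_nat _)), Z2Nat.id by auto.
  pose proof (Rmax_r 0 x). lra.
Qed.

(** * The choice of constants and the final time bound *)

Theorem theorem2 (o : orientation) (md : mode) (d : nat) :
  k_cycle_hypothesis o ->
  ~ exists eps : R, (0 < eps)%R /\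
      dynamic_st_shortest_path_in_time md d
        (fun m => Rpower (INR m) (2 - eps))
        (fun m => Rpower (INR m) (1 - eps)).
Proof.
  intros Hyp (eps & Heps & D & c & K & Halg).
  (* Capping at 1 keeps the exponent [2 - e] at least 1, so that the linear cost of writing the
     graphs is absorbed. *)
  set (e := Rmin eps 1).
  assert (He0 : 0 < e) by (apply Rmin_glb_lt; lra).
  assert (He1 : e <= 1) by apply Rmin_r.
  assert (Hee : e <= eps) by apply Rmin_l.
  destruct (Hyp (e / 2)) as (k & Hk & Hno); [lra|]. apply Hno. clear Hno Hyp.
  destruct (color_count_bound k (e / 2)) as (KZ & HKZ & HZ); [lia|lra|].
  destruct (main_cost_bound md D c k) as (B & HB).
  (* The factor 2 is for preprocessing and operations, the power of 10 for the [10 m] edges of the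
     host graph; [K] has no assumed sign. *)
  set (KT := 2 * Rabs K * Rpower 10 (2 - e)).
  assert (HKT : 0 <= KT).
  { unfold KT. pose proof (Rabs_pos K).
    assert (0 < Rpower 10 (2 - e)) by apply exp_pos. nra. }
  (* The 3 comes from [m + T + 1]: one for [m], one for rounding [T] up, and one for the final
     summand. *)
  exists (comp (main_cmd md D o c k) 0), (word_factor c k), (INR B * (KZ * (KT + 3))).
  intros n E m w Hg Hm Hn.
  set (g := Setup k o E (Nat.log2 (10 * m) + 1) w (c * (Nat.log2 (10 * m) + 1))).
  assert (HN : sN g = (2 * m)%nat) by reflexivity.
  assert (H5N : (5 * sN g = 10 * m)%nat) by lia.
  destruct (room_bound c k m Hm Hk) as [Hroom HwD].
  assert (HmR : 1 <= INR m) by (apply (le_INR 1); auto).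
  assert (Hlog : (10 * m < 2 ^ (Nat.log2 (10 * m) + 1))%nat).
  { rewrite Nat.add_1_r. apply Nat.log2_spec. lia. }
  assert (Hok : setup_ok g).
  { destruct Hg as (G1 & G2 & G3).
    split; [exact Hm|]. split; [exact Hk|]. split; [simpl; lia|].
    split; [exact HwD|]. split; [exact Hroom|]. split.
    - split; [exact G1|]. split; [|exact G3].
      intros u v H. apply G2 in H. rewrite HN. lia.
    - rewrite HN. cbn [sL g]. lia. }
  set (bd := 2 * Rabs K * Rpower (INR (10 * m)) (2 - e)).
  destruct (nat_ceil bd) as (T & HT1 & HT2).
  assert (Hsolve : forall z, (z < sZ g)%nat -> solves g md D z T).
  { intros z _.
    destruct (host_ops_valid md (hst g z) ((10 * m) ^ d)) as [Hv Hme].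
    { apply hst_wf; auto. }
    { apply Nat.neq_0_lt_0, Nat.pow_nonzero. lia. }
    cbn [hN hst] in Hv, Hme. rewrite H5N in Hme.
    specialize (Halg (6 * sN g + 3)%nat (3 * sN g)%nat (4 * sN g + 1)%nat
      (host_graph (hst g z) (first_edge md (sN g))) (host_ops md (hst g z))).
    cbv zeta in Halg. rewrite Hme in Halg.
    destruct Halg as (Tpre & Tops & x & Hx & Hpre & Hserv & Hops); auto; try lia.
    exists Tpre, Tops, x. rewrite H5N. split; [exact Hx|]. split; [exact Hserv|].
    apply HT2. rewrite plus_INR. unfold bd.
    rewrite host_ops_length in Hops. cbn [hN hst] in Hops.
    set (y := INR (10 * m)) in *.
    assert (Hy : 1 <= y) by (apply (le_INR 1); lia).
    assert (P1 : Rpower y (2 - eps) <= Rpower y (2 - e)) by (apply Rle_Rpower; lra).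
    (* There are [3 N = 6 m] operations, at most [y = 10 m], so their total amortised time is of the
       order of the preprocessing bound. *)
    assert (P2 : INR (3 * sN g) * Rpower y (1 - eps) <= Rpower y (2 - e)).
    { apply Rle_trans with (y * Rpower y (1 - eps)).
      - apply Rmult_le_compat_r; [left; apply exp_pos|]. apply le_INR. lia.
      - rewrite <- (Rpower_1 y) at 1 by lra. rewrite <- Rpower_plus.
        apply Rle_Rpower; lra. }
    pose proof (Rle_abs K). pose proof (Rabs_pos K).
    assert (Q0 : 0 < Rpower y (2 - eps)) by apply exp_pos.
    assert (Q1 : 0 <= INR (3 * sN g) * Rpower y (1 - eps)).
    { apply Rmult_le_pos; [apply pos_INR|left; apply exp_pos]. }
    assert (K * Rpower y (2 - eps) <= Rabs K * Rpower y (2 - e)).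
    { apply Rle_trans with (Rabs K * Rpower y (2 - eps)).
      - apply Rmult_le_compat_r; lra.
      - apply Rmult_le_compat_l; lra. }
    assert (K * (INR (3 * sN g) * Rpower y (1 - eps)) <= Rabs K * Rpower y (2 - e)).
    { apply Rle_trans with (Rabs K * (INR (3 * sN g) * Rpower y (1 - eps))).
      - apply Rmult_le_compat_r; lra.
      - apply Rmult_le_compat_l; lra. }
    lra. }
  destruct (main_exec g md D c T n Hok) as (T' & x & Hx & HT' & Hres);
    [rewrite H5N; reflexivity|reflexivity|auto|].
  exists T', x. split; [exact Hx|]. split.
  - rewrite Hres. symmetry.
    apply (has_cycle_iff_colored o k E (Nat.log2 (10 * m) + 1) n); auto; try lia.
  - assert (HZ1 : (1 <= sZ g)%nat) by (destruct (setup_sizes g Hok); lia).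
    specialize (HB m (sZ g) T Hm HZ1).
    rewrite HN in HT'. cbn [sk g] in HT'.
    assert (HT3 : INR T' <= INR B * (INR (sZ g) * INR (m + T + 1))).
    { rewrite <- !mult_INR. apply le_INR. lia. }
    apply Rle_trans with (1 := HT3). rewrite !Rmult_assoc.
    apply Rmult_le_compat_l; [apply pos_INR|].
    replace (2 - e / 2) with (e / 2 + (2 - e)) by lra. rewrite Rpower_plus.
    specialize (HZ m Hm). fold (sD g) in HZ. 
    set (r := Rpower (INR m) (2 - e)) in *.
    assert (Hr : 1 <= r) by (apply Rpower_ge_1; lra).
    assert (Hmr : INR m <= r).
    { unfold r. rewrite <- (Rpower_1 (INR m)) at 1 by lra. apply Rle_Rpower; lra. }
    assert (Hbd : bd = KT * r).
    { unfold bd, KT, r. rewrite mult_INR, <- Rpower_mult_distr by (simpl; lra).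
      replace (INR 10) with 10 by (simpl; lra). ring. }
    assert (HA : INR (m + T + 1) <= (KT + 3) * r).
    { rewrite !plus_INR. simpl (INR 1).
      rewrite Rmax_right in HT1 by (rewrite Hbd; nra). rewrite Hbd in HT1. nra. }
    apply Rle_trans with ((KZ * Rpower (INR m) (e / 2)) * ((KT + 3) * r)).
    + apply Rmult_le_compat; auto; apply pos_INR.
    + right. ring.
Qed.
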